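(* Let $A$ be a finite dimensional algebra over a field which is Cohen-Macaulay, with dualizing module $W$ and $\operatorname{fidim}A=d$. If $A$ is $d$-Gorenstein, or more generally if $A^{\mathrm{op}}$ is quasi $d$-Gorenstein, then $\operatorname{CM}A=\Omega^d(\operatorname{mod}A)$.
   Context: $\operatorname{mod}A$ is the category of finitely generated right $A$-modules. $\mathcal{P}^{<\infty}(A)$ (respectively $\mathcal{I}^{<\infty}(A)$) is the full subcategory of modules of finite projective (respectively injective) dimension. $A$ is Cohen-Macaulay if there is an $A$-bimodule $W$ (a dualizing module) such that $-\otimes_AW:\mathcal{P}^{<\infty}(A)\to\mathcal{I}^{<\infty}(A)$ and $\operatorname{Hom}_A(W,-):\mathcal{I}^{<\infty}(A)\to\mathcal{P}^{<\infty}(A)$ are quasi-inverse equivalences. $\operatorname{fidim}A:=\sup\{\operatorname{idim}X\mid X\in\mathcal{I}^{<\infty}(A)\}$. $\operatorname{CM}A:=\{X\in\operatorname{mod}A\mid \operatorname{Ext}^i_A(X,W)=0\ \text{for all } i>0\}$. For $X\in\operatorname{mod}A$, $\Omega^n(X)$ is the $n$-th syzygy in a minimal projective resolution, and $\Omega^n(\operatorname{mod}A)$ is the full subcategory of all direct summands of finite direct sums of modules from $\{A\}\cup\{\Omega^n(X)\mid X\in\operatorname{mod}A\}$. Let $0\to A\to I^0(A)\to I^1(A)\to\cdots$ be the minimal injective coresolution of $A$ as a right $A$-module. $A$ is $n$-Gorenstein if $\operatorname{pdim}I^i(A)\le i$ for all $0\le i\le n-1$, and quasi $n$-Gorenstein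 if $\operatorname{pdim}I^i(A)\le i+1$ for all $0\le i\le n-1$; for $A^{\mathrm{op}}$ the conditions are applied to the algebra $A^{\mathrm{op}}$. *)

(* Defs.v *)
From HB Require Import structures.
From mathcomp Require Import all_boot all_order all_algebra all_field.
From mathcomp Require Import boolp classical_sets.

Set Implicit Arguments.
Unset Strict Implicit.
Unset Printing Implicit Defensive.

Import GRing.Theory.
Local Open Scope ring_scope.
Local Open Scope classical_set_scope.
Local Open Scope quotient_scope.

(* A module is an [lmodType R].  Right modules over an algebra A are the
   [lmodType A^c], where A^c is the opposite ring: x . a is [(a : A^c) *: x]. *)

Section Modules.
Variable R : nzRingType.
Implicit Types X Y M N : lmodType R.

Definition finitely_generated M : Prop :=
  exists (n : nat) (g : 'I_n -> M),
    forall x : M, exists c : 'I_n -> R, x = \sum_i c i *: g i.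

Definition is_submodule M (S : set M) : Prop :=
  S 0 /\ forall (a : R) (x y : M), S x -> S y -> S (a *: x + y).

Definition superfluous M (K : set M) : Prop :=
  forall S : set M, is_submodule S ->
    (forall x, exists2 s, S s & K (x - s)) -> S = setT.

Definition essential M (K : set M) : Prop :=
  forall S : set M, is_submodule S -> S `&` K = [set 0] -> S = [set 0].

Definition linear_surj M N (f : {linear M -> N}) : Prop :=
  forall y : N, exists x : M, f x = y.

Definition linear_ker M N (f : {linear M -> N}) : set M := [set x | f x = 0].

Definition projective (P : lmodType R) : Prop :=
  forall M N (f : {linear M -> N}) (g : {linear P -> N}), linear_surj f ->
    exists h : {linear P -> M}, f \o h =1 g.

Definition injective_module (I : lmodType R) : Prop :=
  forall M N (f : {linear M -> N}) (g : {linear M -> I}), injective f ->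
    exists h : {linear N -> I}, h \o f =1 g.

(* [with_aug X C] is the sequence X, C 0, C 1, ...; it lets [proj_resolution]
   treat the augmentation P 0 -> X as the differential of index 0, and
   [inj_coresolution] the coaugmentation X -> I 0. *)
Definition with_aug X (C : nat -> lmodType R) (n : nat) : lmodType R :=
  if n is m.+1 then C m else X.

(* ... -> P 1 -> P 0 -> X -> 0 *)
Record proj_resolution X := ProjResolution {
  pr_obj :> nat -> lmodType R;
  pr_d : forall n, {linear pr_obj n -> with_aug X pr_obj n};
  pr_fg : forall n, finitely_generated (pr_obj n);
  pr_proj : forall n, projective (pr_obj n);
  pr_surj : linear_surj (pr_d 0);
  pr_exact : forall n, linear_ker (pr_d n) = range (pr_d n.+1)
}.

(* 0 -> X -> I 0 -> I 1 -> ... *)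
Record inj_coresolution X := InjCoresolution {
  ic_obj :> nat -> lmodType R;
  ic_d : forall n, {linear with_aug X ic_obj n -> ic_obj n};
  ic_fg : forall n, finitely_generated (ic_obj n);
  ic_inj : forall n, injective_module (ic_obj n);
  ic_injective : injective (ic_d 0);
  ic_exact : forall n, linear_ker (ic_d n.+1) = range (ic_d n)
}.

Definition pr_minimal X (P : proj_resolution X) : Prop :=
  forall n, superfluous (linear_ker (pr_d P n)).

Definition ic_minimal X (I : inj_coresolution X) : Prop :=
  forall n, essential (range (ic_d I n)).

Definition zero_module M : Prop := forall x : M, x = 0.

Definition pdim_le (n : nat) X : Prop :=
  exists P : proj_resolution X, forall i, (n < i)%N -> zero_module (P i).

Definition idim_le (n : nat) X : Prop :=
  exists I : inj_coresolution X, forall i, (n < i)%N -> zero_module (I i).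

Definition finite_pdim X : Prop :=
  finitely_generated X /\ exists n, pdim_le n X.

Definition finite_idim X : Prop :=
  finitely_generated X /\ exists n, idim_le n X.

(* The complex Hom(P, Y) is 0 -> Hom(P 0, Y) -> Hom(P 1, Y) -> ...; the
   augmentation is not part of it. *)
Definition is_cocycle X Y (P : proj_resolution X) n (f : {linear P n -> Y}) :
    Prop :=
  forall x : P n.+1, f (pr_d P n.+1 x) = 0.

Definition is_coboundary X Y (P : proj_resolution X) n :
    {linear P n -> Y} -> Prop :=
  match n with
  | 0 => fun f => forall x, f x = 0
  | m.+1 => fun f =>
      exists g : {linear P m -> Y}, forall x : P m.+1, f x = g (pr_d P m.+1 x)
  end.

(* Ext^n(X, Y) = 0 *)
Definition Ext_vanishes (n : nat) X Y : Prop :=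
  exists P : proj_resolution X,
    forall f : {linear P n -> Y}, is_cocycle f -> is_coboundary f.

(* Y is isomorphic to the n-th syzygy of X, i.e. to the image of the n-th
   differential of a minimal projective resolution (to X itself if n = 0). *)
Definition is_syzygy (n : nat) X Y : Prop :=
  exists P : proj_resolution X, pr_minimal P /\
    exists j : {linear Y -> with_aug X P n},
      injective j /\ range j = range (pr_d P n).

Inductive finite_direct_sum (C : lmodType R -> Prop) : lmodType R -> Prop :=
| fds_nil : finite_direct_sum C 'rV[R]_0
| fds_cons M N : C M -> finite_direct_sum C N ->
    finite_direct_sum C (M * N)%type.

Definition direct_summand X M : Prop :=
  exists (X' : lmodType R) (f : {linear (X * X')%type -> M}), bijective f.

End Modules.

Section AlgebraInvariants.
Variable B : nzRingType.

Definition regular_right : lmodType B^c := (B^c)^o.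

Definition fidim_eq (d : nat) : Prop :=
  (forall X : lmodType B^c, finite_idim X -> idim_le d X) /\
  (forall e, (forall X : lmodType B^c, finite_idim X -> idim_le e X) ->
     (d <= e)%N).

Definition Gorenstein (n : nat) : Prop :=
  exists I : inj_coresolution regular_right,
    ic_minimal I /\ forall i, (i < n)%N -> pdim_le i (I i).

Definition quasi_Gorenstein (n : nat) : Prop :=
  exists I : inj_coresolution regular_right,
    ic_minimal I /\ forall i, (i < n)%N -> pdim_le i.+1 (I i).

Definition Omega_mod (n : nat) (X : lmodType B^c) : Prop :=
  finitely_generated X /\
  exists2 S : lmodType B^c,
    finite_direct_sum
      (fun Y => Y = regular_right \/
         exists Z : lmodType B^c, finitely_generated Z /\ is_syzygy n Z Y) S
    & direct_summand X S.

End AlgebraInvariants.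

(* An A-A-bimodule on which k acts centrally: a right A-module with a left
   action by right A-linear maps. *)
Record bimodule (k : fieldType) (A : falgType k) := Bimodule {
  bimod_right :> lmodType A^c;
  lact : A -> {linear bimod_right -> bimod_right};
  lactD : forall a b w, lact (a + b) w = lact a w + lact b w;
  lact1 : forall w, lact 1 w = w;
  lactM : forall a b w, lact (a * b) w = lact a (lact b w);
  lact_central : forall (c : k) w, lact (c%:A) w = (c%:A : A^c) *: w
}.

Lemma linear_ext (R : nzRingType) (M N : lmodType R) (f g : {linear M -> N}) :
  f =1 g -> f = g.
Proof.
case: f => f [[f1] [f2]]; case: g => g [[g1] [g2]] /= /funext fg.
rewrite fg in f1 f2 *.
by rewrite (Prop_irrelevance f1 g1) (Prop_irrelevance f2 g2).
Qed.

Section HomTensor.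
Variables (k : fieldType) (A : falgType k) (W : bimodule A).

(* Hom_A(W, Y), a right A-module by (f . a) w = f (a w). *)
Definition hom_mod (Y : lmodType A^c) : Type := {linear W -> Y}.

Section HomModule.
Variable Y : lmodType A^c.
Local Notation H := (hom_mod Y).

HB.instance Definition _ := gen_eqMixin H.
HB.instance Definition _ := gen_choiceMixin H.

Definition hom_zero : H := (\0 : W -> Y).
Definition hom_add (f g : H) : H :=
  ((f : {linear W -> Y}) \+ (g : {linear W -> Y})).
Definition hom_opp (f : H) : H := \- (f : {linear W -> Y}).
Definition hom_scale (a : A^c) (f : H) : H :=
  (f : {linear W -> Y}) \o lact W a.

Fact hom_addA : associative hom_add.
Proof. by move=> f g h; apply: linear_ext => w /=; rewrite addrA. Qed.
Fact hom_addC : commutative hom_add.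
Proof. by move=> f g; apply: linear_ext => w /=; rewrite addrC. Qed.
Fact hom_add0 : left_id hom_zero hom_add.
Proof. by move=> f; apply: linear_ext => w /=; rewrite add0r. Qed.
Fact hom_addN : left_inverse hom_zero hom_opp hom_add.
Proof. by move=> f; apply: linear_ext => w /=; rewrite addNr. Qed.

HB.instance Definition _ :=
  GRing.isZmodule.Build H hom_addA hom_addC hom_add0 hom_addN.

Fact hom_scaleA a b f : hom_scale a (hom_scale b f) = hom_scale (a * b) f.
Proof. by apply: linear_ext => w /=; rewrite lactM. Qed.
Fact hom_scale1 : left_id 1 hom_scale.
Proof. by move=> f; apply: linear_ext => w /=; rewrite lact1. Qed.
Fact hom_scaleDr : right_distributive hom_scale +%R.
Proof. by move=> a f g; apply: linear_ext. Qed.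
Fact hom_scaleDl f : {morph hom_scale^~ f : a b / a + b}.
Proof. by move=> a b; apply: linear_ext => w /=; rewrite lactD linearD. Qed.

HB.instance Definition _ :=
  GRing.Zmodule_isLmodule.Build A^c H
    hom_scaleA hom_scale1 hom_scaleDr hom_scaleDl.

End HomModule.

Section HomFunctor.
Variables (Y Y' : lmodType A^c) (g : {linear Y -> Y'}).

Definition hom_map_fun (f : hom_mod Y) : hom_mod Y' :=
  g \o (f : {linear W -> Y}).

Fact hom_map_linear : linear hom_map_fun.
Proof. by move=> a f f'; apply: linear_ext => w /=; rewrite linearD. Qed.

HB.instance Definition _ :=
  GRing.isLinear.Build A^c (hom_mod Y) (hom_mod Y') *:%R hom_map_fun
    hom_map_linear.

Definition hom_map : {linear hom_mod Y -> hom_mod Y'} := hom_map_fun.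

End HomFunctor.

Section TensorRelation.
Variable X : lmodType A^c.

(* X (x)_A W by generators and relations: a list of pairs (x, w) stands for
   the sum of the x (x) w, and [tens_rel] is the congruence generated by the
   defining relations of the tensor product. *)
Inductive tens_rel : seq (X * W) -> seq (X * W) -> Prop :=
| tens_refl s : tens_rel s s
| tens_sym s t : tens_rel s t -> tens_rel t s
| tens_trans s t u : tens_rel s t -> tens_rel t u -> tens_rel s u
| tens_cat s s' t t' : tens_rel s s' -> tens_rel t t' ->
    tens_rel (s ++ t) (s' ++ t')
| tens_comm s t : tens_rel (s ++ t) (t ++ s)
| tens_zero w : tens_rel [:: (0, w)] [::]
| tens_addl x x' w : tens_rel [:: (x + x', w)] [:: (x, w); (x', w)]
| tens_addr x w w' : tens_rel [:: (x, w + w')] [:: (x, w); (x, w')]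
| tens_mid x (a : A) w :
    tens_rel [:: ((a : A^c) *: x, w)] [:: (x, lact W a w)].

End TensorRelation.

Lemma tens_rel_map (X X' : lmodType A^c) (f : X -> X') (h : W -> W) :
    (forall x y, f (x + y) = f x + f y) ->
    (forall a x, f (a *: x) = a *: f x) ->
    (forall v w, h (v + w) = h v + h w) ->
    (forall a w, h (lact W a w) = lact W a (h w)) ->
  forall s t, tens_rel s t ->
    tens_rel [seq (f p.1, h p.2) | p <- s] [seq (f p.1, h p.2) | p <- t].
Proof.
move=> fD fZ hD hZ s t; elim=> {s t}.
- by move=> s; apply: tens_refl.
- by move=> s t _; apply: tens_sym.
- by move=> s t u _ st _; apply: tens_trans st.
- by move=> s s' t t' _ ss' _ tt'; rewrite !map_cat; apply: tens_cat.
- by move=> s t; rewrite !map_cat; apply: tens_comm.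
- by move=> w /=; rewrite -(scale0r (0 : X)) fZ scale0r; apply: tens_zero.
- by move=> x x' w /=; rewrite fD; apply: tens_addl.
- by move=> x w w' /=; rewrite hD; apply: tens_addr.
- by move=> x a w /=; rewrite fZ hZ; apply: tens_mid.
Qed.

Section Tensor.
Variable X : lmodType A^c.
Local Notation tens_rel := (@tens_rel X).

Definition tens_relb (s t : seq (X * W)) : bool := `[< tens_rel s t >].

Fact tens_relb_refl : reflexive tens_relb.
Proof. by move=> s; apply/asboolP; apply: tens_refl. Qed.
Fact tens_relb_sym : symmetric tens_relb.
Proof.
by move=> s t; apply/asboolP/asboolP; apply: tens_sym.
Qed.
Fact tens_relb_trans : transitive tens_relb.
Proof.
move=> t s u /asboolP st /asboolP tu; apply/asboolP.
exact: tens_trans st tu.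
Qed.

Canonical tens_equiv :=
  EquivRel tens_relb tens_relb_refl tens_relb_sym tens_relb_trans.

Definition tensor : Type := {eq_quot tens_equiv}.

HB.instance Definition _ := Choice.on tensor.
HB.instance Definition _ := EqQuotient.on tensor.

Definition tens_class (s : seq (X * W)) : tensor := \pi_tensor s.

Lemma tens_classP s t : tens_class s = tens_class t <-> tens_rel s t.
Proof.
split=> [/eqP|st]; last by apply/eqmodP; apply/asboolP.
by rewrite /tens_class eqmodE => /asboolP.
Qed.

Lemma tens_repr (u : tensor) : tens_class (repr u) = u.
Proof. exact: reprK. Qed.

Lemma tens_reprP s : tens_rel (repr (tens_class s)) s.
Proof. by apply/tens_classP; rewrite tens_repr. Qed.

Definition tens_add (u v : tensor) : tensor := tens_class (repr u ++ repr v).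
Definition tens_opp (u : tensor) : tensor :=
  tens_class [seq (- p.1, p.2) | p <- repr u].
Definition tens_scale (a : A^c) (u : tensor) : tensor :=
  tens_class [seq (p.1, a *: p.2) | p <- repr u].

Lemma tens_ind (T : tensor -> Prop) :
  (forall s, T (tens_class s)) -> forall u, T u.
Proof. by move=> Ts u; rewrite -[u]tens_repr. Qed.

Lemma tens_addE s t :
  tens_add (tens_class s) (tens_class t) = tens_class (s ++ t).
Proof. by apply/tens_classP; apply: tens_cat; apply: tens_reprP. Qed.

Lemma tens_oppE s :
  tens_opp (tens_class s) = tens_class [seq (- p.1, p.2) | p <- s].
Proof.
apply/tens_classP; apply: (tens_rel_map (f := -%R) (h := id)) => //.
- by move=> x y; rewrite opprD.
- by move=> a x; rewrite scalerN.
- exact: tens_reprP.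
Qed.

Lemma tens_scaleE a s :
  tens_scale a (tens_class s) = tens_class [seq (p.1, a *: p.2) | p <- s].
Proof.
apply/tens_classP; apply: (tens_rel_map (f := id) (h := *:%R a)) => //.
- by move=> v w; rewrite scalerDr.
- by move=> b w; rewrite linearZ.
- exact: tens_reprP.
Qed.

Fact tens_addA : associative tens_add.
Proof.
by elim/tens_ind=> s; elim/tens_ind=> t; elim/tens_ind=> u;
   rewrite !tens_addE catA.
Qed.

Fact tens_addC : commutative tens_add.
Proof.
elim/tens_ind=> s; elim/tens_ind=> t; rewrite !tens_addE.
by apply/tens_classP; apply: tens_comm.
Qed.

Fact tens_add0 : left_id (tens_class [::]) tens_add.
Proof. by elim/tens_ind=> s; rewrite tens_addE. Qed.

Fact tens_addN : left_inverse (tens_class [::]) tens_opp tens_add.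
Proof.
elim/tens_ind=> s; rewrite tens_oppE tens_addE.
elim: s => [//|[x w] s IHs] /=.
transitivity (tens_class
  ([:: (- x, w); (x, w)] ++ ([seq (- p.1, p.2) | p <- s] ++ s))).
  apply/tens_classP; apply: (@tens_cat X [:: _] [:: _]); first exact: tens_refl.
  rewrite -[(x, w) :: s]cat1s -[(x, w) :: _ ++ s]cat1s !catA.
  by apply: tens_cat; [apply: tens_comm | apply: tens_refl].
rewrite -tens_addE IHs tens_addE cats0; apply/tens_classP.
apply: tens_trans (tens_zero X w); rewrite -(addNr x).
exact/tens_sym/tens_addl.
Qed.

HB.instance Definition _ :=
  GRing.isZmodule.Build tensor tens_addA tens_addC tens_add0 tens_addN.

Fact tens_scaleA a b u : tens_scale a (tens_scale b u) = tens_scale (a * b) u.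
Proof.
elim/tens_ind: u => s; rewrite !tens_scaleE -map_comp.
by congr tens_class; apply: eq_map => p /=; rewrite scalerA.
Qed.

Fact tens_scale1 : left_id 1 tens_scale.
Proof.
elim/tens_ind=> s; rewrite tens_scaleE; congr tens_class.
by rewrite -[RHS]map_id; apply: eq_map => -[x w] /=; rewrite scale1r.
Qed.

Fact tens_scaleDr : right_distributive tens_scale +%R.
Proof.
move=> a; elim/tens_ind=> s; elim/tens_ind=> t.
by rewrite [_ + _]tens_addE !tens_scaleE [RHS]tens_addE map_cat.
Qed.

Fact tens_scaleDl u : {morph tens_scale^~ u : a b / a + b}.
Proof.
move=> a b /=; elim/tens_ind: u => s; rewrite !tens_scaleE [RHS]tens_addE.
apply/tens_classP; elim: s => [|[x w] s IHs] /=; first exact: tens_refl.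
rewrite scalerDl.
apply: tens_trans (tens_cat (tens_addr _ _ _) IHs) _ => /=.
apply: (@tens_cat X [:: _] [:: _]); first exact: tens_refl.
rewrite -cat1s -[_ :: map _ s]cat1s !catA.
by apply: tens_cat; [apply: tens_comm | apply: tens_refl].
Qed.

HB.instance Definition _ :=
  GRing.Zmodule_isLmodule.Build A^c tensor
    tens_scaleA tens_scale1 tens_scaleDr tens_scaleDl.

Definition tens (x : X) (w : W) : tensor := tens_class [:: (x, w)].

End Tensor.

Section TensorFunctor.
Variables (X X' : lmodType A^c) (f : {linear X -> X'}).

Definition tensor_map_fun (u : tensor X) : tensor X' :=
  tens_class [seq (f p.1, p.2) | p <- repr u].

Lemma tensor_map_class s :
  tensor_map_fun (tens_class s) = tens_class [seq (f p.1, p.2) | p <- s].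
Proof.
apply/tens_classP; apply: (tens_rel_map (f := f) (h := id)) => //.
- by move=> x y; rewrite linearD.
- by move=> a x; rewrite linearZ.
- exact: tens_reprP.
Qed.

Fact tensor_map_linear : linear tensor_map_fun.
Proof.
move=> a; elim/tens_ind=> s; elim/tens_ind=> t.
rewrite [a *: _]tens_scaleE [_ + _]tens_addE !tensor_map_class.
rewrite [a *: _]tens_scaleE [RHS]tens_addE map_cat -!map_comp.
by [].
Qed.

HB.instance Definition _ :=
  GRing.isLinear.Build A^c (tensor X) (tensor X') *:%R tensor_map_fun
    tensor_map_linear.

Definition tensor_map : {linear tensor X -> tensor X'} := tensor_map_fun.

Lemma tensor_map_tens x w : tensor_map (tens x w) = tens (f x) w.
Proof. exact: tensor_map_class. Qed.

End TensorFunctor.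

(* W is a dualizing module: the functors - (x)_A W and Hom_A(W, -) restrict to
   quasi-inverse equivalences between the full subcategories of modules of
   finite projective and finite injective dimension.  The natural isomorphisms
   eta and eps are constrained on these subcategories only. *)
Definition dualizing : Prop :=
  [/\ forall X : lmodType A^c, finite_pdim X -> finite_idim (tensor X),
      forall Y : lmodType A^c, finite_idim Y -> finite_pdim (hom_mod Y),
      exists eta : forall X : lmodType A^c, {linear X -> hom_mod (tensor X)},
        (forall X, finite_pdim X -> bijective (eta X)) /\
        (forall (X X' : lmodType A^c) (f : {linear X -> X'}),
           finite_pdim X -> finite_pdim X' ->
           eta X' \o f =1 hom_map (tensor_map f) \o eta X)
    & exists eps : forall Y : lmodType A^c, {linear tensor (hom_mod Y) -> Y},
        (forall Y, finite_idim Y -> bijective (eps Y)) /\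
        (forall (Y Y' : lmodType A^c) (g : {linear Y -> Y'}),
           finite_idim Y -> finite_idim Y' ->
           g \o eps Y =1 eps Y' \o tensor_map (hom_map g))].

Definition CM (X : lmodType A^c) : Prop :=
  finitely_generated X /\ forall i, (0 < i)%N -> Ext_vanishes i X W.

End HomTensor.

(* Main.v *)
(* Write T = - (x) W and H = Hom(W, -). Although dualizing modules are only
   assumed to induce an equivalence of categories, T is exact on modules of finite
   projective dimension and H on modules of finite injective dimension, because the
   obvious kernels and cokernels again have finite dimension and are killed by the
   other functor. Hence W has finite injective dimension, and
   Ext^n(W, V) = Ext^n(X, V) = 0 for n > 0, V of finite injective dimension and
   X in CM A.
   As idim W <= d, d-th syzygies lie in CM A.

   Conversely, let X be in CM A, and build X = C^0 -> Q^0 -> C^1 -> Q^1 -> ... from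
   left add(A)-approximations C^i -> Q^i with cokernels C^(i+1), so that
   Ext^j(C^i, A) = 0 for 1 <= j <= i. It suffices that C^i -> Q^i is injective, i.e.
   that maps to A separate the points of C^i, for i < d: then X is a d-th syzygy,
   up to projective summands.
   - If A^op is quasi d-Gorenstein, dualizing the coresolution of A^op gives a
     resolution of DA whose first d terms are projective of finite injective
     dimension. By dimension shifting all maps C^i -> DA lift to the first term.
   - If A is d-Gorenstein, put B = I^0 + ... + I^i. A module M with Hom(M, B) = 0 has
     Ext^l(M, A) = 0 for l <= i. The functor H preserves the injectives of projective
     dimension at most i, because Ext^n(H V, A) = Ext^n(V, W); as add B is of finite
     type it is H- and T-stable, so T(I^0) -> T(I^1) -> ... is an injective
     coresolution of W in degrees <= i with terms in add B. Hence Ext^l(M, W) = 0,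
     then Ext^l(M, X) = 0 for l <= i, and finally Hom(M, C^i) = 0. This applies to
     the submodule M of C^i that is killed by all maps to A. *)

Require Import Defs.
From HB Require Import structures.
From mathcomp Require Import all_boot all_order all_algebra all_field.
From mathcomp Require Import boolp classical_sets.

Set Implicit Arguments.
Unset Strict Implicit.
Unset Printing Implicit Defensive.

Import GRing.Theory.
Local Open Scope ring_scope.
Local Open Scope classical_set_scope.


(** * Modules and exact sequences *)

Section Basics.
Variable R : nzRingType.
Implicit Types X Y Z M N K E P Q B U V L I J F : lmodType R.

Section MkLinear.
Variables (M N : lmodType R) (f : M -> N) (lf : linear f).
(** The proof is a phantom argument, so that the canonical linear structure can be recovered from
    the term. [subm_pred], [scalars] and [dual] use the same device. *)
Definition mklin_fun of linear f := f.
HB.instance Definition _ :=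
  GRing.isLinear.Build R M N *:%R (mklin_fun lf) lf.
Definition mklin : {linear M -> N} := mklin_fun lf.
Lemma mklinE x : mklin x = f x. Proof. by []. Qed.
End MkLinear.

Lemma linP M N (f : M -> N) : linear f -> exists g : {linear M -> N}, g =1 f.
Proof. by move=> lf; exists (mklin lf). Qed.

Lemma lin_sum M N B n (f : 'I_n -> {linear M -> B})
    (g : 'I_n -> {linear B -> N}) :
  exists h : {linear M -> N}, forall x, h x = \sum_j g j (f j x).
Proof.
apply: linP => a x y; rewrite scaler_sumr -big_split /=.
by apply: eq_bigr => j _; rewrite !linearP.
Qed.

Lemma lin_sub M N (f g : {linear M -> N}) :
  exists h : {linear M -> N}, forall x, h x = f x - g x.
Proof.
apply: linP => a x y; rewrite !linearP /= scalerBr.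
by rewrite scalerN addrACA.
Qed.

Section Submodule.
Variables (M : lmodType R) (S : set M) (S_sub : is_submodule S).
Definition subm_pred of is_submodule S : {pred M} := fun x => `[< S x >].

Fact subm_pred_closed : submod_closed (subm_pred S_sub).
Proof.
case: (S_sub) => S0 SP; split=> [|a x y /asboolP Sx /asboolP Sy].
  exact/asboolP.
by apply/asboolP; exact: SP.
Qed.
HB.instance Definition _ :=
  GRing.isSubmodClosed.Build R M (subm_pred S_sub) subm_pred_closed.

Definition submod := {x | x \in subm_pred S_sub}.
HB.instance Definition _ := [isSub of submod for @sval _ _].
HB.instance Definition _ := [Choice of submod by <:].
HB.instance Definition _ := [SubChoice_isSubLmodule of submod by <:].

Lemma submod_exists : exists K (i : {linear K -> M}),
  injective i /\ forall x, S x <-> exists y, i y = x.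
Proof.
exists submod, (val : {linear submod -> M}); split; first exact: val_inj.
move=> x; split=> [Sx|[[y Sy] <-]]; last exact/asboolP.
by exists (exist _ x (asboolT Sx)).
Qed.

Definition quotm := Quotient.quot (subm_pred S_sub).
HB.instance Definition _ := GRing.Zmodule.on quotm.
HB.instance Definition _ := EqQuotient.on quotm.

Definition quotm_pi (x : M) : quotm := (\pi_quotm x)%qT.
Lemma quotm_piP x y : quotm_pi x = quotm_pi y <-> S (x - y).
Proof.
split=> [/eqP|Sxy]; rewrite /quotm_pi.
  by rewrite -Quotient.idealrBE => /asboolP.
by apply/eqP; rewrite -Quotient.idealrBE; apply/asboolP.
Qed.
Lemma quotm_ex (u : quotm) : exists x, quotm_pi x = u.
Proof. by exists (repr u); rewrite /quotm_pi reprK. Qed.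
Lemma quotm_piD : {morph quotm_pi : x y / x + y}.
Proof. by move=> x y; rewrite /quotm_pi !piE. Qed.

Definition quotm_scale (a : R) (u : quotm) : quotm := quotm_pi (a *: repr u).
Lemma quotm_scaleE a x : quotm_scale a (quotm_pi x) = quotm_pi (a *: x).
Proof.
apply/quotm_piP; rewrite -scalerBr.
have /quotm_piP : quotm_pi (repr (quotm_pi x)) = quotm_pi x.
  by rewrite {1}/quotm_pi reprK.
by case: S_sub => S0 SP /(SP a _ 0)/(_ S0); rewrite addr0.
Qed.
Fact quotm_scaleA a b u : quotm_scale a (quotm_scale b u) = quotm_scale (a * b) u.
Proof. by have [x <-] := quotm_ex u; rewrite !quotm_scaleE scalerA. Qed.
Fact quotm_scale1 : left_id 1 quotm_scale.
Proof. by move=> u; have [x <-] := quotm_ex u; rewrite quotm_scaleE scale1r. Qed.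
Fact quotm_scaleDr : right_distributive quotm_scale +%R.
Proof.
move=> a u v; have [x <-] := quotm_ex u; have [y <-] := quotm_ex v.
by rewrite -quotm_piD !quotm_scaleE -quotm_piD scalerDr.
Qed.
Fact quotm_scaleDl u : {morph quotm_scale^~ u : a b / a + b}.
Proof.
by move=> a b; have [x <-] := quotm_ex u; rewrite !quotm_scaleE -quotm_piD scalerDl.
Qed.
HB.instance Definition _ := GRing.Zmodule_isLmodule.Build R quotm
  quotm_scaleA quotm_scale1 quotm_scaleDr quotm_scaleDl.

Lemma quotm_exists : exists Q (p : {linear M -> Q}),
  linear_surj p /\ forall x, p x = 0 <-> S x.
Proof.
have lp : linear quotm_pi.
  by move=> a x y; rewrite quotm_piD -quotm_scaleE.
have p0 : quotm_pi 0 = 0 by apply: (addrI (quotm_pi 0)); rewrite -quotm_piD !addr0.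
exists quotm, (mklin lp); split=> [u|x]; first exact: quotm_ex.
by rewrite mklinE -p0 quotm_piP subr0.
Qed.
End Submodule.

End Basics.


(** * Short exact sequences, retracts of finite powers, and Ext^1 *)

Section Sequences.
Variable R : nzRingType.
Implicit Types X Y Z M N K E P Q B U V L I J F : lmodType R.

Definition ses X Y Z (i : {linear X -> Y}) (p : {linear Y -> Z}) : Prop :=
  [/\ injective i, linear_surj p & forall y, p y = 0 <-> exists x, i x = y].

Lemma lin_inj M N (f : {linear M -> N}) :
  (forall x, f x = 0 -> x = 0) -> injective f.
Proof.
move=> f0 x y fxy; apply/eqP; rewrite -subr_eq0; apply/eqP/f0.
by rewrite linearB fxy subrr.
Qed.

Lemma inj_eq0 M N (f : {linear M -> N}) x : injective f -> f x = 0 -> x = 0.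
Proof. by move=> fI fx; apply: fI; rewrite fx linear0. Qed.

Lemma lin_factor M N Q (p : {linear M -> Q}) (f : {linear M -> N}) :
  linear_surj p -> (forall x, p x = 0 -> f x = 0) ->
  exists g : {linear Q -> N}, forall x, g (p x) = f x.
Proof.
move=> pS pf; have [s sK] := choice pS.
have gE x : f (s (p x)) = f x.
  by apply/eqP; rewrite -subr_eq0 -linearB pf // linearB sK subrr.
have gl : linear (f \o s).
  move=> a u v; rewrite -{1}[u]sK -{1}[v]sK -linearP /= gE.
  by rewrite linearP.
by have [g gE'] := linP gl; exists g => x; rewrite gE' /= gE.
Qed.

Lemma lin_colift M N K (i : {linear K -> N}) (f : {linear M -> N}) :
  injective i -> (forall x, exists y, i y = f x) ->
  exists g : {linear M -> K}, forall x, i (g x) = f x.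
Proof.
move=> iI /choice [g gE].
have gl : linear g by move=> a x y; apply: iI; rewrite linearP !gE linearP.
by have [h hE] := linP gl; exists h => x; rewrite hE gE.
Qed.

Lemma ker_sub M N (f : {linear M -> N}) : is_submodule (linear_ker f).
Proof.
split=> [|a x y]; rewrite /linear_ker /= ?linear0 // linearP => -> ->.
by rewrite scaler0 addr0.
Qed.

Lemma im_sub M N (f : {linear M -> N}) : is_submodule (range f).
Proof.
split; first by exists 0; rewrite ?linear0.
by move=> a _ _ [x _ <-] [y _ <-]; exists (a *: x + y); rewrite ?linearP.
Qed.

Lemma ses_ker M N (p : {linear M -> N}) : linear_surj p ->
  exists K (i : {linear K -> M}), ses i p.
Proof.
move=> pS; have [K [i [iI iE]]] := submod_exists (ker_sub p).
by exists K, i; split.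
Qed.

Lemma ses_coker M N (i : {linear M -> N}) : injective i ->
  exists Q (p : {linear N -> Q}), ses i p.
Proof.
move=> iI; have [Q [p [pS pE]]] := quotm_exists (im_sub i).
exists Q, p; split=> // y; rewrite pE.
by split=> [[x _ <-]|[x <-]]; exists x.
Qed.

Lemma lin_image M N (f : {linear M -> N}) : exists I (p : {linear M -> I})
  (j : {linear I -> N}), [/\ linear_surj p, injective j & forall x, j (p x) = f x].
Proof.
have [I [j [jI jE]]] := submod_exists (im_sub f).
have [x|p pE] := lin_colift (f := f) jI; first by apply/jE; exists x.
exists I, p, j; split=> // y.
have [|x _ fx] := (jE (j y)).2; first by exists y.
by exists x; apply: jI; rewrite pE fx.
Qed.

Lemma ses_comp0 X Y Z (i : {linear X -> Y}) (p : {linear Y -> Z}) x :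
  ses i p -> p (i x) = 0.
Proof. by case=> _ _ ->; exists x. Qed.

Lemma lin_biject M N (f : {linear M -> N}) :
  injective f -> linear_surj f -> bijective f.
Proof.
move=> fI /choice [g gK]; exists g => // x; apply: fI.
by rewrite gK.
Qed.

(* B^r for a finite number r of copies, without the object B^r: N is a retract
   of a finite power of B. *)
Definition addm B N : Prop := exists r (f : 'I_r -> {linear N -> B})
  (g : 'I_r -> {linear B -> N}), forall x, x = \sum_j g j (f j x).

Lemma addm_retract B N (f : {linear N -> B}) (g : {linear B -> N}) :
  (forall x, g (f x) = x) -> addm B N.
Proof. by move=> gf; exists 1, (fun=> f), (fun=> g) => x; rewrite big_ord1 gf. Qed.

Lemma addm_refl B : addm B B.
Proof. exact: (@addm_retract _ _ idfun idfun). Qed.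

Lemma addm_iso M N (f : {linear M -> N}) : bijective f -> addm M N /\ addm N M.
Proof.
move=> [g fK gK].
have gl : linear g by move=> a x y; apply: (can_inj fK); rewrite linearP !gK.
have [h hE] := linP gl.
by split; [apply: (@addm_retract _ _ h f)|apply: (@addm_retract _ _ f h)] => x;
  rewrite hE.
Qed.

Lemma addm_trans B N M : addm B N -> addm N M -> addm B M.
Proof.
move=> [r [f [g fg]]] [s [f' [g' fg']]].
pose h (l : 'I_#|{: 'I_s * 'I_r}|) := enum_val l.
exists #|{: 'I_s * 'I_r}|, (fun l => f (h l).2 \o f' (h l).1),
  (fun l => g' (h l).1 \o g (h l).2) => x.
rewrite {1}[x]fg'.
transitivity (\sum_(p : 'I_s * 'I_r) g' p.1 (g p.2 (f p.2 (f' p.1 x)))).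
  rewrite -(pair_bigA _ (fun i j => g' i (g j (f j (f' i x))))) /=.
  by apply: eq_bigr => i _; rewrite -linear_sum -fg.
rewrite -(big_enum_val (fun p : 'I_s * 'I_r => g' p.1 (g p.2 (f p.2 (f' p.1 x))))).
exact: eq_bigl.
Qed.

Section Power.
Variables (B : lmodType R) (n : nat).
Definition pow_proj_fun (j : 'I_n) (v : {ffun 'I_n -> B}) := v j.
Fact pow_proj_lin j : linear (pow_proj_fun j).
Proof. by move=> a v w; rewrite /pow_proj_fun !ffunE. Qed.
Definition pow_proj j := mklin (pow_proj_lin j).
Definition pow_inj_fun (j : 'I_n) (b : B) : {ffun 'I_n -> B} :=
  [ffun l => if l == j then b else 0].
Fact pow_inj_lin j : linear (pow_inj_fun j).
Proof.
move=> a v w; apply/ffunP => l; rewrite !ffunE.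
by case: eqP => // _; rewrite scaler0 addr0.
Qed.
Definition pow_inj j := mklin (pow_inj_lin j).
Lemma pow_sum (v : {ffun 'I_n -> B}) : v = \sum_j pow_inj j (pow_proj j v).
Proof.
apply/ffunP => l; rewrite sum_ffunE (bigD1 l) //= big1 ?addr0 => [|j jl].
  by rewrite ffunE eqxx.
by rewrite ffunE eq_sym (negbTE jl).
Qed.
Lemma addm_pow : addm B {ffun 'I_n -> B}.
Proof. by exists n, pow_proj, pow_inj; exact: pow_sum. Qed.
End Power.

Lemma pow_tuple M B n (f : 'I_n -> {linear M -> B}) :
  exists F : {linear M -> {ffun 'I_n -> B}}, forall x j, F x j = f j x.
Proof.
have [|F FE] := @linP _ _ _ (fun x => [ffun j => f j x] : {ffun 'I_n -> B}).
  by move=> a x y; apply/ffunP => j; rewrite !ffunE linearP.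
by exists F => x j; rewrite FE ffunE.
Qed.

Lemma fg_surj M N (f : {linear M -> N}) : linear_surj f ->
  finitely_generated M -> finitely_generated N.
Proof.
move=> fS [n [g gE]]; exists n, (f \o g) => y.
have [x <-] := fS y; have [c {1}->] := gE x; exists c.
by rewrite linear_sum; apply: eq_bigr => i _; rewrite linearZ.
Qed.

Lemma fg_addm B N : addm B N -> finitely_generated B -> finitely_generated N.
Proof.
move=> [r [f [g fg]]] [n [e eE]].
pose h (l : 'I_#|{: 'I_r * 'I_n}|) := enum_val l.
exists #|{: 'I_r * 'I_n}|, (fun l => g (h l).1 (e (h l).2)) => x.
have [c cE] := choice (fun j => eE (f j x)).
exists (fun l => c (h l).1 (h l).2); rewrite {1}[x]fg.
transitivity (\sum_(p : 'I_r * 'I_n) c p.1 p.2 *: g p.1 (e p.2)).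
  rewrite -(pair_bigA _ (fun i j => c i j *: g i (e j))) /=.
  apply: eq_bigr => i _; rewrite {1}[f i x]cE linear_sum.
  by apply: eq_bigr => j _; rewrite linearZ.
rewrite -(big_enum_val (fun p : 'I_r * 'I_n => c p.1 p.2 *: g p.1 (e p.2))).
exact: eq_bigl.
Qed.

Lemma fg_regular : finitely_generated (R^o : lmodType R).
Proof. 
by exists 1, (fun=> 1) => x; exists (fun=> x); rewrite big_ord1 /GRing.scale /= mulr1.
Qed.

Lemma fg_pow B n : finitely_generated B -> finitely_generated {ffun 'I_n -> B}.
Proof. exact/fg_addm/addm_pow. Qed.

Lemma scale_lin M (x : M) : linear (fun a : R^o => a *: x).
Proof. by move=> a b c; rewrite scalerDl -scalerA. Qed.

Lemma projective_regular : projective (R^o : lmodType R).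
Proof.
move=> M N f g fS; have [x fx] := fS (g 1).
exists (mklin (scale_lin x)) => a /=; rewrite mklinE linearZ /= fx -linearZ.
by congr (g _); rewrite /GRing.scale /= mulr1.
Qed.

Lemma projective_addm B N : addm B N -> projective B -> projective N.
Proof.
move=> [r [f [g fg]]] Bp M M' p h pS.
have [l lE] := choice (fun j => Bp _ _ p (h \o g j) pS).
have [t tE] := lin_sum f l.
exists t => x /=; rewrite tE linear_sum {2}[x]fg linear_sum.
by apply: eq_bigr => j _; exact: lE.
Qed.

Lemma injective_addm B N : addm B N -> injective_module B -> injective_module N.
Proof.
move=> [r [f [g fg]]] Bi M M' i h iI.
have [l lE] := choice (fun j => Bi _ _ i (f j \o h) iI).
have [t tE] := lin_sum l g.
exists t => x /=; rewrite tE [RHS]fg.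
by apply: eq_bigr => j _; congr (g j _); exact: lE.
Qed.

Lemma projective_pow n : projective ({ffun 'I_n -> R^o} : lmodType R).
Proof. exact/projective_addm/projective_regular/addm_pow. Qed.

Lemma free_cover M : finitely_generated M ->
  exists n (p : {linear {ffun 'I_n -> R^o} -> M}), linear_surj p.
Proof.
move=> [n [g gE]].
have [h hE] := lin_sum (fun j : 'I_n => pow_proj (R^o : lmodType R) j)
  (fun j => mklin (scale_lin (g j))).
exists n, h => y; have [c cE] := gE y; exists [ffun j => c j].
rewrite hE cE; apply: eq_bigr => j _.
by rewrite mklinE /= mklinE /pow_proj_fun ffunE.
Qed.

Lemma projective_lift P X E (p : {linear E -> X}) (h : {linear P -> X}) :
  projective P -> linear_surj p ->
  exists g : {linear P -> E}, forall x, p (g x) = h x.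
Proof. by move=> Pp pS; have [g gE] := Pp _ _ p h pS; exists g. Qed.

Lemma injective_extend J X E (i : {linear X -> E}) (h : {linear X -> J}) :
  injective_module J -> injective i ->
  exists g : {linear E -> J}, forall x, g (i x) = h x.
Proof. by move=> Ji iI; have [g gE] := Ji _ _ i h iI; exists g. Qed.

Lemma addm_projective P : finitely_generated P -> projective P ->
  addm (R^o : lmodType R) P.
Proof.
move=> /free_cover[n [p pS]] Pp.
have [s sE] := projective_lift idfun Pp pS.
exact/(addm_trans (@addm_pow _ n))/(addm_retract sE).
Qed.

(* Ext^1(X, Y) = 0: the pushout of any extension by X along K -> Y splits. *)
Definition ext1 X Y : Prop :=
  forall K E (i : {linear K -> E}) (p : {linear E -> X}), ses i p ->
  forall f : {linear K -> Y}, exists g : {linear E -> Y}, forall x, g (i x) = f x.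

(** The pullback [Pb] of [q] along [h] is an extension of [X] by [Y], so it has a retraction [r];
    the difference of [fst \o j] and [i \o r] vanishes on [Y] and descends to [X]. *)
Lemma ext1_lift X Y : ext1 X Y ->
  forall E Z (i : {linear Y -> E}) (q : {linear E -> Z}), ses i q ->
  forall h : {linear X -> Z}, exists g : {linear X -> E}, forall x, q (g x) = h x.
Proof.
move=> XY E Z i q iq h.
have [iI qS qE] := iq.
have Ss : is_submodule [set u : E * X | q u.1 = h u.2].
  split=> [|a u v]; rewrite /= ?linear0 // !linearP => -> ->.
  by rewrite ?linearP.
have [Pb [j [jI jE]]] := submod_exists Ss.
have [|s sE] := @lin_colift _ _ _ j
  (mklin (f := fun y : Y => (i y, 0 : X))
    (fun a x y => congr2 pair (linearP i a x y)
      (esym (etrans (addr0 _) (scaler0 _ a))))) jI.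
  move=> y; apply/jE => /=; rewrite linear0; apply/qE; by exists y.
pose p : {linear Pb -> X} := snd \o j.
have sp : ses s p.
  split.
  - by move=> y y' /(congr1 j); rewrite !sE /= => -[/iI].
  - move=> x; have [e qe] := qS (h x).
    by have [u uE] := (jE (e, x)).1 qe; exists u; rewrite /p /= uE.
  - move=> u; split=> [pu|[y <-]]; last by rewrite /p /= sE.
    have [|y yE] := (qE (j u).1).1.
      have /jE -> : exists y, j y = j u by exists u.
      by move: pu; rewrite /p /= => ->; rewrite linear0.
    exists y; apply: jI; rewrite sE mklinE.
    by move: yE pu; rewrite /p /=; case: (j u) => a b /= -> ->.
have [r rE] := XY _ _ _ _ sp idfun.
have [d dE] := lin_sub (fst \o j : {linear Pb -> E}) (i \o r : {linear Pb -> E}).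
have [_ pS pE] := sp.
have [u /pE[y <-]|g gE] := lin_factor (f := d) pS.
  by rewrite dE /= sE rE /= subrr.
exists g => x; have [u <-] := pS x; rewrite gE dE linearB /=.
have /jE -> : exists y, j y = j u by exists u.
by rewrite (ses_comp0 _ iq) subr0.
Qed.

(** One projective presentation tests all extensions: the middle term [E] of any other is a quotient
    of [P * K'], and [g] on [P] together with [f] on [K'] passes to that quotient. *)
Lemma ext1_proj X Y K P (i : {linear K -> P}) (p : {linear P -> X}) :
  ses i p -> projective P ->
  (ext1 X Y <-> forall f : {linear K -> Y}, exists g : {linear P -> Y},
     forall x, g (i x) = f x).
Proof.
move=> ip Pp; split=> [XY f|H]; first exact: (XY _ _ _ _ ip).
have [iI pS pE] := ip.
move=> K' E j q jq f; have [jI qS qE] := jq.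
have [h hE] := projective_lift p Pp qS.
have [|h' h'E] := @lin_colift _ _ _ j (h \o i) jI.
  by move=> x; apply/qE; rewrite /= hE (ses_comp0 _ ip).
have [g gE] := H (f \o h').
have sl : linear (fun u : P * K' => h u.1 + j u.2).
  by move=> a u v; rewrite !linearP /= scalerDr addrACA.
have tl : linear (fun u : P * K' => g u.1 + f u.2).
  by move=> a u v; rewrite !linearP /= scalerDr addrACA.
have [e|[x k]|t tE] := @lin_factor _ _ _ (mklin sl) (mklin tl).
- have [x xE] := pS (q e); have /qE[k kE] : q (e - h x) = 0.
    by rewrite linearB hE xE subrr.
  by exists (x, k); rewrite mklinE /= kE addrC subrK.
- rewrite !mklinE /= => hk.
  have /pE[y yE] : p x = 0.
    by rewrite -hE -[h x](addrK (j k)) hk sub0r linearN (ses_comp0 _ jq) oppr0.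
  have <- : - h' y = k.
    by apply: jI; rewrite linearN h'E /= yE; apply/eqP; rewrite eq_sym -addr_eq0 addrC hk.
  by rewrite -yE gE linearN subrr.
exists t => k; have := tE (0, k).
by rewrite !mklinE /= !linear0 !add0r.
Qed.

Lemma ext1_inj X Y J Z (i : {linear Y -> J}) (q : {linear J -> Z}) :
  ses i q -> injective_module J ->
  (ext1 X Y <-> forall h : {linear X -> Z}, exists g : {linear X -> J},
     forall x, q (g x) = h x).
Proof.
move=> iq Jinj; split=> [XY h|H]; first exact: (ext1_lift XY iq).
have [iI qS qE] := iq.
move=> K E j p jp f; have [jI pS pE] := jp.
have [h hE] := injective_extend (i \o f) Jinj jI.
have [x /pE[k <-]|h' h'E] := lin_factor (f := q \o h) pS.
  by rewrite /= hE (ses_comp0 _ iq).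
have [g gE] := H h'.
have [t tE] := lin_sub h (g \o p).
have [e|s sE] := @lin_colift _ _ _ i t iI.
  by apply/qE; rewrite tE linearB /= gE h'E subrr.
exists s => k; apply: iI.
by rewrite sE tE hE /= (ses_comp0 _ jp) linear0 subr0.
Qed.

Lemma ext1_projl P Y : projective P -> ext1 P Y.
Proof.
move=> Pp; apply/(@ext1_proj _ _ 'rV[R]_0 P (\0) idfun) => //.
  split=> [x y _| y|y]; last split=> [/= ->|[x <-]] //.
  - by rewrite [x]thinmx0 [y]thinmx0.
  - by exists y.
  - by exists 0.
by move=> f; exists (\0 : {linear P -> Y}) => x; rewrite [x]thinmx0 /= [RHS]linear0.
Qed.

Lemma ext1_injr X J : injective_module J -> ext1 X J.
Proof. by move=> Ji K E i p [iI _ _] f; exact: injective_extend. Qed.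

End Sequences.


(** * Vanishing of Ext *)

Definition Noetherian (R : nzRingType) : Prop :=
  forall (M N : lmodType R) (i : {linear N -> M}),
    injective i -> finitely_generated M -> finitely_generated N.

Definition enough_injectives (R : nzRingType) : Prop :=
  forall M : lmodType R, finitely_generated M ->
  exists (J : lmodType R) (i : {linear M -> J}),
    [/\ finitely_generated J, injective_module J & injective i].

Section ExtTheory.
Variable R : nzRingType.
Implicit Types X Y Z M N K E P Q B U V L I J F : lmodType R.
Hypothesis R_noeth : Noetherian R.
Hypothesis R_einj : enough_injectives R.

(* Ext^n(X, Y) = 0, defined by shifting the first argument down to n = 1 *)
Fixpoint Ext0 (n : nat) X Y {struct n} : Prop :=
  match n with
  | 0 => forall (f : {linear X -> Y}) x, f x = 0
  | m.+1 => match m with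
    | 0 => ext1 X Y
    | _.+1 => exists K P (i : {linear K -> P}) (p : {linear P -> X}),
        [/\ ses i p, finitely_generated P, projective P & Ext0 m K Y]
    end
  end.

Lemma cover X : finitely_generated X ->
  exists K P (i : {linear K -> P}) (p : {linear P -> X}),
    [/\ ses i p, finitely_generated P, projective P, finitely_generated K
      & addm (R^o : lmodType R) P].
Proof.
move=> /free_cover[n [p pS]]; have [K [i ip]] := ses_ker pS.
have Ff := @fg_pow R _ n (fg_regular R).
exists K, {ffun 'I_n -> R^o}, i, p; split=> //.
- exact: projective_pow.
- by have [iI _ _] := ip; exact: R_noeth iI Ff.
- exact: addm_pow.
Qed.

Lemma hull Y : finitely_generated Y ->
  exists J Z (i : {linear Y -> J}) (q : {linear J -> Z}),
    [/\ ses i q, finitely_generated J, injective_module J & finitely_generated Z].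
Proof.
move=> /R_einj[J [i [Jf Ji iI]]]; have [Z [q iq]] := ses_coker iI.
exists J, Z, i, q; split=> //; have [_ qS _] := iq; exact: fg_surj Jf.
Qed.

Lemma ses_fgl X Y Z (i : {linear X -> Y}) (p : {linear Y -> Z}) :
  ses i p -> finitely_generated Y -> finitely_generated X.
Proof. by case=> iI _ _; exact: R_noeth iI. Qed.

Lemma ses_fgr X Y Z (i : {linear X -> Y}) (p : {linear Y -> Z}) :
  ses i p -> finitely_generated Y -> finitely_generated Z.
Proof. by case=> _ pS _; exact: fg_surj. Qed.

(** For [n = 0] both sides amount to every map K -> Z factoring as K -> P -> J -> Z; above that, the
    shift passes to the first syzygy of [X]. *)
Lemma Ext0_shiftr n X Y J Z (i : {linear Y -> J}) (q : {linear J -> Z}) :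
  finitely_generated X -> ses i q -> injective_module J ->
  (Ext0 n.+1 X Z <-> Ext0 n.+2 X Y).
Proof.
move=> Xf iq Ji; elim: n X Xf => [|n IHn] X Xf; last first.
  split=> -[K [P [j [p [jp Pf Pp EK]]]]]; exists K, P, j, p; split=> //;
    exact/(IHn K (ses_fgl jp Pf)).
have H K P (j : {linear K -> P}) (p : {linear P -> X}) : ses j p -> projective P ->
    (ext1 X Z <-> ext1 K Y).
  move=> jp Pp; rewrite (ext1_proj _ jp Pp) (ext1_inj _ iq Ji).
  have [iI qS qE] := iq; have [jI pS pE] := jp.
  split=> EX h.
    have [g gE] := EX h; have [g' g'E] := projective_lift g Pp qS.
    by exists (g' \o j) => x; rewrite /= g'E gE.
  have [g gE] := EX h; have [g' g'E] := injective_extend g Ji jI.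
  by exists (q \o g') => x; rewrite /= g'E gE.
split=> [EX|[K [P [j [p [jp Pf Pp EK]]]]]]; last exact/(H _ _ _ _ jp Pp).
have [K [P [j [p [jp Pf Pp Kf _]]]]] := cover Xf.
by exists K, P, j, p; split=> //; exact/(H _ _ _ _ jp Pp).
Qed.

(** [Ext0] only provides some presentation of its first argument; embedding [Y] into an injective
    and shifting on that side shows that every presentation gives the same answer. *)
Lemma Ext0_shiftl n X Y K P (i : {linear K -> P}) (p : {linear P -> X}) :
  finitely_generated Y -> ses i p -> finitely_generated P -> projective P ->
  (Ext0 n.+1 K Y <-> Ext0 n.+2 X Y).
Proof.
move=> + ip Pf Pp; elim: n Y => [|n IHn] Y Yf;
  have [J [Z [j [q [jq Jf Ji Zf]]]]] := hull Yf;
  have Xf := ses_fgr ip Pf; have Kf := ses_fgl ip Pf; last first.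
  by rewrite -(Ext0_shiftr _ Kf jq Ji) IHn // -(Ext0_shiftr _ Xf jq Ji).
split=> [EK|EX]; first by exists K, P, i, p.
have /(Ext0_shiftr 0 Xf jq Ji) E1 := EX.
rewrite /= (ext1_inj _ jq Ji) => h.
have [g gE] := (ext1_proj _ ip Pp).1 E1 h.
have [_ qS _] := jq; have [g' g'E] := projective_lift g Pp qS.
by exists (g' \o i) => x; rewrite /= g'E gE.
Qed.

Lemma Ext0_projl n P Y : finitely_generated P -> finitely_generated Y ->
  projective P -> Ext0 n.+1 P Y.
Proof.
move=> Pf + Pp; elim: n Y => [|n IHn] Y Yf; first exact: ext1_projl.
have [J [Z [j [q [jq Jf Ji Zf]]]]] := hull Yf.
exact/(Ext0_shiftr n Pf jq Ji)/IHn.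
Qed.

Lemma Ext0_injr n X J : finitely_generated X -> injective_module J -> Ext0 n.+1 X J.
Proof.
move=> + Ji; elim: n X => [|n IHn] X Xf; first exact: ext1_injr.
have [K [P [i [p [ip Pf Pp Kf _]]]]] := cover Xf.
by exists K, P, i, p; split=> //; exact: IHn.
Qed.

Lemma Ext0_addr n X B N : addm B N -> Ext0 n X B -> Ext0 n X N.
Proof.
move=> BN; have [r [f [g fg]]] := BN; elim: n X => [|[|n] IHn] X EB.
- by move=> h x; rewrite [h x]fg big1 // => j _; rewrite -[f j _]/((f j \o h) x) EB linear0.
- move=> K E i p ip h.
  have [t tE] := choice (fun j => EB _ _ _ _ ip (f j \o h)).
  have [s sE] := lin_sum t g.
  exists s => x; rewrite sE [RHS]fg; apply: eq_bigr => j _.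
  by rewrite tE.
- by have [K [P [i [p [ip Pf Pp EK]]]]] := EB; exists K, P, i, p; split=> //; exact: IHn.
Qed.

Lemma Ext0_addl n Y B N : finitely_generated B -> finitely_generated Y ->
  addm B N -> Ext0 n B Y -> Ext0 n N Y.
Proof.
move=> Bf + BN; have Nf := fg_addm BN Bf.
have [r [f [g fg]]] := BN; elim: n Y => [|[|n] IHn] Y Yf EB.
- move=> h x; rewrite [x]fg linear_sum big1 // => j _.
  by rewrite -[h _]/((h \o g j) _) EB.
- have [J [Z [i [q [iq Jf Ji Zf]]]]] := hull Yf.
  rewrite /= (ext1_inj _ iq Ji) => h.
  have [t tE] := choice (fun j => ext1_lift EB iq (h \o g j)).
  have [s sE] := lin_sum f t.
  exists s => x; rewrite sE linear_sum [x in RHS]fg linear_sum.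
  by apply: eq_bigr => j _; rewrite tE.
- have [J [Z [i [q [iq Jf Ji Zf]]]]] := hull Yf.
  apply/(Ext0_shiftr _ Nf iq Ji); apply: IHn => //.
  exact/(Ext0_shiftr _ Bf iq Ji).
Qed.

Section SecondVariable.
Variables (Y' Y Y'' : lmodType R) (i : {linear Y' -> Y}) (q : {linear Y -> Y''}).
Hypotheses (iq : ses i q) (Yf : finitely_generated Y).

Lemma Ext0_quotr n X : finitely_generated X ->
  Ext0 n X Y -> Ext0 n.+1 X Y' -> Ext0 n X Y''.
Proof.
have Yf' := ses_fgl iq Yf; have Yf'' := ses_fgr iq Yf.
elim: n X => [|n IHn] X Xf.
  move=> E0 E1 f x; have [g <-] := ext1_lift E1 iq f.
  by rewrite E0 linear0.
have [K [P [j [p [jp Pf Pp Kf _]]]]] := cover Xf.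
case: n IHn => [_ E1|n IHn]; rewrite -(Ext0_shiftl _ Yf' jp Pf Pp).
  move=> EK; rewrite /= (ext1_proj _ jp Pp) => f.
  have [g gE] := ext1_lift EK iq f; have [h hE] := (ext1_proj _ jp Pp).1 E1 g.
  by exists (q \o h) => x; rewrite /= hE gE.
rewrite -(Ext0_shiftl _ Yf jp Pf Pp) -(Ext0_shiftl _ Yf'' jp Pf Pp).
exact: IHn.
Qed.

(** An extension [g] of [i \o f] to [P] induces a map X -> Y''; subtracting a lift of it makes [g]
    land in [Y']. The first two degrees of [Ext0_subr] share this argument. *)
Lemma ext1_subr_lift X : finitely_generated X -> ext1 X Y ->
  (forall h : {linear X -> Y''}, exists g : {linear X -> Y},
     forall x, q (g x) = h x) -> ext1 X Y'.
Proof.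
have [iI qS qE] := iq.
move=> /cover[K [P [j [p [jp Pf Pp Kf _]]]]] E1 H.
have [jI pS pE] := jp.
rewrite (ext1_proj _ jp Pp) => f; have [g gE] := (ext1_proj _ jp Pp).1 E1 (i \o f).
have [x /pE[y <-]|h hE] := lin_factor (f := q \o g) pS.
  by rewrite /= gE (ses_comp0 _ iq).
have [h' h'E] := H h; have [t tE] := lin_sub g (h' \o p).
have [x|s sE] := lin_colift (f := t) iI.
  by apply/qE; rewrite tE linearB /= h'E hE subrr.
exists s => x; apply: iI.
by rewrite sE tE gE /= (ses_comp0 _ jp) linear0 subr0.
Qed.

Lemma Ext0_subr n X : finitely_generated X ->
  Ext0 n X Y'' -> Ext0 n.+1 X Y -> Ext0 n.+1 X Y'.
Proof.
have Yf' := ses_fgl iq Yf; have Yf'' := ses_fgr iq Yf.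
elim: n X => [|n IHn] X Xf.
  move=> E0 E1; apply: ext1_subr_lift => // h.
  by exists (\0 : {linear X -> Y}) => x; rewrite E0 linear0.
have [K [P [j [p [jp Pf Pp Kf _]]]]] := cover Xf.
rewrite -(Ext0_shiftl _ Yf' jp Pf Pp) -(Ext0_shiftl _ Yf jp Pf Pp).
case: n IHn => [_ E1 EK|n IHn]; last first.
  by rewrite -(Ext0_shiftl _ Yf'' jp Pf Pp); exact: IHn.
apply: ext1_subr_lift => // h.
have [g gE] := (ext1_proj _ jp Pp).1 E1 h.
have [_ qS _] := iq; have [g' g'E] := projective_lift g Pp qS.
by exists (g' \o j) => x; rewrite /= g'E gE.
Qed.

End SecondVariable.

Section FirstVariable.
Variables (X' X X'' : lmodType R) (i : {linear X' -> X}) (p : {linear X -> X''}).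
Hypotheses (ip : ses i p) (Xf : finitely_generated X).

Lemma Ext0_subl n Y : finitely_generated Y ->
  Ext0 n.+1 X Y -> Ext0 n.+2 X'' Y -> Ext0 n.+1 X' Y.
Proof.
have Xf' := ses_fgl ip Xf; have Xf'' := ses_fgr ip Xf.
elim: n Y => [|n IHn] Y Yf;
  have [J [Z [j [q [jq Jf Ji Zf]]]]] := hull Yf;
  rewrite -(Ext0_shiftr _ Xf'' jq Ji); last first.
  by rewrite -(Ext0_shiftr _ Xf' jq Ji) -(Ext0_shiftr _ Xf jq Ji); exact: IHn.
move=> E1 E2; rewrite /= (ext1_inj _ jq Ji) => f.
have [g gE] := E2 _ _ _ _ ip f; have [h hE] := ext1_lift E1 jq g.
by exists (h \o i) => x; rewrite /= hE gE.
Qed.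

(** Dual to [ext1_subr_lift]: a lift of [f \o p] to [J] maps [X'] into [Y], and an extension of this
    map to [X] is the correction. *)
Lemma ext1_quotl_extend Y : finitely_generated Y -> ext1 X Y ->
  (forall f : {linear X' -> Y}, exists g : {linear X -> Y},
     forall x, g (i x) = f x) -> ext1 X'' Y.
Proof.
have [iI pS pE] := ip.
move=> /hull[J [Z [j [q [jq Jf Ji Zf]]]]] E1 H; have [jI qS qE] := jq.
rewrite (ext1_inj _ jq Ji) => f.
have [g gE] := ext1_lift E1 jq (f \o p).
have [x|h hE] := lin_colift (f := g \o i) jI.
  by apply/qE; rewrite /= gE /= (ses_comp0 _ ip) linear0.
have [h' h'E] := H h; have [t tE] := lin_sub g (j \o h').
have [x /pE[y <-]|s sE] := lin_factor (f := t) pS.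
  by rewrite tE /= h'E hE subrr.
exists s => y; have [x <-] := pS y.
by rewrite sE tE linearB gE /= (ses_comp0 _ jq) subr0.
Qed.

Lemma Ext0_quotl n Y : finitely_generated Y ->
  Ext0 n.+1 X' Y -> Ext0 n.+2 X Y -> Ext0 n.+2 X'' Y.
Proof.
have Xf' := ses_fgl ip Xf; have Xf'' := ses_fgr ip Xf.
elim: n Y => [|n IHn] Y Yf;
  have [J [Z [j [q [jq Jf Ji Zf]]]]] := hull Yf;
  rewrite -(Ext0_shiftr _ Xf'' jq Ji) -(Ext0_shiftr _ Xf jq Ji); last first.
  by rewrite -(Ext0_shiftr _ Xf' jq Ji); exact: IHn.
move=> E1 E2; apply: ext1_quotl_extend => // f.
have [g gE] := ext1_lift E1 jq f; have [iI _ _] := ip.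
have [h hE] := injective_extend g Ji iI.
by exists (q \o h) => x; rewrite /= hE gE.
Qed.

End FirstVariable.

End ExtTheory.


(** * Resolutions and homological dimensions *)

Section Resolutions.
Variable R : nzRingType.
Implicit Types X Y Z M N K E Q B U V L J F : lmodType R.

Section ProjectiveShift.
Variables (X : lmodType R) (P : proj_resolution X) (K : lmodType R).
Variables (i : {linear K -> P 0}) (e : {linear P 1 -> K}).
Hypotheses (ip : ses i (pr_d P 0)) (eE : forall x, i (e x) = pr_d P 1 x).

Definition pr_shift_d n :
    {linear P n.+1 -> with_aug K (fun n => P n.+1) n} :=
  match n with 0 => e | m.+1 => pr_d P m.+2 end.

Fact pr_shift_surj : linear_surj (pr_shift_d 0).
Proof.
have [iI _ _] := ip => y.
have : linear_ker (pr_d P 0) (i y) by apply: ses_comp0 ip.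
by rewrite pr_exact => -[x _ xy]; exists x; apply: iI; rewrite eE.
Qed.

Fact pr_shift_exact n :
  linear_ker (pr_shift_d n) = range (pr_shift_d n.+1).
Proof.
case: n => [|n]; last exact: (pr_exact P n.+2).
rewrite /= -(pr_exact P 1) /linear_ker; apply/predeqP => x /=.
rewrite -eE; split=> [->|]; first by rewrite linear0.
by apply: inj_eq0; case: ip.
Qed.

Definition pr_shift : proj_resolution K :=
  ProjResolution (fun n => pr_fg P n.+1) (fun n => @pr_proj _ _ P n.+1)
    pr_shift_surj pr_shift_exact.
End ProjectiveShift.

Lemma pr_shift_exists X (P : proj_resolution X) :
  exists K (i : {linear K -> P 0}) (e : {linear P 1 -> K}),
    ses i (pr_d P 0) /\ forall x, i (e x) = pr_d P 1 x.
Proof.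
have [K [i ip]] := ses_ker (@pr_surj _ _ P); have [iI _ iE] := ip.
have [x|e eE] := lin_colift (f := pr_d P 1 : {linear P 1 -> P 0}) iI.
  by apply/iE; rewrite -[_ = 0]/(linear_ker (pr_d P 0) _) pr_exact; exists x.
by exists K, i, e.
Qed.

Section ProjectiveSplice.
Variables (X K Q : lmodType R) (i : {linear K -> Q}) (p : {linear Q -> X}).
Hypotheses (ip : ses i p) (Qf : finitely_generated Q) (Qp : projective Q).
Variable P : proj_resolution K.

Definition pr_splice_d n :
    {linear with_aug Q P n -> with_aug X (with_aug Q P) n} :=
  match n with
  | 0 => p
  | m.+1 => match m return {linear P m -> with_aug Q P m} with
            | 0 => i \o pr_d P 0
            | l.+1 => pr_d P l.+1
            end
  end.

Fact pr_splice_fg n : finitely_generated (with_aug Q P n).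
Proof. by case: n => //= n; exact: pr_fg. Qed.
Fact pr_splice_proj n : projective (with_aug Q P n).
Proof. by case: n => //= n; exact: pr_proj. Qed.
Fact pr_splice_surj : linear_surj (pr_splice_d 0).
Proof. by case: ip. Qed.
Fact pr_splice_exact n :
  linear_ker (pr_splice_d n) = range (pr_splice_d n.+1).
Proof.
have [iI _ pE] := ip.
case: n => [|[|n]]; last exact: (pr_exact P n.+1).
- apply/predeqP => x; rewrite /linear_ker /= pE; split.
    by case=> y <-; have [z <-] := @pr_surj _ _ P y; exists z.
  by case=> z _ <-; exists (pr_d P 0 z).
- rewrite /= -(pr_exact P 0) /linear_ker; apply/predeqP => x /=.
  by split=> [|->]; [exact: inj_eq0|rewrite linear0].
Qed.

Definition pr_splice : proj_resolution X :=
  ProjResolution pr_splice_fg pr_splice_proj pr_splice_surj pr_splice_exact.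
End ProjectiveSplice.

Lemma rV0_projective : projective ('rV[R]_0 : lmodType R).
Proof.
move=> M N f g _; exists (\0 : {linear 'rV[R]_0 -> M}) => x /=.
by rewrite [x]thinmx0 !linear0.
Qed.

Lemma rV0_injective : injective_module ('rV[R]_0 : lmodType R).
Proof.
move=> M N f g _; exists (\0 : {linear N -> 'rV[R]_0}) => x /=.
by rewrite [g x]thinmx0.
Qed.

Lemma rV0_fg : finitely_generated ('rV[R]_0 : lmodType R).
Proof.
by exists 0, (fun=> 0) => x; exists (fun=> 0); rewrite [x]thinmx0 big_ord0.
Qed.

Lemma pdim_le_splice n X K Q (i : {linear K -> Q}) (p : {linear Q -> X}) :
  ses i p -> finitely_generated Q -> projective Q -> pdim_le n K ->
  pdim_le n.+1 X.
Proof.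
move=> ip Qf Qp [P P0]; exists (pr_splice ip Qf Qp P) => -[//|m] mn x /=.
exact: P0.
Qed.

Lemma pdim_le_projective U n : finitely_generated U -> projective U ->
  pdim_le n U.
Proof.
move=> Uf Up; pose C m := if m is _.+1 then 'rV[R]_0 : lmodType R else U.
pose d m : {linear C m -> with_aug U C m} :=
  match m with 0 => idfun | _ => \0 end.
have Cf m : finitely_generated (C m) by case: m => //= _; exact: rV0_fg.
have Cp m : projective (C m) by case: m => //= _; exact: rV0_projective.
have dS : linear_surj (d 0) by move=> x; exists x.
have dE m : linear_ker (d m) = range (d m.+1).
  apply/predeqP => x; case: m x => [|m] x; rewrite /linear_ker /=.
    by split=> [->|[y _ <-]] //; exists 0.
  by split=> // _; exists 0; rewrite // [x]thinmx0.
by exists (ProjResolution Cf Cp dS dE) => -[//|m] mn x; rewrite [x]thinmx0.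
Qed.

Section InjectiveShift.
Variables (X : lmodType R) (I : inj_coresolution X) (Y : lmodType R).
Variables (q : {linear I 0 -> Y}) (e : {linear Y -> I 1}).
Hypotheses (iq : ses (ic_d I 0) q) (eE : forall x, e (q x) = ic_d I 1 x).

Definition ic_shift_d n :
    {linear with_aug Y (fun n => I n.+1) n -> I n.+1} :=
  match n with 0 => e | m.+1 => ic_d I m.+2 end.

Fact ic_shift_injective : injective (ic_shift_d 0).
Proof.
have [_ qS qE] := iq; apply: lin_inj => y; have [x <-] := qS y.
rewrite /= eE => Ix; apply/qE.
have : linear_ker (ic_d I 1) x by [].
by rewrite ic_exact => -[z _ <-]; exists z.
Qed.

Fact ic_shift_exact n :
  linear_ker (ic_shift_d n.+1) = range (ic_shift_d n).
Proof.
have [_ qS _] := iq.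
case: n => [|n]; last exact: (ic_exact I n.+2).
rewrite [LHS](ic_exact I 1); apply/predeqP => x; split=> -[y _ <-].
  by exists (q y); rewrite //= eE.
by have [z <-] := qS y; exists z; rewrite //= eE.
Qed.

Definition ic_shift : inj_coresolution Y :=
  InjCoresolution (fun n => ic_fg I n.+1) (fun n => @ic_inj _ _ I n.+1)
    ic_shift_injective ic_shift_exact.
End InjectiveShift.

Lemma ic_shift_exists X (I : inj_coresolution X) :
  exists Y (q : {linear I 0 -> Y}) (e : {linear Y -> I 1}),
    ses (ic_d I 0) q /\ forall x, e (q x) = ic_d I 1 x.
Proof.
have [Y [q iq]] := ses_coker (@ic_injective _ _ I); have [_ qS qE] := iq.
have [x /qE[y <-]|e eE] := lin_factor (f := ic_d I 1 : {linear I 0 -> I 1}) qS.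
  suff : linear_ker (ic_d I 1) (ic_d I 0 y) by [].
  by rewrite ic_exact; exists y.
by exists Y, q, e.
Qed.

Section InjectiveSplice.
Variables (X J Y : lmodType R) (i : {linear X -> J}) (q : {linear J -> Y}).
Hypotheses (iq : ses i q) (Jf : finitely_generated J) (Ji : injective_module J).
Variable I : inj_coresolution Y.

Definition ic_splice_d n :
    {linear with_aug X (with_aug J I) n -> with_aug J I n} :=
  match n with
  | 0 => i
  | m.+1 => match m return {linear with_aug J I m -> I m} with
            | 0 => ic_d I 0 \o q
            | l.+1 => ic_d I l.+1
            end
  end.

Fact ic_splice_fg n : finitely_generated (with_aug J I n).
Proof. by case: n => //= n; exact: ic_fg. Qed.
Fact ic_splice_inj n : injective_module (with_aug J I n).
Proof. by case: n => //= n; exact: ic_inj. Qed.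
Fact ic_splice_injective : injective (ic_splice_d 0).
Proof. by case: iq. Qed.
Fact ic_splice_exact n :
  linear_ker (ic_splice_d n.+1) = range (ic_splice_d n).
Proof.
have [_ qS qE] := iq.
case: n => [|[|n]]; last exact: (ic_exact I n.+1).
- apply/predeqP => x; rewrite /linear_ker /=.
  split=> [/(inj_eq0 (@ic_injective _ _ I))/qE[y <-]|[y _ <-]]; first by exists y.
  by rewrite (ses_comp0 _ iq) linear0.
- rewrite [LHS](ic_exact I 0); apply/predeqP => x; split=> -[y _ <-].
    by have [z <-] := qS y; exists z.
  by exists (q y).
Qed.

Definition ic_splice : inj_coresolution X :=
  InjCoresolution ic_splice_fg ic_splice_inj ic_splice_injective ic_splice_exact.
End InjectiveSplice.

Lemma idim_le_splice n X J Y (i : {linear X -> J}) (q : {linear J -> Y}) :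
  ses i q -> finitely_generated J -> injective_module J -> idim_le n Y ->
  idim_le n.+1 X.
Proof.
move=> iq Jf Ji [I I0]; exists (ic_splice iq Jf Ji I) => -[//|m] mn x /=.
exact: I0.
Qed.

Lemma idim_le_injective V n : finitely_generated V -> injective_module V ->
  idim_le n V.
Proof.
move=> Vf Vi; pose C m := if m is _.+1 then 'rV[R]_0 : lmodType R else V.
pose d m : {linear with_aug V C m -> C m} :=
  match m with 0 => idfun | _ => \0 end.
have Cf m : finitely_generated (C m) by case: m => //= _; exact: rV0_fg.
have Ci m : injective_module (C m) by case: m => //= _; exact: rV0_injective.
have dI : injective (d 0) by [].
have dE m : linear_ker (d m.+1) = range (d m).
  apply/predeqP => x; case: m x => [|m] x; rewrite /linear_ker /=.
    by split=> // _; exists x.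
  by split=> // _; exists 0; rewrite // [x]thinmx0.
by exists (InjCoresolution Cf Ci dI dE) => -[//|m] mn x; rewrite [x]thinmx0.
Qed.

Lemma split_retract X Y Z (i : {linear X -> Y}) (p : {linear Y -> Z}) (r : {linear Y -> X}) :
  ses i p -> (forall x, r (i x) = x) ->
  exists s : {linear Z -> Y}, forall z, p (s z) = z.
Proof.
move=> ip ri; have [iI pS pE] := ip; have [t tE] := lin_sub idfun (i \o r).
have [y /pE[x <-]|s sE] := lin_factor (f := t) pS.
  by rewrite tE /= ri subrr.
exists s => z; have [y <-] := pS z.
by rewrite sE tE linearB /= (ses_comp0 _ ip) subr0.
Qed.

Hypothesis R_noeth : Noetherian R.
Hypothesis R_einj : enough_injectives R.

Lemma Ext0_of_pdim_le n U Y : pdim_le n U -> finitely_generated Y -> Ext0 n.+1 U Y.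
Proof.
move=> [P P0] Yf; elim: n U P P0 => [|n IHn] U P P0;
  have [K [i [e [ip eE]]]] := pr_shift_exists P; have [iI pS pE] := ip.
  apply: ext1_projl.
  have d0I : injective (pr_d P 0).
    apply: lin_inj => x /pE[y <-].
    by rewrite (_ : y = 0) ?linear0 //; have [z <-] := pr_shift_surj ip eE y;
      rewrite [z](P0 1%N) // linear0.
  have [+ _] := addm_iso (lin_biject d0I pS).
  by move=> /projective_addm; apply; exact: pr_proj.
apply/(Ext0_shiftl R_noeth R_einj n Yf ip (pr_fg P 0) (@pr_proj _ _ P 0)).
by apply: (IHn K (pr_shift ip eE)) => m mn; exact: P0.
Qed.

Lemma Ext0_of_idim_le n V X : idim_le n V -> finitely_generated X -> Ext0 n.+1 X V.
Proof.
move=> [I I0] Xf; elim: n V I I0 => [|n IHn] V I I0;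
  have [Y [q [e [iq eE]]]] := ic_shift_exists I; have [iI qS qE] := iq.
  apply: ext1_injr.
  have d0S : linear_surj (ic_d I 0).
    move=> x; apply/qE; apply: (ic_shift_injective iq eE).
    by rewrite [LHS](I0 1%N) // linear0.
  have [_ +] := addm_iso (lin_biject iI d0S).
  by move=> /injective_addm; apply; exact: ic_inj.
apply/(Ext0_shiftr R_noeth n Xf iq (@ic_inj _ _ I 0)).
by apply: (IHn Y (ic_shift iq eE)) => m mn; exact: I0.
Qed.

Lemma pdim_le_of_Ext0 n U : finitely_generated U ->
  (forall Y, finitely_generated Y -> Ext0 n.+1 U Y) -> pdim_le n U.
Proof.
elim: n U => [|n IHn] U Uf EU;
  have [K [P [i [p [ip Pf Pp Kf _]]]]] := cover R_noeth Uf.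
  apply: pdim_le_projective => //.
  have [r rE] := EU K Kf _ _ _ _ ip idfun.
  have [s sE] := split_retract ip rE.
  exact: projective_addm (addm_retract sE) Pp.
apply: (pdim_le_splice ip Pf Pp); apply: IHn => // Y Yf.
exact/(Ext0_shiftl R_noeth R_einj n Yf ip Pf Pp)/EU.
Qed.

Lemma idim_le_of_Ext0 n V : finitely_generated V ->
  (forall X, finitely_generated X -> Ext0 n.+1 X V) -> idim_le n V.
Proof.
elim: n V => [|n IHn] V Vf EV;
  have [J [Z [i [q [iq Jf Ji Zf]]]]] := hull R_einj Vf.
  apply: idim_le_injective => //.
  have [r rE] := EV Z Zf _ _ _ _ iq idfun.
  exact: injective_addm (addm_retract rE) Ji.
apply: (idim_le_splice iq Jf Ji); apply: IHn => // X Xf.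
exact/(Ext0_shiftr R_noeth n Xf iq Ji)/EV.
Qed.

(** Connects [Ext0] with [Ext_vanishes] for any resolution. Truncation reduces to degree 1, where
    cocycles on [P 1] are maps on the syzygy and coboundaries are those that extend to [P 0]. *)
Lemma Ext0_resolution n X Y (P : proj_resolution X) : finitely_generated Y ->
  (Ext0 n.+1 X Y <->
   forall f : {linear P n.+1 -> Y}, is_cocycle f -> is_coboundary f).
Proof.
move=> Yf; elim: n X P => [|n IHn] X P;
  have [K [i [e [ip eE]]]] := pr_shift_exists P; last first.
  rewrite -(Ext0_shiftl R_noeth R_einj n Yf ip (pr_fg P 0) (@pr_proj _ _ P 0)).
  exact: (IHn K (pr_shift ip eE)).
have eS := pr_shift_surj ip eE; have [iI _ _] := ip.
rewrite /= (ext1_proj _ ip (@pr_proj _ _ P 0)); split=> H f.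
  move=> fc; have [x ex|g gE] := lin_factor (f := f) eS.
    have : linear_ker (pr_d P 1) x by rewrite /linear_ker /= -eE ex linear0.
    by rewrite pr_exact => -[y _ <-]; exact: fc.
  by have [h hE] := H g; exists h => x; rewrite -eE hE gE.
have [|g gE] := H (f \o e).
  move=> x /=; rewrite (_ : e _ = 0) ?linear0 //; apply: iI; rewrite eE linear0.
  suff : linear_ker (pr_d P 1) (pr_d P 2 x) by [].
  by rewrite pr_exact; exists x.
by exists g => y; have [x <-] := eS y; rewrite eE -gE.
Qed.

End Resolutions.


(** * Closure properties of finite projective and finite injective dimension *)

Section FiniteDimension.
Variable R : nzRingType.
Implicit Types X Y Z M N K E Q B U V L J F P C : lmodType R.
Hypothesis R_noeth : Noetherian R.
Hypothesis R_einj : enough_injectives R.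

Lemma pdim_le_mono m n U : (m <= n)%N -> pdim_le m U -> pdim_le n U.
Proof.
move=> mn [P P0]; exists P => i ni; apply: P0; exact: leq_ltn_trans ni.
Qed.

Lemma idim_le_mono m n U : (m <= n)%N -> idim_le m U -> idim_le n U.
Proof.
move=> mn [P P0]; exists P => i ni; apply: P0; exact: leq_ltn_trans ni.
Qed.

Section FinP.
Variables (X Y Z : lmodType R) (i : {linear X -> Y}) (p : {linear Y -> Z}).
Hypothesis ip : ses i p.

Lemma finite_pdim_quot : finite_pdim X -> finite_pdim Y -> finite_pdim Z.
Proof.
move=> [Xf [m Xm]] [Yf [n Yn]]; have Zf := ses_fgr ip Yf.
split=> //; exists (maxn m n).+1; apply: pdim_le_of_Ext0 => // V Vf.
apply: (Ext0_quotl R_noeth R_einj ip Yf Vf).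
  by apply: Ext0_of_pdim_le => //; apply: pdim_le_mono Xm; exact: leq_maxl.
apply: Ext0_of_pdim_le => //; apply: pdim_le_mono Yn.
exact/leqW/leq_maxr.
Qed.

Lemma finite_pdim_sub : finite_pdim Y -> finite_pdim Z -> finite_pdim X.
Proof.
move=> [Yf [m Ym]] [Zf [n Zn]]; have Xf := ses_fgl R_noeth ip Yf.
split=> //; exists (maxn m n); apply: pdim_le_of_Ext0 => // V Vf.
apply: (Ext0_subl R_noeth R_einj ip Yf Vf).
  by apply: Ext0_of_pdim_le => //; apply: pdim_le_mono Ym; exact: leq_maxl.
apply: Ext0_of_pdim_le => //; apply: pdim_le_mono Zn.
exact/leqW/leq_maxr.
Qed.

Lemma finite_idim_sub : finite_idim Y -> finite_idim Z -> finite_idim X.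
Proof.
move=> [Yf [m Ym]] [Zf [n Zn]]; have Xf := ses_fgl R_noeth ip Yf.
split=> //; exists (maxn m n).+1; apply: idim_le_of_Ext0 => // V Vf.
apply: (Ext0_subr R_noeth R_einj ip Yf Vf).
  by apply: Ext0_of_idim_le => //; apply: idim_le_mono Zn; exact: leq_maxr.
apply: Ext0_of_idim_le => //; apply: idim_le_mono Ym.
exact/leqW/leq_maxl.
Qed.

Lemma finite_idim_quot : finite_idim X -> finite_idim Y -> finite_idim Z.
Proof.
move=> [Xf [m Xm]] [Yf [n Yn]]; have Zf := ses_fgr ip Yf.
split=> //; exists (maxn m n); apply: idim_le_of_Ext0 => // V Vf.
apply: (Ext0_quotr R_noeth R_einj ip Yf Vf).
  by apply: Ext0_of_idim_le => //; apply: idim_le_mono Yn; exact: leq_maxr.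
apply: Ext0_of_idim_le => //; apply: idim_le_mono Xm.
exact/leqW/leq_maxl.
Qed.
End FinP.

Lemma pdim_le_addm n B N : finitely_generated B -> addm B N -> pdim_le n B ->
  pdim_le n N.
Proof.
move=> Bf BN Bn; apply: pdim_le_of_Ext0 => // [|Y Yf]; first exact: fg_addm BN _.
by apply: Ext0_addl BN _ => //; exact: Ext0_of_pdim_le.
Qed.

Lemma idim_le_addm n B N : finitely_generated B -> addm B N -> idim_le n B ->
  idim_le n N.
Proof.
move=> Bf BN Bn; apply: idim_le_of_Ext0 => // [|Y Yf]; first exact: fg_addm BN _.
by apply: Ext0_addr BN _ => //; exact: Ext0_of_idim_le.
Qed.

Lemma finite_pdim_addm B N : addm B N -> finite_pdim B -> finite_pdim N.
Proof.
move=> BN [Bf [n Bn]]; split; first exact: fg_addm BN _.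
by exists n; exact: pdim_le_addm BN _.
Qed.

Lemma finite_idim_addm B N : addm B N -> finite_idim B -> finite_idim N.
Proof.
move=> BN [Bf [n Bn]]; split; first exact: fg_addm BN _.
by exists n; exact: idim_le_addm BN _.
Qed.

Lemma finite_pdim_proj U : finitely_generated U -> projective U -> finite_pdim U.
Proof. by move=> Uf Up; split=> //; exists 0; exact: pdim_le_projective. Qed.

Lemma finite_idim_inj U : finitely_generated U -> injective_module U -> finite_idim U.
Proof. by move=> Uf Up; split=> //; exists 0; exact: idim_le_injective. Qed.

Lemma pdim_le0_projective U : finitely_generated U -> pdim_le 0 U -> projective U.
Proof.
move=> Uf U0; have [K [P [i [p [ip Pf Pp Kf _]]]]] := cover R_noeth Uf.
have [r rE] := Ext0_of_pdim_le R_noeth R_einj U0 Kf _ _ _ _ ip idfun.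
have [s sE] := split_retract ip rE.
exact: projective_addm (addm_retract sE) Pp.
Qed.

Lemma pdim_le_syzygy n U K P (i : {linear K -> P}) (p : {linear P -> U}) :
  ses i p -> finitely_generated P -> projective P -> pdim_le n.+1 U ->
  pdim_le n K.
Proof.
move=> ip Pf Pp Un; have Kf := ses_fgl R_noeth ip Pf.
apply: (pdim_le_of_Ext0 R_noeth R_einj) => // Y Yf.
apply/(Ext0_shiftl R_noeth R_einj n Yf ip Pf Pp).
exact: Ext0_of_pdim_le.
Qed.

End FiniteDimension.

(** * The functors T = - (x) W and H = Hom(W, -) *)

Section TensorHom.
Variables (k : fieldType) (A : falgType k) (W : bimodule A).
Local Notation R := A^c.
Implicit Types X Y Z M N K E Q B U V L J F : lmodType R.
Local Notation T := (tensor W).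
Local Notation H := (hom_mod W).
Local Notation Tm := (tensor_map W).
Local Notation Hm := (hom_map W).

Lemma tens_class_sum X (s : seq (X * W)) :
  tens_class s = \sum_(p <- s) tens p.1 p.2.
Proof.
elim: s => [|[x w] s IHs]; first by rewrite big_nil.
by rewrite big_cons -IHs /= [RHS]tens_addE.
Qed.

Lemma tens_span X Z (f g : {linear T X -> Z}) :
  (forall x w, f (tens x w) = g (tens x w)) -> f =1 g.
Proof.
move=> fg; elim/tens_ind => s; rewrite tens_class_sum !linear_sum.
by apply: eq_bigr => p _; exact: fg.
Qed.

Lemma tensDl X (x y : X) (w : W) : tens (x + y) w = tens x w + tens y w.
Proof. by rewrite [RHS]tens_addE; apply/tens_classP; exact: tens_addl. Qed.

Lemma tens_lin X (x : X) : linear (fun w : W => tens x w : T X).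
Proof.
move=> a v w; rewrite -[a *: tens x v]/(tens_scale a (tens_class [:: (x, v)])).
rewrite tens_scaleE [RHS]tens_addE.
by apply/tens_classP; exact: tens_addr.
Qed.

Lemma tens_middle X (a : R) (x : X) (w : W) : tens (a *: x) w = tens x (lact W a w).
Proof. exact/tens_classP/tens_mid. Qed.

(** One direction of the adjunction between T and H: a list of pairs is evaluated termwise, and [eP]
    checks the generating relations. [tens_curry] is the other direction. *)
Lemma tens_lift X Z (g : {linear X -> H Z}) :
  exists h : {linear T X -> Z},
    forall x w, h (tens x w) = (g x : {linear W -> Z}) w.
Proof.
pose e (s : seq (X * W)) := \sum_(p <- s) (g p.1 : {linear W -> Z}) p.2.
have eP s t : tens_rel s t -> e s = e t.
  elim=> {s t} //.
  - by move=> s t u _ -> _ ->.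
  - by move=> s s' t t' _ E _ E'; rewrite /e !big_cat /= -/(e s) -/(e t) E E'.
  - by move=> s t; rewrite /e !big_cat /= addrC.
  - by move=> w; rewrite /e big_seq1 big_nil linear0.
  - by move=> x x' w; rewrite /e !big_cons !big_nil linearD !addr0.
  - by move=> x w w'; rewrite /e !big_cons !big_nil linearD !addr0.
  - by move=> x a w; rewrite /e !big_seq1 /= linearZ.
pose h (u : T X) := e (repr u).
have hE s : h (tens_class s) = e s by apply: eP; exact: tens_reprP.
have hl : linear h.
  move=> a; elim/tens_ind => s; elim/tens_ind => t.
  rewrite -[a *: tens_class s]/(tens_scale a (tens_class s)) tens_scaleE.
  rewrite [_ + _ in LHS]tens_addE !hE /e big_cat big_map /=; congr (_ + _).
  rewrite scaler_sumr; apply: eq_bigr => p _.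
  by rewrite linearZ.
by exists (mklin hl) => x w; rewrite mklinE hE /e big_seq1.
Qed.

Lemma tens_curry X Z (q : {linear T X -> Z}) : exists g : {linear X -> H Z},
  forall x w, (g x : {linear W -> Z}) w = q (tens x w).
Proof.
have ql x : linear (fun w => q (tens x w)).
  by move=> a v w; rewrite tens_lin linearP.
have gl : linear (fun x => mklin (ql x) : H Z).
  move=> a x y; apply: linear_ext => w.
  by rewrite /= !mklinE tensDl linearD tens_middle.
by exists (mklin gl) => x w; rewrite mklinE.
Qed.

Lemma tensor_mapE X Y (f : {linear X -> Y}) (s : seq (X * W)) :
  Tm f (tens_class s) = tens_class [seq (f p.1, p.2) | p <- s].
Proof. exact: tensor_map_class. Qed.

Lemma tensor_map_comp X Y Z (f : {linear X -> Y}) (g : {linear Y -> Z}) u :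
  Tm g (Tm f u) = Tm (g \o f) u.
Proof.
by elim/tens_ind: u => s; rewrite !tensor_mapE -map_comp.
Qed.

Lemma tensor_map_id X (f : {linear X -> X}) u : f =1 id -> Tm f u = u.
Proof.
move=> f1; elim/tens_ind: u => s; rewrite tensor_mapE.
by congr tens_class; rewrite -[RHS]map_id; apply: eq_map => -[x w] /=; rewrite f1.
Qed.

Lemma tensor_map0 X Y (f : {linear X -> Y}) u : (forall x, f x = 0) -> Tm f u = 0.
Proof.
move=> f0; rewrite -[RHS]/((\0 : {linear T X -> T Y}) u); apply: tens_span => x w.
rewrite tensor_map_tens f0 /=.
by apply: (addrI (tens 0 w)); rewrite -tensDl !addr0.
Qed.

Lemma tensor_addm B N : addm B N -> addm (T B) (T N).
Proof.
move=> [r [f [g fg]]]; exists r, (fun j => Tm (f j)), (fun j => Tm (g j)).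
have [h hE] := lin_sum (fun j => Tm (f j)) (fun j => Tm (g j)).
move=> u; rewrite -hE -[LHS]/(idfun u).
apply: tens_span => x w; rewrite hE /= {1}[x]fg.
have tl : {morph (fun x : N => tens x w : T N) : x y / x + y}.
  by move=> y z; exact: tensDl.
have t0 : tens (0 : N) w = 0 by apply: (addrI (tens 0 w)); rewrite -tensDl !addr0.
rewrite (big_morph _ tl t0); apply: eq_bigr => j _.
by rewrite !tensor_map_tens.
Qed.

Lemma hom_addm B N : addm B N -> addm (H B) (H N).
Proof.
move=> [r [f [g fg]]]; exists r, (fun j => Hm (f j)), (fun j => Hm (g j)).
move=> u; apply: linear_ext => w.
have E (v : 'I_r -> H N) : ((\sum_j v j : H N) : {linear W -> N}) w
    = \sum_j (v j : {linear W -> N}) w.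
  by elim/big_rec2: _ => // j y1 y2 _ <-.
by rewrite E [LHS]fg.
Qed.

Lemma tensor_regular : exists h : {linear W -> T (R^o)}, bijective h.
Proof.
have gl : linear (fun a : R^o => lact W a : H W).
  by move=> a b c; apply: linear_ext => w; rewrite /= lactD lactM.
have [h hE] := tens_lift (mklin gl).
exists (mklin (@tens_lin (R^o) 1)); exists h => [w|u].
  by rewrite hE !mklinE lact1.
rewrite -[LHS]/((mklin (@tens_lin (R^o) 1) \o h) u) -[RHS]/(idfun u).
apply: tens_span => x w /=; rewrite hE !mklinE /= -tens_middle.
by congr tens; rewrite /GRing.scale /= mulr1.
Qed.

Section TensorExact.
Variables (X Y Z : lmodType R) (i : {linear X -> Y}) (p : {linear Y -> Z}).
Hypothesis ip : ses i p.

Lemma tensor_map_surj : linear_surj (Tm p).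
Proof.
have [_ /choice[s sK] _] := ip.
elim/tens_ind => t; exists (tens_class [seq (s u.1, u.2) | u <- t]).
rewrite tensor_mapE -map_comp; congr tens_class.
by rewrite -[RHS]map_id; apply: eq_map => -[x w] /=; rewrite sK.
Qed.

(** Right exactness from the adjunction: the cokernel of [Tm i], curried, is a map on [Y] that kills
    [X], so it descends to [Z] and, uncurried, factors through [Tm p]. *)
Lemma tensor_map_mid u : Tm p u = 0 <-> exists v, Tm i v = u.
Proof.
have [_ pS pE] := ip; split=> [pu|[v <-]]; last first.
  by rewrite tensor_map_comp tensor_map0 // => x /=; exact: ses_comp0 ip.
have [Q [q [qS qE]]] := quotm_exists (im_sub (Tm i)).
have [g gE] := tens_curry q.
have [y /pE[x <-]|g' g'E] := lin_factor (f := g) pS.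
  apply: linear_ext => w; rewrite gE; apply/qE.
  by exists (tens x w); rewrite ?tensor_map_tens.
have [h hE] := tens_lift g'.
have hq : h \o Tm p =1 q.
  by apply: tens_span => x w; rewrite /= tensor_map_tens hE g'E gE.
have /qE[v _ <-] : q u = 0 by rewrite -hq /= pu linear0.
by exists v.
Qed.
End TensorExact.

End TensorHom.


(** * Homological consequences of the dualizing equivalence *)

Section Dualizing.
Variables (k : fieldType) (A : falgType k) (W : bimodule A).
Local Notation R := A^c.
Implicit Types X Y Z M N K E Q B U V L I J F : lmodType R.
Local Notation T := (tensor W).
Local Notation H := (hom_mod W).
Local Notation Tm := (tensor_map W).
Local Notation Hm := (hom_map W).
Hypothesis R_noeth : Noetherian R.
Hypothesis R_einj : enough_injectives R.
Hypothesis W_dual : dualizing W.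

Lemma tensor_finite X : finite_pdim X -> finite_idim (T X).
Proof. by have [+ _ _ _] := W_dual; apply. Qed.

Lemma hom_finite Y : finite_idim Y -> finite_pdim (H Y).
Proof. by have [_ + _ _] := W_dual; apply. Qed.

Lemma tensor_addm_hom Y : finite_idim Y -> addm (T (H Y)) Y /\ addm Y (T (H Y)).
Proof.
have [_ _ _ [eps [epsB _]]] := W_dual => /epsB /addm_iso[? ?]; by split.
Qed.

(** [Y] is isomorphic to T (H Y), which vanishes with H Y. [tensor_zero] is the mirror argument
    through [eta]. *)
Lemma hom_zero Y : finite_idim Y -> (forall (f : {linear W -> Y}) w, f w = 0) ->
  forall y : Y, y = 0.
Proof.
have [_ _ _ [eps [epsB _]]] := W_dual => Yf f0 y.
have [g _ gK] := epsB _ Yf; rewrite -(gK y).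
rewrite -(tensor_map_id (f := idfun) (g y)) // tensor_map0 ?linear0 // => f /=.
by apply: linear_ext => w; rewrite f0.
Qed.

Lemma tensor_zero X : finite_pdim X -> (forall u : T X, u = 0) ->
  forall x : X, x = 0.
Proof.
have [_ _ [eta [etaB _]] _] := W_dual => Xf u0 x.
have [g etaK _] := etaB _ Xf; rewrite -(etaK x) -(etaK 0).
congr (g _); apply: linear_ext => w.
by rewrite [LHS]u0 [RHS]u0.
Qed.

(* K = ker (T X -> T Y) is also the kernel of T X -> ker (T Y -> T Z), so that it
   has finite injective dimension; H K = 0 because H T X = X embeds in H T Y = Y. *)
Lemma tensor_ses X Y Z (i : {linear X -> Y}) (p : {linear Y -> Z}) :
  finite_pdim X -> finite_pdim Y -> finite_pdim Z -> ses i p ->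
  ses (Tm i) (Tm p).
Proof.
move=> Xf Yf Zf ip; have [iI pS pE] := ip.
have TpS := @tensor_map_surj _ _ W _ _ _ _ _ ip.
split=> // [|u]; last exact: tensor_map_mid.
have [L [l lp]] := ses_ker TpS; have [lI _ lE] := lp.
have Lf := finite_idim_sub R_noeth R_einj lp (tensor_finite Yf) (tensor_finite Zf).
have [u|e eE] := lin_colift (f := Tm i) lI.
  by apply/lE/(tensor_map_mid ip); exists u.
have eS : linear_surj e.
  move=> y; have /(tensor_map_mid ip)[u uE] : Tm p (l y) = 0 by exact: ses_comp0 lp.
  by exists u; apply: lI; rewrite eE.
have [K [j je]] := ses_ker eS; have [jI _ jE] := je.
have Kf := finite_idim_sub R_noeth R_einj je (tensor_finite Xf) Lf.
have [_ _ [eta [etaB etaN]] _] := W_dual.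
have K0 : forall y : K, y = 0.
  apply: hom_zero => // f w; apply: jI; rewrite linear0.
  have [g _ gK] := etaB _ Xf; have [g' gK' _] := etaB _ Yf.
  pose phi : H (T X) := j \o f.
  suff phi0 : phi = 0 by rewrite -[LHS]/((phi : {linear W -> T X}) w) phi0.
  have ix : i (g phi) = 0.
    rewrite -(gK' (i _)) -[eta Y (i _)]/((eta Y \o i) (g phi)) etaN //=.
    rewrite gK -(gK' 0); congr (g' _); apply: linear_ext => v.
    by rewrite /= -eE (ses_comp0 _ je) linear0 linear0.
  by rewrite -(gK phi) (inj_eq0 iI ix) linear0.
apply: lin_inj => u iu; have : e u = 0 by apply: lI; rewrite eE iu linear0.
by move=> /jE[y <-]; rewrite [y]K0 linear0.
Qed.

(* The cokernel C of H Y -> H Z has finite projective dimension and T C = 0,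
   whence C = H T C = 0. *)
Lemma hom_map_surj X Y Z (i : {linear X -> Y}) (p : {linear Y -> Z}) :
  finite_idim X -> finite_idim Y -> finite_idim Z -> ses i p ->
  linear_surj (Hm p).
Proof.
move=> Xf Yf Zf ip; have [iI pS pE] := ip.
have [I [p' [j [p'S jI jE]]]] := lin_image (Hm p).
have ip' : ses (Hm i) p'.
  split=> // [f g /(congr1 (fun h : {linear W -> Y} => h : W -> Y)) fg|f].
    apply: linear_ext => w; apply: iI; exact: (congr1 (fun h => h w) fg).
  split=> [pf|[g <-]].
    have [w|g gE] := lin_colift (f := f : {linear W -> Y}) iI.
      apply/pE; rewrite -[LHS]/((Hm p f : {linear W -> Z}) w) -jE pf linear0.
      by [].
    by exists g; apply: linear_ext => w; exact: gE.
  apply: jI; rewrite jE linear0; apply: linear_ext => w.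
  exact: ses_comp0 ip.
have If := finite_pdim_quot R_noeth R_einj ip' (hom_finite Xf) (hom_finite Yf).
have [C [c jc]] := ses_coker jI; have [_ cS cE] := jc.
have Cf := finite_pdim_quot R_noeth R_einj jc If (hom_finite Zf).
have [_ _ _ [eps [epsB epsN]]] := W_dual.
have C0 : forall x : C, x = 0.
  apply: tensor_zero => // v; have [u <-] := @tensor_map_surj _ _ W _ _ _ _ _ jc v.
  have [y yE] := pS (eps Z u); have [g _ gK] := epsB _ Yf.
  have [g' gK' _] := epsB _ Zf.
  have -> : u = Tm (Hm p) (g y).
    rewrite -[LHS]gK' -[RHS]gK' -yE; congr (g' _).
    by rewrite -[RHS]/((eps Z \o _) (g y)) -epsN //= gK.
  rewrite tensor_map_comp tensor_map0 // => f /=.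
  by rewrite -[X in c X](jE f) (ses_comp0 _ jc).
move=> f; have /cE[x <-] : c f = 0 by exact: C0.
by have [g <-] := p'S x; exists g; rewrite jE.
Qed.

Lemma finite_pdim_regular : finite_pdim (R^o : lmodType R).
Proof.
apply: finite_pdim_proj; [exact: fg_regular | exact: projective_regular].
Qed.

Lemma finite_idim_W : finite_idim W.
Proof.
have [h /addm_iso[_ TW]] := tensor_regular W.
exact: finite_idim_addm TW (tensor_finite finite_pdim_regular).
Qed.

Lemma tensor_projective P : finitely_generated P -> projective P -> addm W (T P).
Proof.
move=> Pf Pp; have [h /addm_iso[WT _]] := tensor_regular W.
exact: addm_trans WT (tensor_addm W (addm_projective Pf Pp)).
Qed.

(** Degree 1 is the surjectivity of H J -> H Z; higher degrees replace [V] by its cosyzygy [Z],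
    again of finite injective dimension. *)
Lemma Ext0_W n V : finite_idim V -> Ext0 n.+1 W V.
Proof.
elim: n V => [|n IHn] V Vf; have [VF _] := Vf;
  have [J [Z [i [q [iq Jf Ji Zf]]]]] := hull R_einj VF;
  have Jd := finite_idim_inj Jf Ji;
  have Zd := finite_idim_quot R_noeth R_einj iq Vf Jd.
  rewrite /= (ext1_inj _ iq Ji) => h.
  have [g gE] := hom_map_surj Vf Jd Zd iq h.
  by exists g => w; rewrite -gE.
have [WF _] := finite_idim_W.
exact/(Ext0_shiftr R_noeth n WF iq Ji)/IHn.
Qed.

(** [V] is a retract of T (H V), so it is enough to treat T U with [U] of finite projective
    dimension. T turns a projective presentation of [U] into an exact sequence with middle term in
    add W, and the dimension drops. *)
Lemma Ext0_of_CM X : finitely_generated X -> (forall n, Ext0 n.+1 X W) ->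
  forall n V, finite_idim V -> Ext0 n.+1 X V.
Proof.
move=> Xf XW.
suff main m U : finitely_generated U -> pdim_le m U -> forall n, Ext0 n.+1 X (T U).
  move=> n V Vf; have [HV _] := tensor_addm_hom Vf.
  have [HVf [m Hm]] := hom_finite Vf.
  by apply: Ext0_addr HV _; exact: main Hm n.
elim: m U => [|m IHm] U Uf Um n;
  have [K [P [i [p [ip Pf Pp Kf _]]]]] := cover R_noeth Uf.
  have Up := pdim_le0_projective R_noeth R_einj Uf Um.
  by apply: Ext0_addr (tensor_projective Uf Up) _.
have Km := pdim_le_syzygy R_noeth R_einj ip Pf Pp Um.
have PF := finite_pdim_proj Pf Pp.
have TK : finite_pdim K by split=> //; exists m.
have TU : finite_pdim U by split=> //; exists m.+1.
have [TPf _] := tensor_finite PF.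
apply: (Ext0_quotr R_noeth R_einj (tensor_ses TK PF TU ip) TPf) => //.
  by apply: Ext0_addr (tensor_projective Pf Pp) _.
exact: IHm.
Qed.

(** [r'] is H r conjugated by [eta]. Testing it on maps out of an arbitrary [Z] combines fullness
    with faithfulness. *)
Lemma tensor_full X Y (r : {linear T Y -> T X}) : finite_pdim X -> finite_pdim Y ->
  exists r' : {linear Y -> X}, forall Z (i : {linear Z -> Y}) (j : {linear Z -> X}),
    finite_pdim Z -> (forall u, r (Tm i u) = Tm j u) ->
    forall z, r' (i z) = j z.
Proof.
move=> Xf Yf; have [_ _ [eta [etaB etaN]] _] := W_dual.
have [g gK' gK] := etaB _ Xf.
have [y|r' r'E] := @lin_colift _ _ _ _ (eta X) (Hm r \o eta Y) (can_inj gK').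
  by exists (g (Hm r (eta Y y))); rewrite gK.
exists r' => Z i j Zf rij z; apply: (can_inj gK'); rewrite r'E /=.
rewrite -[eta Y (i z)]/((eta Y \o i) z) -[eta X (j z)]/((eta X \o j) z) !etaN //=.
by apply: linear_ext => w; exact: rij.
Qed.

(** In degree 1, a map K -> Z is tensored, extended over T P, and brought back by fullness. Higher
    degrees shift, since T P lies in add W and Ext(W, T Z) vanishes in positive degrees. *)
Lemma Ext0_tensor n U Z : finite_pdim U -> finite_pdim Z ->
  Ext0 n.+1 (T U) (T Z) -> Ext0 n.+1 U Z.
Proof.
move=> + Zf; have [ZF _] := Zf; have [TZf _] := tensor_finite Zf.
elim: n U => [|n IHn] U Uf EU; have [UF _] := Uf;
  have [K [P [i [p [ip Pf Pp _ _]]]]] := cover R_noeth UF;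
  have Pd := finite_pdim_proj Pf Pp;
  have Kd := finite_pdim_sub R_noeth R_einj ip Pd Uf;
  have Tip := tensor_ses Kd Pd Uf ip.
  rewrite /= (ext1_proj _ ip Pp) => f.
  have [g gE] := EU _ _ _ _ Tip (Tm f).
  have [g' g'E] := tensor_full g Zf Pd.
  by exists g'; exact: g'E.
apply/(Ext0_shiftl R_noeth R_einj n ZF ip Pf Pp); apply: IHn => //.
have [TPf _] := tensor_finite Pd.
apply: (Ext0_subl R_noeth R_einj Tip TPf TZf) => //.
apply: (Ext0_addl R_noeth R_einj _ TZf (tensor_projective Pf Pp)).
  by case: finite_idim_W.
exact/Ext0_W/tensor_finite.
Qed.

End Dualizing.


(** * Syzygies of Cohen-Macaulay modules *)

Lemma bounded_nat_stable (f : nat -> nat) b :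
  (forall n, (f n <= b)%N) -> exists n, (f n.+1 <= f n)%N.
Proof.
move=> fb; apply: contrapT => /forallNP no.
have le m : (m <= f m)%N.
  elim: m => // m IHm; apply: leq_ltn_trans IHm _.
  by rewrite ltnNge; apply/negP/no.
by have := leq_trans (le b.+1) (fb b.+1); rewrite ltnn.
Qed.

(** [F] is a left add(B)-approximation of [C]. *)
Definition left_approximations (R : nzRingType) : Prop :=
  forall C B : lmodType R, finitely_generated C -> finitely_generated B ->
  exists r (F : {linear C -> {ffun 'I_r -> B}}), forall g : {linear C -> B},
  exists h : {linear {ffun 'I_r -> B} -> B}, forall x, h (F x) = g x.

(** Any rank that grows strictly along strict inclusions of submodules serves as a length; for
    algebras it is the dimension over k. *)
Definition finite_length (R : nzRingType) : Prop :=
  forall M : lmodType R, finitely_generated M ->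
  exists r : set M -> nat, forall S S' : set M,
    is_submodule S -> is_submodule S' -> S `<=` S' ->
    (r S <= r S')%N /\ ((r S' <= r S)%N -> S' `<=` S).

(** * Modules separated by maps to the algebra, and coresolutions by projectives *)

Section Tower.
Variable R : nzRingType.
Implicit Types X Y Z M N K E Q B U V L I J F P C : lmodType R.
Hypothesis R_noeth : Noetherian R.
Hypothesis R_einj : enough_injectives R.
Hypothesis R_approx : left_approximations R.
Local Notation Reg := (R^o : lmodType R).

(** The killed elements form the reject of [B] in [C]. It is zero, that is [C] is [separated], when
    [B] cogenerates [C]; for the regular module this is torsionlessness. *)
Definition killed C B (x : C) : Prop :=
  forall f : {linear C -> B}, f x = 0.

Definition separated C B : Prop :=
  forall x : C, killed B x -> x = 0.

Lemma killed_addm B N C (x : C) : addm B N -> killed B x -> killed N x.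
Proof.
move=> [r [f [g fg]]] xB h; rewrite [h x]fg big1 // => j _.
by rewrite -[f j _]/((f j \o h) x) xB linear0.
Qed.

Lemma killed_sub C B : is_submodule [set x : C | killed B x].
Proof.
split=> [f|a x y xB yB f]; first by rewrite linear0.
by rewrite linearP xB yB scaler0 addr0.
Qed.

Lemma separated_embed C B : finitely_generated C -> finitely_generated B ->
  separated C B ->
  exists r (F : {linear C -> {ffun 'I_r -> B}}), injective F /\
    forall g : {linear C -> B}, exists h : {linear {ffun 'I_r -> B} -> B},
      forall x, h (F x) = g x.
Proof.
move=> Cf Bf CB; have [r [F FE]] := R_approx Cf Bf; exists r, F; split=> //.
apply: lin_inj => x Fx; apply: CB => f.
by have [h <-] := FE f; rewrite Fx linear0.
Qed.

(** Each step along a projective resolution of [N] raises the degree by one, up to [q + p] at most,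
    when a projective syzygy is reached. *)
Lemma Ext0_of_regular q p C N : finitely_generated C -> finitely_generated N ->
  (forall l, (l <= p)%N -> Ext0 (q + l) C Reg) -> pdim_le p N -> Ext0 q C N.
Proof.
move=> Cf; elim: p q N => [|p IHp] q N Nf CR Np.
  apply: Ext0_addr (addm_projective Nf (pdim_le0_projective R_noeth R_einj Nf Np)) _.
  by rewrite -[q]addn0; exact: CR.
have [K [P [i [j [ij Pf Pp Kf PR]]]]] := cover R_noeth Nf.
apply: (Ext0_quotr R_noeth R_einj ij Pf) => //.
  by apply: Ext0_addr PR _; rewrite -[q]addn0; exact: CR.
apply: IHp => // [l lp|]; last exact: (pdim_le_syzygy R_noeth R_einj ij Pf Pp Np).
by rewrite addSnnS; exact: CR.
Qed.

(** For [i > 0] a map C -> B lifts to a projective [P] over [B]: the obstruction lies in Ext^1(C,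
    K), where the syzygy [K] has projective dimension below [i]. Maps to [P] kill [x]. *)
Lemma killed_pdim i C B (x : C) : finitely_generated C -> finitely_generated B ->
  (forall j, (j < i)%N -> Ext0 j.+1 C Reg) -> pdim_le i B ->
  killed Reg x -> killed B x.
Proof.
move=> Cf Bf CR Bi xR; case: i CR Bi => [|i] CR Bi.
  exact: killed_addm (addm_projective Bf (pdim_le0_projective R_noeth R_einj Bf Bi)) xR.
have [K [P [j [p [jp Pf Pp Kf PR]]]]] := cover R_noeth Bf.
move=> f; have CK : ext1 C K.
  exact: (@Ext0_of_regular 1 i _ _ Cf Kf CR (pdim_le_syzygy R_noeth R_einj jp Pf Pp Bi)).
have [g <-] := ext1_lift CK jp f.
by rewrite (killed_addm PR xR) linear0.
Qed.

(** The top Ext of a module of finite projective dimension is right exact in the second variable, so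
    its vanishing on the regular module makes it vanish everywhere and lowers the bound [m]. *)
Lemma pdim_le_of_Ext0_regular m i U : finitely_generated U -> pdim_le m U ->
  (forall n, (i <= n)%N -> Ext0 n.+1 U Reg) -> pdim_le i U.
Proof.
move=> Uf + UR; elim: m => [|m IHm] Um; first exact: pdim_le_mono Um.
have [mi|im] := leqP m.+1 i; first exact: pdim_le_mono Um.
apply: IHm; apply: (pdim_le_of_Ext0 R_noeth R_einj) => // Y Yf.
have [K [P [j [p [jp Pf Pp Kf PR]]]]] := cover R_noeth Yf.
apply: (Ext0_quotr R_noeth R_einj jp Pf) => //.
  by apply: Ext0_addr PR _; exact: UR.
exact: Ext0_of_pdim_le.
Qed.

(* 0 -> X -> Q^0 -> ... -> Q^(n-1) -> C -> 0 exact, with finitely generated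
   projective Q^i *)
Inductive tower X : nat -> lmodType R -> Prop :=
| tower0 : tower X 0 X
| towerS n C C' Q (i : {linear C -> Q}) (p : {linear Q -> C'}) :
    tower X n C -> ses i p -> finitely_generated Q -> projective Q ->
    tower X n.+1 C'.

Lemma tower_fg n X C : finitely_generated X -> tower X n C -> finitely_generated C.
Proof. by move=> Xf [//|m C' C'' Q i p _ ip Qf _]; exact: ses_fgr ip Qf. Qed.

Lemma Ext0_tower m n X C Y : finitely_generated Y -> tower X n C ->
  (Ext0 (n + m).+1 C Y <-> Ext0 m.+1 X Y).
Proof.
move=> Yf; elim=> // {n C} n C C' Q i p _ IH ip Qf Qp.
by rewrite addSn -(Ext0_shiftl R_noeth R_einj _ Yf ip Qf Qp).
Qed.

(** Each storey costs one degree: Ext^l(M, C') lies between Ext^l(M, Q) = 0 and Ext^(l+1)(M, C).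
    Hence the bound on [l + n]. *)
Lemma Ext0_into_tower i l n M X C : finitely_generated M ->
  (forall l, (l <= i)%N -> Ext0 l M Reg) -> (forall l, (l <= i)%N -> Ext0 l M X) ->
  tower X n C -> (l + n <= i)%N -> Ext0 l M C.
Proof.
move=> Mf MR MX t; elim: t l => {n C} [|n C C' Q j p _ IH jp Qf Qp] l.
  by rewrite addn0; exact: MX.
rewrite addnS => li; apply: (Ext0_quotr R_noeth R_einj jp Qf) => //.
  apply: Ext0_addr (addm_projective Qf Qp) _; apply: MR.
  by apply: leq_trans li; rewrite -addnS leq_addr.
by apply: IH; rewrite addSn.
Qed.

(** Each step is a left approximation by a power of the algebra A: all maps C -> A extend along it,
    so Ext^1(C', A) = 0, and the earlier vanishing shifts up. Torsionlessness is therefore asked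
    only of modules with this vanishing. *)
Lemma tower_exists d X : finitely_generated X ->
  (forall i C, (i < d)%N -> tower X i C ->
     (forall j, (j < i)%N -> Ext0 j.+1 C Reg) -> separated C Reg) ->
  exists C, tower X d C.
Proof.
move=> Xf sep.
suff H i : (i <= d)%N ->
    exists C, tower X i C /\ forall j, (j < i)%N -> Ext0 j.+1 C Reg.
  by have [C [? _]] := H d (leqnn d); exists C.
elim: i => [_|i IHi id]; first by exists X; split=> //; exact: tower0.
have [C [tC CR]] := IHi (ltnW id); have Cf := tower_fg Xf tC.
have Rf := fg_regular R.
have [r [F [FI FE]]] := separated_embed Cf Rf (sep _ _ id tC CR).
have [C' [p Fp]] := ses_coker FI.
have Pf : finitely_generated {ffun 'I_r -> R^o} := fg_pow _ Rf.
have Pp : projective ({ffun 'I_r -> R^o} : lmodType R) := @projective_pow _ _.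
exists C'; split; first exact: towerS tC Fp Pf Pp.
case=> [_|j ji]; last first.
  by apply/(Ext0_shiftl R_noeth R_einj j Rf Fp Pf Pp); exact: CR.
by apply: (ext1_quotl_extend R_einj Fp) => //; exact: ext1_projl.
Qed.

(* 0 -> V' -> Q_(n-1) -> ... -> Q_0 -> V -> 0 exact, with projective Q_j and all
   terms of finite injective dimension *)
Inductive fid_resolved : nat -> lmodType R -> Prop :=
| fid_resolved0 V : finite_idim V -> fid_resolved 0 V
| fid_resolvedS n V V' Q (i : {linear V' -> Q}) (p : {linear Q -> V}) :
    ses i p -> finite_idim Q -> projective Q -> fid_resolved n V' ->
    fid_resolved n.+1 V.

Lemma fid_resolved_inv n V : fid_resolved n.+1 V ->
  exists V' Q (i : {linear V' -> Q}) (p : {linear Q -> V}),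
    [/\ ses i p, finite_idim Q, projective Q & fid_resolved n V'].
Proof. by inversion 1 as [|m V0 V' Q i p]; exists V', Q, i, p. Qed.

Lemma fid_resolved_finite n V : fid_resolved n V -> finite_idim V.
Proof.
elim=> {n V} // n V V' Q i p ip Qd _ _ Vd.
exact: (finite_idim_quot R_noeth R_einj ip Vd Qd).
Qed.

Lemma fid_resolved_le m n V : (m <= n)%N -> fid_resolved n V -> fid_resolved m V.
Proof.
move=> + Vn; elim: Vn m => {n V} [V Vd|n V V' Q i p ip Qd Qp Vn IH] m.
  by rewrite leqn0 => /eqP->; exact: fid_resolved0.
case: m => [_|m mn]; last exact: fid_resolvedS ip Qd Qp (IH m mn).
exact/fid_resolved0/(fid_resolved_finite (fid_resolvedS ip Qd Qp Vn)).
Qed.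

End Tower.


(** * Finite products, and vanishing read off from an injective coresolution *)

Section Products.
Variable R : nzRingType.
Implicit Types X Y Z M N K E Q B U V L I J F P C : lmodType R.
Hypothesis R_noeth : Noetherian R.
Hypothesis R_einj : enough_injectives R.

Definition pairl M N : {linear M -> (M * N)%type} :=
  mklin (f := fun x : M => (x, 0 : N))
    (fun a x y => congr2 pair (erefl _) (esym (etrans (addr0 _) (scaler0 _ a)))).
Definition pairr M N : {linear N -> (M * N)%type} :=
  mklin (f := fun x : N => (0 : M, x))
    (fun a x y => congr2 pair (esym (etrans (addr0 _) (scaler0 _ a))) (erefl _)).
Lemma pairE M N (u : M * N) : u = pairl M N u.1 + pairr M N u.2.
Proof. by case: u => x y; congr pair; rewrite /= ?addr0 ?add0r. Qed.

Lemma addm_prodl M N : addm (M * N)%type M.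
Proof. by apply: (@addm_retract _ _ _ (pairl M N) fst). Qed.

Lemma addm_prodr M N : addm (M * N)%type N.
Proof. by apply: (@addm_retract _ _ _ (pairr M N) snd). Qed.

Lemma fg_prod M N : finitely_generated M -> finitely_generated N ->
  finitely_generated (M * N)%type.
Proof.
move=> [m [e eE]] [n [f fE]].
exists (m + n)%N, (fun j => match split j with
  | inl a => pairl M N (e a) | inr b => pairr M N (f b) end) => u.
have [c cE] := eE u.1; have [c' c'E] := fE u.2.
exists (fun j => match split j with inl a => c a | inr b => c' b end).
rewrite big_split_ord {1}[u]pairE {1}cE {1}c'E !linear_sum /=.
congr (_ + _); apply: eq_bigr => j _; rewrite linearZ.
  by rewrite (unsplitK (inl j)).
by rewrite (unsplitK (inr j)).
Qed.

Lemma injective_prod M N : injective_module M -> injective_module N ->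
  injective_module (M * N)%type.
Proof.
move=> Mi Ni X Y i h iI.
have [f fE] := injective_extend (fst \o h) Mi iI.
have [g gE] := injective_extend (snd \o h) Ni iI.
have [|t tE] := @linP _ _ _ (fun y => (f y, g y) : M * N).
  by move=> a x y; rewrite !linearP.
by exists t => x /=; rewrite tE fE gE -surjective_pairing.
Qed.

Lemma Ext0_prod n M N Y : finitely_generated M -> finitely_generated N ->
  finitely_generated Y -> Ext0 n.+1 M Y -> Ext0 n.+1 N Y ->
  Ext0 n.+1 (M * N)%type Y.
Proof.
move=> Mf Nf; have MNf := fg_prod Mf Nf.
elim: n Y => [|n IHn] Y Yf EM EN; have [J [Z [i [q [iq Jf Ji Zf]]]]] := hull R_einj Yf.
  rewrite /= (ext1_inj _ iq Ji) => h.
  have [f fE] := ext1_lift EM iq (h \o pairl M N).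
  have [g gE] := ext1_lift EN iq (h \o pairr M N).
  have [|t tE] := @linP _ _ _ (fun u : M * N => f u.1 + g u.2).
    by move=> a x y; rewrite !linearP /= scalerDr addrACA.
  by exists t => u; rewrite tE linearD fE gE [u in RHS]pairE linearD.
apply/(Ext0_shiftr R_noeth n MNf iq Ji); apply: IHn => //.
  exact/(Ext0_shiftr R_noeth n Mf iq Ji).
exact/(Ext0_shiftr R_noeth n Nf iq Ji).
Qed.

Lemma pdim_le_prod n M N : finitely_generated M -> finitely_generated N ->
  pdim_le n M -> pdim_le n N -> pdim_le n (M * N)%type.
Proof.
move=> Mf Nf Mn Nn; apply: (pdim_le_of_Ext0 R_noeth R_einj) => [|Y Yf].
  exact: fg_prod.
by apply: Ext0_prod => //; exact: Ext0_of_pdim_le.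
Qed.

Lemma Ext0_coresolution i M X (I : inj_coresolution X) : finitely_generated M ->
  (forall j, (j <= i)%N -> Ext0 0 M (I j)) ->
  forall l, (l <= i)%N -> Ext0 l M X.
Proof.
move=> Mf; elim: i X I => [|i IHi] X I MI [|l] // li;
  have [Y [q [e [iq eE]]]] := ic_shift_exists I; have [iI _ _] := iq.
- by move=> f x; apply: iI; rewrite -[LHS]/((ic_d I 0 \o f) x) MI // linear0.
- by move=> f x; apply: iI; rewrite -[LHS]/((ic_d I 0 \o f) x) MI // linear0.
- have Ii : injective_module (I 0) := @ic_inj _ _ I 0.
  apply: (Ext0_subr R_noeth R_einj iq (ic_fg I 0) Mf); last exact: Ext0_injr.
  by apply: (IHi Y (ic_shift iq eE)) => // j ji; exact: MI.
Qed.

End Products.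

(** * Torsionlessness of the cokernels in both Gorenstein cases *)

Section Cases.
Variables (k : fieldType) (A : falgType k) (W : bimodule A).
Local Notation R := A^c.
Implicit Types X Y Z M N K E Q B U V L I J F C : lmodType R.
Local Notation T := (tensor W).
Local Notation H := (hom_mod W).
Local Notation Tm := (tensor_map W).
Local Notation Hm := (hom_map W).
Local Notation Reg := (R^o : lmodType R).
Hypothesis R_noeth : Noetherian R.
Hypothesis R_einj : enough_injectives R.
Hypothesis R_approx : left_approximations R.
Hypothesis R_flen : finite_length R.
Hypothesis W_dual : dualizing W.

(** The cosyzygies in this range keep finite projective dimension, so T preserves exactness; as the
    T (I^j) are injective, the shift of [Ext0_coresolution] applies. *)
Lemma Ext0_tensor_coresolution i M X (I : inj_coresolution X) :
  finitely_generated M -> finite_pdim X ->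
  (forall j, (j <= i)%N ->
     [/\ finite_pdim (I j), injective_module (T (I j)) & Ext0 0 M (T (I j))]) ->
  forall l, (l <= i)%N -> Ext0 l M (T X).
Proof.
move=> Mf; elim: i X I => [|i IHi] X I Xf MI [|l] // li;
  have [Y [q [e [iq eE]]]] := ic_shift_exists I;
  have [If Ii MI0] := MI 0 isT;
  have Yf := finite_pdim_quot R_noeth R_einj iq Xf If;
  have Tiq := tensor_ses R_noeth R_einj W_dual Xf If Yf iq;
  have [TiI _ _] := Tiq.
- by move=> f x; apply: TiI; rewrite -[LHS]/((Tm (ic_d I 0) \o f) x) MI0 linear0.
- by move=> f x; apply: TiI; rewrite -[LHS]/((Tm (ic_d I 0) \o f) x) MI0 linear0.
- have [TIf _] := tensor_finite W_dual If.
  apply: (Ext0_subr R_noeth R_einj Tiq TIf Mf); last exact: Ext0_injr.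
  by apply: (IHi Y (ic_shift iq eE)) => // j ji; exact: MI.
Qed.

Section CohenMacaulayModule.
Variable X : lmodType R.
Hypothesis Xf : finitely_generated X.
Hypothesis XW : forall n, Ext0 n.+1 X W.

(** [X] embeds in an injective [J], a retract of T (H J). With a projective [P] over H J, maps X ->
    T (H J) lift to T P because Ext^1(X, T K) = 0, and T P lies in add W. *)
Lemma CM_separated : separated X W.
Proof.
have [J [Z [i [q [iq Jf Ji Zf]]]]] := hull R_einj Xf.
have Jd := finite_idim_inj Jf Ji; have [HJ _] := tensor_addm_hom W_dual Jd.
have HJd := hom_finite W_dual Jd; have [HJf _] := HJd.
have [K [P [j [p [jp Pf Pp Kf _]]]]] := cover R_noeth HJf.
have Pd := finite_pdim_proj Pf Pp.
have Kd := finite_pdim_sub R_noeth R_einj jp Pd HJd.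
have Tjp := tensor_ses R_noeth R_einj W_dual Kd Pd HJd jp.
have [iI _ _] := iq.
move=> x xW; apply: (inj_eq0 iI).
suff xTHJ : killed (T (H J)) x by exact: killed_addm HJ xTHJ i.
move=> f; have E1 := Ext0_of_CM R_noeth R_einj W_dual Xf XW 0 (tensor_finite W_dual Kd).
have [g <-] := ext1_lift E1 Tjp f.
by rewrite (killed_addm (tensor_projective W Pf Pp) xW) linear0.
Qed.

(** The embedding is a left add(W)-approximation, so its cokernel has no Ext^1 to [W]; the
    construction can thus be iterated. *)
Lemma CM_coresolve : exists X' r (i : {linear X -> {ffun 'I_r -> W}})
  (q : {linear {ffun 'I_r -> W} -> X'}),
  [/\ ses i q, finitely_generated X' & forall n, Ext0 n.+1 X' W].
Proof.
have Wd := finite_idim_W R_noeth R_einj W_dual; have [Wf _] := Wd.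
have WW n := Ext0_W R_noeth R_einj W_dual n Wd.
have [r [F [FI FE]]] := separated_embed R_approx Xf Wf CM_separated.
have [X' [q Fq]] := ses_coker FI.
have WrW n : Ext0 n.+1 {ffun 'I_r -> W} W.
  by apply: Ext0_addl (@addm_pow _ W r) _.
have Wrf : finitely_generated {ffun 'I_r -> W} := fg_pow _ Wf.
exists X', r, F, q; split=> // [|[|n]]; first exact: ses_fgr Fq Wrf.
  exact: (ext1_quotl_extend R_einj Fq Wf (WrW 0)).
exact: (Ext0_quotl R_noeth R_einj Fq Wrf Wf).
Qed.

End CohenMacaulayModule.

Lemma Ext0_into_CM i M X : finitely_generated M ->
  (forall l, (l <= i)%N -> Ext0 l M W) ->
  finitely_generated X -> (forall n, Ext0 n.+1 X W) ->
  forall l, (l <= i)%N -> Ext0 l M X.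
Proof.
move=> Mf MW Xf XW l; elim: l X Xf XW => [|l IHl] X Xf XW li;
  have [X' [r [j [q [jq X'f X'W]]]]] := CM_coresolve Xf XW; have [jI _ _] := jq;
  have MWr m : (m <= i)%N -> Ext0 m M {ffun 'I_r -> W}
    by move=> mi; apply: Ext0_addr (@addm_pow _ W r) _; exact: MW.
  by move=> f x; apply: jI; rewrite linear0; exact: (MWr 0 isT (j \o f)).
have [Wf _] := finite_idim_W R_noeth R_einj W_dual.
apply: (Ext0_subr R_noeth R_einj jq (fg_pow _ Wf) Mf); last exact: MWr.
by apply: IHl => //; exact: ltnW.
Qed.

(* Maps from C to D lift along the first step Q -> D of the resolution: the
   obstruction moves up to Ext^(i+1)(C, V) = Ext^1(X, V) = 0 with V of finite
   injective dimension. *)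
Lemma tower_separated_of_resolved i X C D : finitely_generated X ->
  (forall n, Ext0 n.+1 X W) -> tower X i C ->
  (forall j, (j < i)%N -> Ext0 j.+1 C Reg) ->
  fid_resolved i.+1 D -> separated C D -> separated C Reg.
Proof.
move=> Xf XW t CR Dres CD; have Cf := tower_fg Xf t.
have main m V j : fid_resolved m V -> (j + m = i)%N -> Ext0 j.+1 C V.
  move=> Vm; elim: Vm j => {m V} [V Vd|m V V' Q i' p ip [Qf _] Qp V'm IH] j.
    rewrite addn0 => ->; have [Vf _] := Vd; rewrite -[i]addn0.
    by apply/(Ext0_tower R_noeth R_einj 0 Vf t)/(Ext0_of_CM R_noeth R_einj W_dual).
  rewrite -addSnnS => jm; apply: (Ext0_quotr R_noeth R_einj ip Qf Cf); last exact: IH.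
  apply: Ext0_addr (addm_projective Qf Qp) _; apply: CR.
  by rewrite -jm leq_addr.
move=> x xR; apply: CD => f.
have [V' [Q [i' [p [ip [Qf _] Qp V'n]]]]] := fid_resolved_inv Dres.
have [g <-] := ext1_lift (main _ _ 0 V'n (add0n _)) ip f.
by rewrite (killed_addm (addm_projective Qf Qp) xR) linear0.
Qed.

(* Ext^n(H V, A) = Ext^n(V, T A), which vanishes for n > pdim V. *)
Lemma pdim_le_hom i V : finite_idim V -> pdim_le i V -> pdim_le i (H V).
Proof.
move=> Vd Vi; have HVd := hom_finite W_dual Vd; have [HVf [m HVm]] := HVd.
have [Vf _] := Vd; have Rd := finite_pdim_regular A.
have [TRf _] := tensor_finite W_dual Rd.
apply: (pdim_le_of_Ext0_regular R_noeth R_einj HVf HVm) => n ni.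
apply: (Ext0_tensor R_noeth R_einj W_dual HVd Rd).
have [_ VTH] := tensor_addm_hom W_dual Vd.
apply: (Ext0_addl R_noeth R_einj Vf TRf VTH).
exact/(Ext0_of_pdim_le R_noeth R_einj)/TRf/(pdim_le_mono ni).
Qed.

Section GorensteinLevel.
Variables (i : nat) (B : lmodType R).
Hypotheses (Bf : finitely_generated B) (Bi : injective_module B).
Hypothesis Bp : pdim_le i B.
Hypothesis B_grade : forall M, finitely_generated M -> Ext0 0 M B ->
  forall l, (l <= i)%N -> Ext0 l M Reg.

(* The submodule M killed by all maps to B has Hom(M, B) = 0, hence
   Ext^l(M, A) = 0 for l <= i, hence Hom(M, N) = 0. *)
Lemma separated_level N : finitely_generated N -> pdim_le i N -> separated N B.
Proof.
move=> Nf Ni x xB; have [M [j [jI jE]]] := submod_exists (killed_sub N B).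
have Mf := R_noeth jI Nf.
have MB : Ext0 0 M B.
  move=> f y; have [g <-] := injective_extend f Bi jI.
  by have /jE : exists z, j z = j y by exists y; exact.
have MN : Ext0 0 M N.
  apply: (Ext0_of_regular R_noeth R_einj Mf Nf _ Ni) => l li.
  by rewrite add0n; exact: B_grade.
by have [y <-] := (jE x).1 xB; exact: MN.
Qed.

(* N embeds in a power B^r with cokernel of finite projective dimension; T keeps
   this sequence exact and turns it into a split one. *)
Lemma addm_level N : finitely_generated N -> pdim_le i N ->
  injective_module (T N) -> addm B N.
Proof.
move=> Nf Ni TNi; have [r [F [FI _]]] := separated_embed R_approx Nf Bf (separated_level Nf Ni).
have [Z [q Fq]] := ses_coker FI.
have Nd : finite_pdim N by split=> //; exists i.
have Bd : finite_pdim {ffun 'I_r -> B}.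
  by apply: (finite_pdim_addm R_noeth R_einj (@addm_pow _ B r)); split=> //; exists i.
have Zd := finite_pdim_quot R_noeth R_einj Fq Nd Bd.
have [TFI _ _] := tensor_ses R_noeth R_einj W_dual Nd Bd Zd Fq.
have [g gE] := injective_extend idfun TNi TFI.
have [g' g'E] := tensor_full W_dual g Nd Bd.
apply: addm_trans (@addm_pow _ B r) (addm_retract (f := F) (g := g') _) => x.
rewrite (g'E _ F idfun) // => u.
by rewrite gE tensor_map_id.
Qed.

Definition homs m : lmodType R := iter m (fun Y => H Y : lmodType R) B.

(** T (homs m.+1) is isomorphic to [homs m], hence injective, and H keeps the projective dimension
    at most [i]; so [addm_level] applies at each step. *)
Lemma homs_finite m : finite_idim (homs m) /\ addm B (homs m).
Proof.
elim: m => [|m [IHd IHa]]; first by split; [exact: finite_idim_inj|exact: addm_refl].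
suff Ha : addm B (homs m.+1).
  by split=> //; apply: (finite_idim_addm R_noeth R_einj Ha); exact: finite_idim_inj.
have [THf _] := tensor_addm_hom W_dual IHd.
have [_ fT] := tensor_addm_hom W_dual IHd.
have [Hf _] := hom_finite W_dual IHd.
apply: addm_level => //.
  apply: pdim_le_hom => //; exact: (pdim_le_addm R_noeth R_einj Bf IHa).
exact: injective_addm fT (injective_addm IHa Bi).
Qed.

Lemma homs_step m : addm (homs m) (homs m.+1).
Proof.
elim: m => [|m IHm]; last exact: hom_addm.
by have [_] := homs_finite 1.
Qed.

(* Each H^(m+1) B lies in add (H^m B), so the submodules of B killed by all maps
   to H^m B increase; once they are stationary H^m B embeds in a power of
   H^(m+1) B, and splits off because it is injective. *)
Lemma homs_stable : exists m, addm (homs m.+1) (homs m).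
Proof.
pose S m := [set x : B | killed (homs m) x].
have S_sub m : is_submodule (S m) := killed_sub B (homs m).
have SS m : S m `<=` S m.+1 by move=> x; exact/killed_addm/homs_step.
have [r rE] := R_flen Bf.
have T_sub : is_submodule [set: B] by [].
have [|m le] := @bounded_nat_stable (fun m => r (S m)) (r [set: B]).
  by move=> m; have [] := rE _ _ (S_sub m) T_sub (fun _ _ => Logic.I).
have Sm : S m.+1 `<=` S m by exact: (rE _ _ (S_sub m) (S_sub m.+1) (SS m)).2.
exists m; have [[hf _] [s [f [g fg]]]] := homs_finite m.
have [[hSf _] _] := homs_finite m.+1.
have sep : separated (homs m) (homs m.+1).
  (* The coordinate [f j y] in [B] is killed by all maps to [homs m.+1], hence, by stationarity,
     also by [g j]. *)
  move=> y yS; rewrite [y]fg big1 // => j _.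
  have : S m (f j y) by apply: Sm => h; exact: (yS (h \o f j)).
  by apply.
have [t [F [FI _]]] := separated_embed R_approx hf hSf sep.
have hi : injective_module (homs m).
  by apply: injective_addm Bi; exists s, f, g.
have [h hE] := injective_extend idfun hi FI.
exact: addm_trans (@addm_pow _ _ t) (addm_retract hE).
Qed.

(** T lowers the index in [homs_stable] one by one until [B] lies in add (H B); a last application
    puts T B in add (T (H B)), and T (H B) is isomorphic to [B]. *)
Lemma addm_tensor_level : addm B (T B).
Proof.
have [m] := homs_stable.
have H1 : addm (homs m.+1) (homs m) -> addm (homs 1) B.
  elim: m => // m IHm Hm; apply: IHm.
  have [md _] := homs_finite m; have [m1d _] := homs_finite m.+1.
  have [TH _] := tensor_addm_hom W_dual md.
  have [_ HT] := tensor_addm_hom W_dual m1d.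
  exact: addm_trans HT (addm_trans (tensor_addm W Hm) TH).
move=> /H1 /(tensor_addm W) HB; apply: addm_trans HB.
by have [_] := tensor_addm_hom W_dual (finite_idim_inj Bf Bi).
Qed.

(* M, the submodule of C killed by all maps to A, has Hom(M, B) = 0: maps C -> B
   factor through projectives. Therefore Ext^l(M, A), Ext^l(M, W), Ext^l(M, X)
   and finally Hom(M, C) vanish. *)
Lemma tower_separated_level (I : inj_coresolution Reg) X C :
  (forall j, (j <= i)%N -> addm B (I j)) ->
  finitely_generated X -> (forall n, Ext0 n.+1 X W) -> tower X i C ->
  (forall j, (j < i)%N -> Ext0 j.+1 C Reg) -> separated C Reg.
Proof.
move=> BI Xf XW t CR x xR; have Cf := tower_fg Xf t.
have [M [j [jI jE]]] := submod_exists (killed_sub C Reg).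
have Mf := R_noeth jI Cf.
have MB : Ext0 0 M B.
  move=> f y; have [g <-] := injective_extend f Bi jI.
  apply: (killed_pdim R_noeth R_einj Cf Bf CR Bp).
  by apply/jE; exists y.
have BTI l : (l <= i)%N -> addm B (T (I l)).
  by move=> li; exact: addm_trans addm_tensor_level (tensor_addm W (BI _ li)).
have MTR : forall l, (l <= i)%N -> Ext0 l M (T Reg).
  apply: (@Ext0_tensor_coresolution i M Reg I Mf (finite_pdim_regular A)) => l li.
  split; [|exact: injective_addm (BTI l li) Bi|exact: Ext0_addr (BTI l li) MB].
  by apply: (finite_pdim_addm R_noeth R_einj (BI l li)); split=> //; exists i.
have MW l : (l <= i)%N -> Ext0 l M W.
  move=> li; have [h /addm_iso[_ TW]] := tensor_regular W.
  exact: Ext0_addr TW (MTR l li).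
have MX := Ext0_into_CM Mf MW Xf XW.
have MC := Ext0_into_tower (l := 0) R_noeth R_einj Mf (B_grade Mf MB) MX t (leqnn i).
by have [y <-] := (jE x).1 xR; exact: MC.
Qed.

End GorensteinLevel.

Lemma tower_separated_of_Gorenstein d (I : inj_coresolution Reg) X i C :
  (forall i, (i < d)%N -> pdim_le i (I i)) ->
  finitely_generated X -> (forall n, Ext0 n.+1 X W) -> (i < d)%N -> tower X i C ->
  (forall j, (j < i)%N -> Ext0 j.+1 C Reg) -> separated C Reg.
Proof.
move=> Ip Xf XW id.
(* [B] is the product of I^0, ..., I^i, so that [Ext0_coresolution] gives the grade condition for
   it. *)
have [B [Bf Bi Bp BI]] : exists B : lmodType R,
    [/\ finitely_generated B, injective_module B, pdim_le i B
      & forall j, (j <= i)%N -> addm B (I j)].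
  elim: i id => [|i IHi] id.
    exists (I 0); split; [exact: ic_fg|exact: (@ic_inj _ _ I)|exact: Ip|].
    by move=> j; rewrite leqn0 => /eqP->; exact: addm_refl.
  have [B [Bf Bi Bp BI]] := IHi (ltnW id).
  have If := ic_fg I i.+1.
  exists (B * I i.+1)%type; split.
  - exact: fg_prod.
  - by apply: injective_prod => //; exact: (@ic_inj _ _ I).
  - by apply: pdim_le_prod => //; [exact: pdim_le_mono Bp|exact: Ip].
  - move=> j; rewrite leq_eqVlt => /predU1P[->|ji]; first exact: addm_prodr.
    exact: addm_trans (addm_prodl _ _) (BI j ji).
move=> t CR; apply: (@tower_separated_level i B Bf Bi Bp _ I X C) => // M Mf MB.
apply: (@Ext0_coresolution _ R_noeth R_einj i M _ I) => // j ji.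
exact: Ext0_addr (BI j ji) MB.
Qed.

End Cases.


(** * Finite dimensional algebras and duality *)

Section VectorSpaces.
Variable k : fieldType.
Implicit Types U V : lmodType k.

(** [B] has maximal rank among the matrices with row space inside [S]; adjoining a vector of [S]
    cannot raise it. *)
Lemma rV_subspace N (S : set 'rV[k]_N) : is_submodule S ->
  exists B : 'M[k]_N, forall v, S v <-> (v <= B)%MS.
Proof.
move=> [S0 SP].
pose p r := `[< exists B : 'M[k]_N, \rank B = r /\ forall v : 'rV_N, (v <= B)%MS -> S v >].
have p0 : exists r, p r.
  exists 0%N; apply/asboolP; exists 0; rewrite mxrank0; split=> // v.
  by rewrite submx0 => /eqP->.
have pN r : p r -> (r <= N)%N by move=> /asboolP[B [<- _]]; exact: rank_leq_row.
case: (ex_maxnP p0 pN) => r /asboolP[B [Br BS]] rmax.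
exists B => v; split=> [Sv|]; last exact: BS.
have /rmax : p (\rank (B + v)%MS).
  apply/asboolP; exists (B + v)%MS; split=> // u /sub_addsmxP[[a b] ->] /=.
  rewrite -[a *m B]scale1r; apply: (SP 1); first exact/BS/submxMl.
  by rewrite [b]mx11_scalar mul_scalar_mx -[_ *: v]addr0; exact: SP.
rewrite -Br => rk; apply: submx_trans (addsmxSr B v) _.
by have [_ <-] := mxrank_leqif_sup (addsmxSl B v); rewrite eqn_leq rk mxrankS ?addsmxSl.
Qed.

Lemma fg_rV_surj V : finitely_generated V ->
  exists N (phi : {linear 'rV[k]_N -> V}), linear_surj phi.
Proof.
move=> [N [g gE]].
have [|phi phiE] := @linP _ _ _ (fun v : 'rV[k]_N => \sum_j v 0 j *: g j).
  move=> a v w; rewrite scaler_sumr -big_split /=; apply: eq_bigr => j _.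
  by rewrite !mxE scalerDl scalerA.
exists N, phi => x; have [c ->] := gE x; exists (\row_j c j).
by rewrite phiE; apply: eq_bigr => j _; rewrite mxE.
Qed.

Lemma preimage_subspace V N (phi : {linear 'rV[k]_N -> V}) (S : set V) :
  is_submodule S -> exists B : 'M[k]_N, forall v, S (phi v) <-> (v <= B)%MS.
Proof.
move=> [S0 SP]; apply: (@rV_subspace N [set v | S (phi v)]).
by split=> [|a x y]; rewrite /= ?linear0 // linearP; exact: SP.
Qed.

Lemma subspace_fg V (S : set V) : finitely_generated V -> is_submodule S ->
  exists m (s : 'I_m -> V), (forall j, S (s j)) /\
    forall v, S v -> exists c : 'I_m -> k, v = \sum_j c j *: s j.
Proof.
move=> /fg_rV_surj[N [phi phiS]] /(preimage_subspace phi)[B BE].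
exists N, (fun j => phi (row j B)); split=> [j|v].
  by apply/BE; exact: row_sub.
have [u <-] := phiS v => /BE/submxP[D ->]; exists (fun j => D 0 j).
by rewrite mulmx_sum_row linear_sum; apply: eq_bigr => j _; rewrite linearZ.
Qed.

Lemma vector_space_length V : finitely_generated V ->
  exists r : set V -> nat, forall S S', is_submodule S -> is_submodule S' ->
    S `<=` S' -> (r S <= r S')%N /\ ((r S' <= r S)%N -> S' `<=` S).
Proof.
move=> /fg_rV_surj[N [phi phiS]].
have ex (S : set V) : exists B : 'M[k]_N,
    is_submodule S -> forall v, S (phi v) <-> (v <= B)%MS.
  have [SS|nS] := pselect (is_submodule S); last by exists 0.
  by have [B BE] := preimage_subspace phi SS; exists B.
have [B BE] := choice ex.
exists (fun S => \rank (B S)) => S S' SS SS' sub.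
have BB : (B S <= B S')%MS.
  by apply/row_subP => j; apply/(BE _ SS')/sub/(BE _ SS); exact: row_sub.
split=> [|le v]; first exact: mxrankS.
have [u <-] := phiS v => /(BE _ SS') uB; apply/(BE _ SS)/(submx_trans uB).
by have [_ <-] := mxrank_leqif_sup BB; rewrite eqn_leq le mxrankS.
Qed.

(** The spaces may have infinite dimension, so Zorn's lemma is applied to graphs in V * k that
    contain the graph [Gam] of [phi]. *)
Lemma field_injective : injective_module (k^o : lmodType k).
Proof.
move=> U V i phi iI.
pose T : lmodType k := (V * k^o)%type.
pose Gam := [set u : T | exists x, u = (i x, phi x)].
(* Both conditions bear on the union with [Gam], so that the empty chain, whose union is empty, also
   satisfies [P]. *)
pose P (G : set T) := is_submodule (G `|` Gam) /\ forall c, (G `|` Gam) (0, c) -> c = 0.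
have Gam0 : Gam 0 by exists 0; rewrite !linear0.
have GamS : is_submodule Gam.
  by split=> // a _ _ [x ->] [y ->]; exists (a *: x + y); rewrite !linearP.
have GamF c : Gam (0, c) -> c = 0.
  by move=> [x [/esym ix ->]]; rewrite (inj_eq0 iI ix) linear0.
have [F FP Ftot|A [[AS AF] Amax]] := @Zorn_bigcup T P.
  have mem u v : (\bigcup_(X in F) X `|` Gam) u -> (\bigcup_(X in F) X `|` Gam) v ->
      exists G, [/\ P G, (G `|` Gam) u, (G `|` Gam) v &
        (G `|` Gam) `<=` (\bigcup_(X in F) X `|` Gam)].
    have sub G : F G -> (G `|` Gam) `<=` (\bigcup_(X in F) X `|` Gam).
      by move=> FG; apply: setSU => x Gx; exists G.
    move=> [[G FG Gu]|Gu] [[G' FG' Gv]|Gv].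
    - have [GG|GG] := Ftot _ _ FG FG'.
        by exists G'; split; [exact: FP|left; exact: GG|left|exact: sub].
      by exists G; split; [exact: FP|left|left; exact: GG|exact: sub].
    - by exists G; split; [exact: FP|left|right|exact: sub].
    - by exists G'; split; [exact: FP|right|left|exact: sub].
    - exists set0; split; [|by right|by right|by rewrite set0U => x; right].
      by rewrite /P set0U; split.
  split; first split; first by right.
    move=> a u v Fu Fv; have [G [[[_ GS] _] Gu Gv Gsub]] := mem u v Fu Fv.
    exact/Gsub/GS.
  by move=> c Fc; have [G [[_ GF] Gc _ _]] := mem _ _ Fc Fc; exact: GF.
pose L := A `|` Gam.
have L0 : L 0 by right.
have LP a u v : L u -> L v -> L (a *: u + v) by case: AS => _; apply.
have Ltot v : exists c, L (v, c).
  apply: contrapT => nv.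
  (* [G] extends the maximal graph by the value 0 at [v]; if it were no longer single-valued, [v]
     would already lie in the domain. *)
  pose G := [set u : T | exists a w, L w /\ u = (w.1 + a *: v, w.2)].
  have LG : L `<=` G.
    by move=> w Lw; exists 0, w; rewrite scale0r addr0 -surjective_pairing.
  have GE : G `|` Gam = G.
    by apply/seteqP; split=> [u [//|Gu]|u Gu]; [apply: LG; right|left].
  apply: (Amax G); last first.
    rewrite /P GE; split; first split; first exact: LG.
      move=> a _ _ [b [w [Lw ->]]] [b' [w' [Lw' ->]]].
      exists (a * b + b'), (a *: w + w'); split; first exact: LP.
      by congr pair; rewrite /= scalerDr scalerDl scalerA addrACA.
    move=> c [a [w [Lw [wa ->]]]]; have [a0|a0] := eqVneq a 0.
      apply: AF; move: wa; rewrite a0 scale0r addr0 => ->.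
      by rewrite -surjective_pairing.
    case: nv; exists (- a^-1 *: w.2).
    suff -> : (v, - a^-1 *: w.2) = - a^-1 *: w + 0 by exact: LP.
    rewrite addr0; congr pair; apply: (scalerI a0).
    rewrite scalerA mulrN mulfV // scaleN1r.
    by apply/eqP; rewrite -addr_eq0 addrC -wa.
  split=> [u Au|/(_ (v, 0)) GA]; first by apply: LG; left.
  apply: nv; exists 0; left; apply: GA; exists 1, 0; split=> //.
  by congr pair; rewrite /= scale1r add0r.
have Lfun v c c' : L (v, c) -> L (v, c') -> c = c'.
  move=> Lc Lc'; apply/eqP; rewrite -subr_eq0; apply/eqP/AF.
  have := LP (-1) _ _ Lc' Lc; rewrite scaleN1r.
  suff -> : - (v, c') + (v, c) = (0, c - c') :> T by [].
  by congr pair; rewrite /= addrC ?subrr.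
have [psi psiE] := choice Ltot.
have psil : linear (psi : V -> k^o).
  move=> a v w; apply: (Lfun (a *: v + w)) (psiE _) _.
  exact: (LP a (v, psi v) (w, psi w)).
exists (mklin psil) => x /=; apply: (Lfun (i x)) (psiE _) _.
by right; exists x.
Qed.

End VectorSpaces.

(* A ring R with a central ring morphism kappa : k -> R making it finite
   dimensional; the coordinates eps on the generators e are part of the data. *)
Definition fin_dim_algebra (k : fieldType) (R : nzRingType) (kappa : k -> R) :=
  [/\ kappa 1 = 1, {morph kappa : a b / a + b}, {morph kappa : a b / a * b},
      forall c a, kappa c * a = a * kappa c
    & exists n (e : 'I_n -> R) (eps : 'I_n -> R -> k),
        (forall j c a b, eps j (kappa c * a + b) = c * eps j a + eps j b) /\
        forall a, a = \sum_j kappa (eps j a) * e j].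

(** * Finiteness properties of an algebra by restriction to the base field *)

Section Algebra.
Variables (k : fieldType) (R : nzRingType) (kappa : k -> R).
Hypothesis Rk : fin_dim_algebra kappa.
Implicit Types X Y Z M N K E Q B V L I J F P C : lmodType R.

Definition scalars of fin_dim_algebra kappa := fun M : lmodType R => (M : Type).
Section Scalars.
Variable M : lmodType R.
Local Notation kM := (scalars Rk M).
HB.instance Definition _ := GRing.Zmodule.copy kM M.
Definition scalars_scale (c : k) (x : kM) : kM := kappa c *: (x : M).
Fact scalars_scaleA a b x : scalars_scale a (scalars_scale b x) = scalars_scale (a * b) x.
Proof. by have [_ _ kM _ _] := Rk; rewrite /scalars_scale kM scalerA. Qed.
Fact scalars_scale1 : left_id 1 scalars_scale.
Proof. by have [k1 _ _ _ _] := Rk => x; rewrite /scalars_scale k1 scale1r. Qed.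
Fact scalars_scaleDr : right_distributive scalars_scale +%R.
Proof. by move=> c x y; rewrite /scalars_scale scalerDr. Qed.
Fact scalars_scaleDl x : {morph scalars_scale^~ x : a b / a + b}.
Proof. by have [_ kD _ _ _] := Rk => a b; rewrite /scalars_scale kD scalerDl. Qed.
HB.instance Definition _ := GRing.Zmodule_isLmodule.Build k kM
  scalars_scaleA scalars_scale1 scalars_scaleDr scalars_scaleDl.
End Scalars.
Local Notation res M := (scalars Rk M : lmodType k).

Lemma scalarsE M (c : k) (x : M) : c *: (x : res M) = kappa c *: x.
Proof. by []. Qed.

Lemma scalars_linear M N (f : {linear M -> N}) : linear (f : res M -> res N).
Proof. by move=> c x y; rewrite [LHS]linearP. Qed.

Lemma fg_scalars M : finitely_generated M -> finitely_generated (res M).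
Proof.
have [_ _ _ _ [n [e [eps [_ epsE]]]]] := Rk.
move=> [m [g gE]]; pose h (l : 'I_#|{: 'I_m * 'I_n}|) := enum_val l.
exists #|{: 'I_m * 'I_n}|, (fun l => e (h l).2 *: g (h l).1) => x.
have [c {1}->] := gE x; exists (fun l => eps (h l).2 (c (h l).1)).
transitivity (\sum_(p : 'I_m * 'I_n) (eps p.2 (c p.1) : k) *: (e p.2 *: g p.1 : res M)).
  rewrite -(pair_bigA _ (fun i j => (eps j (c i) : k) *: (e j *: g i : res M))) /=.
  apply: eq_bigr => i _; rewrite {1}[c i]epsE scaler_suml.
  by apply: eq_bigr => j _; rewrite scalarsE scalerA.
rewrite -(big_enum_val (fun p : 'I_m * 'I_n =>
  (eps p.2 (c p.1) : k) *: (e p.2 *: g p.1 : res M))).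
exact: eq_bigl.
Qed.

Lemma scalars_submodule M (S : set M) :
  is_submodule S -> is_submodule (S : set (res M)).
Proof. by move=> [S0 SP]; split=> // c x y; exact: SP. Qed.

Lemma algebra_finite_length : finite_length R.
Proof.
move=> M /fg_scalars/vector_space_length[r rE]; exists r => S S' SS SS'.
by apply: rE; exact: scalars_submodule.
Qed.

Lemma algebra_Noetherian : Noetherian R.
Proof.
move=> M N i iI /fg_scalars Mf.
have [m [s [sS sE]]] := subspace_fg Mf (scalars_submodule (im_sub i)).
have ex j : exists y : N, i y = s j by have [y _ <-] := sS j; exists y.
have [t tE] := choice ex.
exists m, t => x; have [|c cE] := sE (i x); first by exists x.
exists (fun j => kappa (c j)); apply: iI; rewrite cE linear_sum.
by apply: eq_bigr => j _; rewrite linearZ tE.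
Qed.

(** Maps C -> B are determined by their values on generators, so they form a subspace of a power of
    [B]. A finite spanning set gives the components of [F]; centrality of [kappa] makes the
    k-combinations linear over R. *)
Lemma algebra_left_approximations : left_approximations R.
Proof.
move=> C B [n [g gE]] Bf; have [k1 kD kM kC _] := Rk.
pose V : lmodType k := {ffun 'I_n -> res B}.
have Vf : finitely_generated V := fg_pow _ (fg_scalars Bf).
pose S := [set v : V | exists f : {linear C -> B}, forall i, f (g i) = v i].
have SS : is_submodule S.
  split=> [|c u v [f fE] [h hE]].
    by exists (\0 : {linear C -> B}) => i; rewrite ffunE.
  have [|t tE] := @linP _ _ _ (fun x => kappa c *: f x + h x).
    by move=> a x y; rewrite !linearP !scalerDr !scalerA kC addrACA.
  by exists t => i; rewrite tE fE hE !ffunE.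
have [m [s [sS sE]]] := subspace_fg Vf SS; have [f fE] := choice sS.
have [F FE] := pow_tuple f; exists m, F => h.
have [|c cE] := sE [ffun i => h (g i)]; first by exists h => i; rewrite ffunE.
have [|t tE] := @linP _ _ _ (fun w : {ffun 'I_m -> B} => \sum_j kappa (c j) *: w j).
  move=> a u v; rewrite scaler_sumr -big_split /=; apply: eq_bigr => j _.
  by rewrite !ffunE scalerDr !scalerA kC.
exists t => x; have [b ->] := gE x; rewrite !linear_sum.
apply: eq_bigr => i _; rewrite !linearZ; congr (_ *: _); rewrite tE.
transitivity (([ffun i => h (g i)] : V) i); last by rewrite ffunE.
rewrite cE sum_ffunE; apply: eq_bigr => j _.
by rewrite ffunE FE fE.
Qed.

End Algebra.


(* tau : R -> S is an isomorphism of R onto the opposite of S, with inverse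
   sigma, compatible with the k-algebra structures. *)
Definition anti_iso (k : fieldType) (R S : nzRingType) (kR : k -> R)
    (kS : k -> S) (tau : R -> S) (sigma : S -> R) :=
  [/\ {morph tau : a b / a + b}, forall a b, tau (a * b) = tau b * tau a,
      tau 1 = 1, (forall c, tau (kR c) = kS c) & cancel sigma tau /\ cancel tau sigma].

(** * The duality Hom_k(-, k) *)

Section Duality.
Variables (k : fieldType) (R S : nzRingType) (kR : k -> R) (kS : k -> S).
Variables (tau : R -> S) (sigma : S -> R).
Hypotheses (Rk : fin_dim_algebra kR) (Sk : fin_dim_algebra kS).
Hypothesis tauP : anti_iso kR kS tau sigma.
Local Notation res M := (scalars Sk M : lmodType k).
Local Notation resR M := (scalars Rk M : lmodType k).
Implicit Types M N B P I : lmodType S.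

(* Hom_k(M, k), on which R acts through tau *)
Definition dual of anti_iso kR kS tau sigma := fun M =>
  ({linear res M -> k^o} : Type).

Section DualModule.
Variable M : lmodType S.
Local Notation D := (dual tauP M).

HB.instance Definition _ := gen_eqMixin D.
HB.instance Definition _ := gen_choiceMixin D.

Definition dual_zero : D := (\0 : {linear res M -> k^o}).
Definition dual_add (f g : D) : D :=
  ((f : {linear res M -> k^o}) \+ (g : {linear res M -> k^o})).
Definition dual_opp (f : D) : D := \- (f : {linear res M -> k^o}).

Fact dual_act_linear (a : R) : linear (fun x : res M => tau a *: (x : M) : res M).
Proof.
have [_ _ _ kC _] := Sk.
by move=> c x y; rewrite /= scalerDr !scalarsE !scalerA kC.
Qed.
Definition dual_scale (a : R) (f : D) : D :=
  (f : {linear res M -> k^o}) \o mklin (dual_act_linear a).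

Fact dual_addA : associative dual_add.
Proof. by move=> f g h; apply: linear_ext => x /=; rewrite addrA. Qed.
Fact dual_addC : commutative dual_add.
Proof. by move=> f g; apply: linear_ext => x /=; rewrite addrC. Qed.
Fact dual_add0 : left_id dual_zero dual_add.
Proof. by move=> f; apply: linear_ext => x /=; rewrite add0r. Qed.
Fact dual_addN : left_inverse dual_zero dual_opp dual_add.
Proof. by move=> f; apply: linear_ext => x /=; rewrite addNr. Qed.
HB.instance Definition _ :=
  GRing.isZmodule.Build D dual_addA dual_addC dual_add0 dual_addN.

Fact dual_scaleA a b f : dual_scale a (dual_scale b f) = dual_scale (a * b) f.
Proof.
have [_ tM _ _ _] := tauP.
by apply: linear_ext => x /=; rewrite !mklinE tM scalerA.
Qed.
Fact dual_scale1 : left_id 1 dual_scale.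
Proof.
have [_ _ t1 _ _] := tauP => f.
by apply: linear_ext => x /=; rewrite mklinE t1 scale1r.
Qed.
Fact dual_scaleDr : right_distributive dual_scale +%R.
Proof. by move=> a f g; apply: linear_ext. Qed.
Fact dual_scaleDl f : {morph dual_scale^~ f : a b / a + b}.
Proof.
have [tD _ _ _ _] := tauP => a b.
by apply: linear_ext => x /=; rewrite !mklinE tD scalerDl linearD.
Qed.
HB.instance Definition _ := GRing.Zmodule_isLmodule.Build R D
  dual_scaleA dual_scale1 dual_scaleDr dual_scaleDl.

Definition dual_eval (f : D) (x : M) : k := (f : {linear res M -> k^o}) x.

Lemma dual_ext (f g : D) : dual_eval f =1 dual_eval g -> f = g.
Proof. by move=> fg; exact: linear_ext. Qed.
Lemma dual_evalZ a f x : dual_eval (a *: f) x = dual_eval f (tau a *: x).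
Proof. by []. Qed.
Lemma dual_evalP f c x y : dual_eval f (kS c *: x + y) = c * dual_eval f x + dual_eval f y.
Proof. exact: (linearP (f : {linear res M -> k^o}) c). Qed.
Lemma dual_eval0 f : dual_eval f 0 = 0.
Proof. exact: (linear0 (f : {linear res M -> k^o})). Qed.
Lemma dual_evalZk f c x : dual_eval f (kS c *: x) = c * dual_eval f x.
Proof. by rewrite -[_ *: x]addr0 dual_evalP dual_eval0 addr0. Qed.
Lemma dual_evalZr f c x : dual_eval (kR c *: f) x = c * dual_eval f x.
Proof. by have [_ _ _ tk _] := tauP; rewrite dual_evalZ tk dual_evalZk. Qed.
Lemma dual_eval_suml n (v : 'I_n -> D) x :
  dual_eval (\sum_j v j) x = \sum_j dual_eval (v j) x.
Proof. by elim/big_rec2: _ => // j y1 y2 _ <-. Qed.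
Lemma dual_eval_sumr f n (v : 'I_n -> M) :
  dual_eval f (\sum_j v j) = \sum_j dual_eval f (v j).
Proof. exact: (linear_sum (f : {linear res M -> k^o})). Qed.
Lemma dual_evalD f x y : dual_eval f (x + y) = dual_eval f x + dual_eval f y.
Proof. exact: (linearD (f : {linear res M -> k^o})). Qed.

Lemma dual_intro (f : M -> k) :
  (forall c x y, f (kS c *: x + y) = c * f x + f y) ->
  exists g : D, dual_eval g =1 f.
Proof.
move=> fl; have fl' : linear (f : res M -> k^o) by [].
by exists (mklin fl' : D).
Qed.

End DualModule.
Local Notation D M := (dual tauP M : lmodType R).

Lemma dual_evalL M a (f g : D M) x :
  dual_eval (a *: f + g) x = dual_eval f (tau a *: x) + dual_eval g x.
Proof. by []. Qed.

Section DualMap.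
Variables (M N : lmodType S) (f : {linear M -> N}).
Fact dual_map_res : linear (f : res M -> res N).
Proof. exact: scalars_linear. Qed.
Definition dual_map_fun (g : D N) : D M :=
  (g : {linear res N -> k^o}) \o mklin dual_map_res.
Fact dual_map_linear : linear dual_map_fun.
Proof.
by move=> a g h; apply: dual_ext => x; rewrite dual_evalL /dual_eval /= !mklinE linearZ.
Qed.
Definition dual_map : {linear D N -> D M} := mklin dual_map_linear.
Lemma dual_mapE g x : dual_eval (dual_map g) x = dual_eval g (f x).
Proof. by []. Qed.
End DualMap.

Lemma dual_extend M N (i : {linear M -> N}) (f : D M) : injective i ->
  exists g : D N, forall x, dual_eval g (i x) = dual_eval f x.
Proof.
move=> iI; have iI' : injective (mklin (dual_map_res i)) by exact: iI.
have [g gE] := injective_extend (f : {linear res M -> k^o}) (@field_injective k) iI'.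
by exists g => x; exact: gE.
Qed.

Lemma dual_ses (X Y Z : lmodType S) (i : {linear X -> Y}) (p : {linear Y -> Z}) :
  ses i p -> ses (dual_map p) (dual_map i).
Proof.
move=> ip; have [iI pS pE] := ip; split.
- move=> f g fg; apply: dual_ext => z; have [y <-] := pS z.
  by rewrite -!dual_mapE fg.
- move=> f; have [g gE] := dual_extend f iI.
  by exists g; apply: dual_ext => x; rewrite dual_mapE gE.
- move=> f; split=> [if0|[g <-]]; last first.
    apply: dual_ext => x; rewrite !dual_mapE (ses_comp0 _ ip).
    exact: (linear0 (g : {linear res Z -> k^o})).
  have pS' : linear_surj (mklin (dual_map_res p)) by exact: pS.
  have [y /pE[x <-]|g gE] := lin_factor (f := f : {linear res Y -> k^o}) pS'.
    by rewrite -[LHS]/(dual_eval (dual_map i f) x) if0.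
  by exists g; apply: dual_ext => y; exact: gE.
Qed.

Lemma dual_addm B N : addm B N -> addm (D B) (D N).
Proof.
move=> [r [f [g fg]]]; exists r, (fun j => dual_map (g j)), (fun j => dual_map (f j)).
move=> u; apply: dual_ext => x.
by rewrite dual_eval_suml {1}[x]fg dual_eval_sumr; apply: eq_bigr => j _.
Qed.

Lemma anti_iso_inverse : [/\ {morph sigma : a b / a + b},
  forall a b, sigma (a * b) = sigma b * sigma a, sigma 1 = 1 &
  forall c, sigma (kS c) = kR c].
Proof.
have [tD tM t1 tk [sK tK]] := tauP; have tI := can_inj tK.
by split=> [a b|a b||c]; apply: tI; rewrite ?tD ?tM !sK ?t1 ?tk.
Qed.

Section Cogenerator.
Local Notation DS := (D (S^o : lmodType S)).

(** One direction of the bijection between Hom_R(X, DS) and Hom_k(X, k), which reduces injectivity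
    of [DS] and cogeneration by it to facts on vector spaces. *)
Lemma dual_regular_intro (X : lmodType R) (psi : {linear resR X -> k^o}) :
  exists g : {linear X -> DS}, forall x s,
    dual_eval (g x) s = psi (sigma s *: x : resR X).
Proof.
have [sD sM s1 sk] := anti_iso_inverse; have [_ _ _ kC _] := Rk.
have [tD tM t1 tk [sK tK]] := tauP.
have ex x : exists g : DS, dual_eval g =1 fun s => psi (sigma s *: x : resR X).
  apply: dual_intro => c a b; rewrite sD -[kS c *: a]/(kS c * a) sM sk -kC.
  by rewrite scalerDl -scalerA -[kR c *: _]/(c *: (sigma a *: x : resR X)) linearP.
have [g gE] := choice ex.
have gl : linear (g : X -> DS).
  move=> a x y; apply: dual_ext => s; rewrite dual_evalL !gE.
  rewrite -[tau a *: s]/(tau a * s) sM tK -linearD; congr (psi _).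
  by rewrite scalerDr scalerA.
by exists (mklin gl) => x s; rewrite -gE.
Qed.

Lemma dual_regular_injective : injective_module DS.
Proof.
move=> M N i f iI; have [tD tM t1 tk [sK tK]] := tauP.
have phil : linear (fun m : resR M => dual_eval (f m) 1 : k^o).
  move=> c x y; rewrite [f _](linearP f (kR c)) dual_evalL tk.
  by rewrite -[X in dual_eval (f x) X]addr0 dual_evalP
    -[dual_eval _ 0]/((f x : {linear res _ -> k^o}) 0) linear0 addr0.
have iI' : injective (mklin (@scalars_linear _ _ _ Rk _ _ i)) by exact: iI.
have [psi psiE] := injective_extend (mklin phil) (@field_injective k) iI'.
have [g gE] := dual_regular_intro psi.
exists g => m; apply: dual_ext => s; rewrite [LHS]gE.
have -> : sigma s *: i m = i (sigma s *: m) by rewrite linearZ.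
rewrite [LHS](psiE (sigma s *: m)) mklinE linearZ dual_evalZ sK.
by congr dual_eval; rewrite /GRing.scale /= mulr1.
Qed.

Lemma dual_regular_separated (X : lmodType R) : separated X DS.
Proof.
move=> x xD; have [s1 _ _ _] := anti_iso_inverse; apply: contrapT => x0.
have il := @scale_lin k (resR X) x.
have iI : injective (mklin il).
  apply: lin_inj => c; rewrite mklinE => /eqP; rewrite scaler_eq0.
  by case/orP => /eqP // /x0.
have [psi psiE] := injective_extend idfun (@field_injective k) iI.
have [g gE] := dual_regular_intro psi.
have := psiE 1; rewrite mklinE scale1r /= => px.
have [_ _ s1' _] := anti_iso_inverse.
have := gE x 1; rewrite s1' scale1r px xD -[LHS]/0 => /eqP.
by rewrite eq_sym oner_eq0.
Qed.

End Cogenerator.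

Lemma dual_fg M : finitely_generated M -> finitely_generated (D M).
Proof.
move=> /(fg_scalars Sk)[n [g gE]]; have [tD tM t1 tk _] := tauP.
pose V : lmodType k := {ffun 'I_n -> k^o}.
pose SV := [set v : V | exists f : D M, forall i, dual_eval f (g i) = v i].
have SS : is_submodule SV.
  split=> [|c u v [f fE] [h hE]]; first by exists 0 => i; rewrite ffunE.
  exists (kR c *: f + h) => i.
  by rewrite [LHS]/(dual_eval (kR c *: f) _ + dual_eval h _) dual_evalZr fE hE !ffunE.
have [m [s [sS sE]]] := subspace_fg (fg_pow n (fg_regular k)) SS.
have [f fE] := choice sS; exists m, f => h.
have [|c cE] := sE [ffun i => dual_eval h (g i)]; first by exists h => i; rewrite ffunE.
exists (fun j => kR (c j)); apply: dual_ext => x; have [b ->] := gE x.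
rewrite !dual_eval_sumr; apply: eq_bigr => i _; rewrite !dual_evalZk; congr (_ * _).
rewrite dual_eval_suml.
transitivity (([ffun i => dual_eval h (g i)] : V) i); first by rewrite ffunE.
rewrite cE sum_ffunE; apply: eq_bigr => j _.
by rewrite dual_evalZr fE ffunE.
Qed.

End Duality.

Lemma anti_iso_sym (k : fieldType) (R S : nzRingType) (kR : k -> R)
    (kS : k -> S) (tau : R -> S) (sigma : S -> R) :
  anti_iso kR kS tau sigma -> anti_iso kS kR sigma tau.
Proof.
by move=> tauP; have [sD sM s1 sk] := anti_iso_inverse tauP;
  have [_ _ _ _ [sK tK]] := tauP.
Qed.

Section DoubleDual.
Variables (k : fieldType) (R S : nzRingType) (kR : k -> R) (kS : k -> S).
Variables (tau : R -> S) (sigma : S -> R).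
Hypotheses (Rk : fin_dim_algebra kR) (Sk : fin_dim_algebra kS).
Hypothesis tauP : anti_iso kR kS tau sigma.
Let sigmaP := anti_iso_sym tauP.
Local Notation D M := (dual Sk tauP M : lmodType R).
Local Notation D' M := (dual Rk sigmaP M : lmodType S).

Lemma algebra_enough_injectives : enough_injectives R.
Proof.
move=> M Mf.
have Df : finitely_generated (D (S^o : lmodType S)) := dual_fg Sk tauP (fg_regular S).
have [r [F [FI _]]] := separated_embed (algebra_left_approximations Rk) Mf Df
  (@dual_regular_separated _ _ _ _ _ _ _ Rk Sk tauP M).
exists {ffun 'I_r -> D (S^o : lmodType S)}, F; split=> //; first exact: fg_pow.
apply: injective_addm (@addm_pow _ _ r) _; exact: dual_regular_injective.
Qed.

(** The map is evaluation. The coordinate functionals E_j satisfy that phi is the sum of the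
    phi(e_j) E_j, which yields preimages. *)
Lemma double_dual_regular :
  exists h : {linear (R^o : lmodType R) -> D (D' (R^o : lmodType R))}, bijective h.
Proof.
have [k1 kD kM kC [n [e [eps [epsl epsE]]]]] := Rk.
have exE j : exists E : D' (R^o : lmodType R), dual_eval E =1 eps j.
  by apply: dual_intro => c a b; exact: epsl.
have [E EE] := choice exE.
have exh (a : R^o) : exists F : D (D' (R^o : lmodType R)),
    forall phi, dual_eval F phi = dual_eval phi a.
  apply: dual_intro => c f g.
  by rewrite -dual_evalZr.
have [h hE] := choice exh.
have hl : linear (h : R^o -> D (D' (R^o : lmodType R))).
  move=> a b c; apply: dual_ext => phi.
  have [_ _ _ _ [_ tK]] := tauP.
  by rewrite dual_evalL !hE dual_evalD dual_evalZ tK.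
have sum_eps (a : R^o) : a = \sum_j kR (eps j a) *: (e j : R^o) := epsE a.
exists (mklin hl); apply: lin_biject.
  apply: lin_inj => a; rewrite mklinE => ha; rewrite [a]sum_eps big1 // => j _.
  have -> : eps j a = 0.
    by rewrite -EE -hE ha.
  by rewrite (_ : kR 0 = 0) ?scale0r //; apply: (addrI (kR 0)); rewrite -kD !addr0.
move=> F; exists (\sum_j kR (dual_eval F (E j)) *: (e j : R^o)).
apply: dual_ext => phi; rewrite mklinE hE dual_eval_sumr.
have phiE : phi = \sum_j kS (dual_eval phi (e j)) *: E j.
  apply: dual_ext => a; rewrite {1}[a]sum_eps dual_eval_sumr dual_eval_suml.
  by apply: eq_bigr => j _; rewrite dual_evalZk dual_evalZr EE mulrC.
rewrite [in RHS]phiE dual_eval_sumr; apply: eq_bigr => j _.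
by rewrite !dual_evalZk mulrC.
Qed.

End DoubleDual.

Section DualResolution.
Variables (k : fieldType) (R S : nzRingType) (kR : k -> R) (kS : k -> S).
Variables (tau : R -> S) (sigma : S -> R).
Hypotheses (Rk : fin_dim_algebra kR) (Sk : fin_dim_algebra kS).
Hypothesis tauP : anti_iso kR kS tau sigma.
Let sigmaP := anti_iso_sym tauP.
Local Notation D M := (dual Sk tauP M : lmodType R).
Local Notation D' M := (dual Rk sigmaP M : lmodType S).
Let R_noeth := algebra_Noetherian Rk.
Let R_einj := algebra_enough_injectives Rk Sk tauP.
Let S_noeth := algebra_Noetherian Sk.
Let S_einj := algebra_enough_injectives Sk Rk sigmaP.

(** [I] is a retract of a power of the cogenerator D' R, so D I is a retract of a power of D (D' R),
    which is R. *)
Lemma dual_projective (I : lmodType S) :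
  finitely_generated I -> injective_module I -> projective (D I).
Proof.
move=> If Ii; pose Q : lmodType S := D' (R^o : lmodType R).
have Qf : finitely_generated Q := dual_fg Rk sigmaP (fg_regular R).
have [r [F [FI _]]] := separated_embed (algebra_left_approximations Sk) If Qf
  (@dual_regular_separated _ _ _ _ _ _ _ Sk Rk sigmaP I).
have [g gE] := injective_extend idfun Ii FI.
have QI : addm Q I := addm_trans (@addm_pow _ Q r) (addm_retract gE).
have [h /addm_iso[hR _]] := double_dual_regular Rk Sk tauP.
apply: projective_addm (addm_trans hR (dual_addm Sk tauP QI)) _.
exact: projective_regular.
Qed.

Lemma dual_injective (P : lmodType S) :
  finitely_generated P -> projective P -> injective_module (D P).
Proof.
move=> Pf Pp; apply: injective_addm (dual_addm Sk tauP (addm_projective Pf Pp)) _.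
exact: dual_regular_injective.
Qed.

Lemma dual_idim_le n (U : lmodType S) :
  finitely_generated U -> pdim_le n U -> idim_le n (D U).
Proof.
elim: n U => [|n IHn] U Uf Un.
  apply: idim_le_injective; first exact: dual_fg.
  apply: dual_injective => //; exact: (pdim_le0_projective S_noeth S_einj).
have [K [P [i [p [ip Pf Pp Kf _]]]]] := cover S_noeth Uf.
apply: (idim_le_splice (dual_ses Sk tauP ip)); first exact: dual_fg.
  exact: dual_injective.
apply: IHn => //; exact: (pdim_le_syzygy S_noeth S_einj ip Pf Pp Un).
Qed.

(** The coresolution is dualized step by step: the D (I^j) are projective, and of finite injective
    dimension as the I^j have finite projective dimension; the kernels inherit the latter. *)
Lemma dual_fid_resolved n (X : lmodType S) (I : inj_coresolution X) :
  finite_idim (D X) -> (forall j, (j < n)%N -> exists m, pdim_le m (I j)) ->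
  fid_resolved n (D X).
Proof.
elim: n X I => [|n IHn] X I Xd Ip; first exact: fid_resolved0.
have [Y [q [e [iq eE]]]] := ic_shift_exists I.
have [m I0m] := Ip 0 isT; have If := ic_fg I 0.
have DId : finite_idim (D (I 0)).
  by split; [exact: dual_fg|exists m; exact: dual_idim_le].
have Dses := dual_ses Sk tauP iq.
apply: (fid_resolvedS Dses DId); first by apply: dual_projective => //; exact: (@ic_inj _ _ I 0).
apply: (IHn Y (ic_shift iq eE)); first exact: (finite_idim_sub R_noeth R_einj Dses).
by move=> j jn; exact: Ip.
Qed.

End DualResolution.


(** * Minimal resolutions *)

Section ProjectiveCovers.
Variable R : nzRingType.
Implicit Types X Y Z M N K E Q B U V L I J F P C : lmodType R.
Hypothesis R_noeth : Noetherian R.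
Hypothesis R_flen : finite_length R.

(** [v] is a power of [u] with stable image and kernel, so that [M] is their direct sum. The first
    two clauses record what any power with positive exponent inherits from [u]. *)
Lemma Fitting M (u : {linear M -> M}) : finitely_generated M ->
  exists v : {linear M -> M},
    [/\ forall S : set M, (forall x, S (u x)) -> forall x, S (v x),
        forall N (p : {linear M -> N}), (forall x, p (u x) = p x) ->
          forall x, p (v x) = p x,
        forall x, exists y, v x = v (v y)
      & forall x, v (v x) = 0 -> v x = 0].
Proof.
move=> Mf; have [r rE] := R_flen Mf.
pose fix v n : {linear M -> M} := if n is m.+1 then v m \o v m else u.
have T_sub : is_submodule [set: M] by [].
have rT S : is_submodule S -> (r S <= r [set: M])%N.
  by move=> SS; have [] := rE _ _ SS T_sub (fun _ _ => Logic.I).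
have imS n : range (v n.+1) `<=` range (v n).
  by move=> _ [x _ <-]; exists (v n x).
have keS n : linear_ker (v n) `<=` linear_ker (v n.+1).
  by move=> x; rewrite /linear_ker /= => ->; rewrite linear0.
have [i1 i2] := all_and2 (fun n => rE _ _ (im_sub (v n.+1)) (im_sub (v n)) (imS n)).
have [k1 k2] := all_and2 (fun n => rE _ _ (ker_sub (v n)) (ker_sub (v n.+1)) (keS n)).
(* Kernels grow and images shrink under squaring, so both summands are nondecreasing; where the sum
   does not grow, both are stationary. *)
have [|n le] := @bounded_nat_stable
    (fun n => r (linear_ker (v n)) + (r [set: M] - r (range (v n))))%N
    (r [set: M] + r [set: M])%N.
  by move=> n; apply: leq_add; [exact/rT/ker_sub|exact: leq_subr].
have ik := i1 n; have kk := k1 n; have it := rT _ (im_sub (v n)).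
have it' := rT _ (im_sub (v n.+1)).
have le1 : (r (range (v n)) <= r (range (v n.+1)))%N.
  rewrite leqNgt; apply/negP => lt; move: le; rewrite leqNgt => /negP; apply.
  by rewrite -addnS; apply: leq_add => //; exact: ltn_sub2l (leq_trans lt it) lt.
have le2 : (r (linear_ker (v n.+1)) <= r (linear_ker (v n)))%N.
  rewrite leqNgt; apply/negP => lt; move: le; rewrite leqNgt => /negP; apply.
  by rewrite -addSn; apply: leq_add => //; exact: leq_sub2l.
exists (v n); split.
- by move=> S Su; elim: n {le ik kk it it' le1 le2} => //= n IHn x; exact: IHn.
- move=> N p pu; elim: n {le ik kk it it' le1 le2} => //= n IHn x.
  by rewrite !IHn.
- by move=> x; have [|y _ <-] := i2 n le1 (v n x); [exists x|exists y].
- by move=> x; exact: (k2 n le2).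
Qed.

(* Among the idempotents e of a free cover F of X that respect the map to X, take
   one of minimal image: its image is a projective cover, since a submodule that
   still maps onto X would contain the image of another such idempotent, by
   Fitting. *)
Lemma projective_cover X : finitely_generated X ->
  exists K P (i : {linear K -> P}) (p : {linear P -> X}),
    [/\ ses i p, finitely_generated P, projective P, finitely_generated K
      & superfluous (linear_ker p)].
Proof.
move=> /free_cover[n [p pS]]; set F := ({ffun 'I_n -> R^o} : lmodType R) in p pS.
have Ff : finitely_generated F := fg_pow _ (fg_regular R).
have Fp : projective F := @projective_pow R n.
have [r rE] := R_flen Ff.
pose good (e : {linear F -> F}) := (forall x, e (e x) = e x) /\ forall x, p (e x) = p x.
have ex : exists m, `[< exists2 e, good e & r (range e) = m >].
  by exists (r (range (idfun : {linear F -> F}))); apply/asboolP; exists idfun.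
case: (ex_minnP ex) => m /asboolP[e [ee pe] em] mmin.
have [P [q [j [qS jI jq]]]] := lin_image e.
have qj y : q (j y) = y.
  by have [x <-] := qS y; apply: jI; rewrite !jq ee.
have piS : linear_surj (p \o j).
  by move=> x; have [y <-] := pS x; exists (q y); rewrite /= jq pe.
have [K [i ip]] := ses_ker piS.
have FP : addm F P := addm_retract qj.
have Pf := fg_addm FP Ff.
exists K, P, i, (p \o j); split=> //; first exact: projective_addm FP Fp.
  by have [iI _ _] := ip; exact: R_noeth iI Pf.
move=> S SS Scov; have [L [l [lI lE]]] := submod_exists SS.
have plS : linear_surj (p \o j \o l).
  move=> x; have [y <-] := piS x; have [s Ss ys] := Scov y.
  have [z zs] := (lE s).1 Ss; exists z; rewrite /= zs.
  by apply/eqP; rewrite eq_sym -subr_eq0; apply/eqP; rewrite -!linearB; exact: ys.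
have [h hE] := projective_lift p Fp plS.
have [v [vS vp vim vker]] := Fitting (j \o l \o h : {linear F -> F}) Ff.
have vP x : p (v x) = p x by apply: vp => y; rewrite -[RHS]hE.
have vuniq a b : v (v a) = v (v b) -> v a = v b.
  move=> vab; apply/eqP; rewrite -subr_eq0 -linearB; apply/eqP/vker.
  by rewrite !linearB vab subrr.
(* [v \o g] is the projection onto the image of [v] along its kernel; [vuniq] makes it linear
   although [g] is merely chosen. *)
have [g gE] := choice vim.
have e'l : linear (v \o g).
  move=> a x y; rewrite /= -linearP; apply: vuniq.
  by rewrite -gE !linearP /= -!gE.
have ve' x : v (v (g x)) = v x by rewrite -gE.
have e'good : good (mklin e'l).
  split=> x; rewrite !mklinE /=; last by rewrite -vP ve' vP.
  by apply: vuniq; rewrite !ve'.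
have sub : range (mklin e'l) `<=` range e.
  move=> _ [x _ <-]; rewrite mklinE /=.
  apply: (vS (range e)) => y; have [z zE] := qS (l (h y)).
  by exists z; rewrite //= -jq zE.
have le : (r (range e) <= r (range (mklin e'l)))%N.
  by rewrite em; apply: mmin; apply/asboolP; exists (mklin e'l).
have := (rE _ _ (im_sub (mklin e'l)) (im_sub e) sub).2 le => sub'.
apply/seteqP; split=> // y _.
have [|x _ xy] := sub' (j y); first by exists (j y); rewrite // -jq qj.
pose jS := [set z | exists2 s, S s & z = j s].
have : jS (j y).
  rewrite -xy mklinE; apply: (vS jS) => z; exists (l (h z)) => //.
  by apply/lE; exists (h z).
by case=> s Ss /jI->.
Qed.

Record min_cover X := MinCover {
  mc_ker : lmodType R; mc_proj : lmodType R;
  mc_incl : {linear mc_ker -> mc_proj}; mc_map : {linear mc_proj -> X};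
  mc_ses : ses mc_incl mc_map; mc_fg : finitely_generated mc_proj;
  mc_projective : projective mc_proj;
  mc_ker_fg : finitely_generated mc_ker;
  mc_minimal : superfluous (linear_ker mc_map) }.

(** Inhabitation is stated in [Prop], from which [cid] chooses a cover at each stage of the
    resolution. *)
Lemma min_cover_exists X : finitely_generated X -> exists _ : min_cover X, True.
Proof.
move=> /projective_cover[K [P [i [p [ip Pf Pp Kf sup]]]]].
by exists (MinCover ip Pf Pp Kf sup).
Qed.

Section MinimalResolution.
Variables (X : lmodType R) (Xf : finitely_generated X).
Definition stage := {Y : lmodType R | finitely_generated Y}.
Definition stage_cover (s : stage) : min_cover (sval s) :=
  sval (cid (min_cover_exists (svalP s))).
Fixpoint stages (n : nat) : stage :=
  if n is m.+1 then let c := stage_cover (stages m) in exist _ (mc_ker c) (mc_ker_fg c)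
  else exist _ X Xf.
Definition mr_obj n := mc_proj (stage_cover (stages n)).
Definition mr_d n : {linear mr_obj n -> with_aug X mr_obj n} :=
  match n with
  | 0 => mc_map (stage_cover (stages 0))
  | m.+1 => mc_incl (stage_cover (stages m)) \o mc_map (stage_cover (stages m.+1))
  end.
Fact mr_ker n x : mr_d n x = 0 <-> mc_map (stage_cover (stages n)) x = 0.
Proof.
case: n x => [|n] x //=.
have [iI _ _] := mc_ses (stage_cover (stages n)).
by split=> [/(inj_eq0 iI)|->] //; rewrite linear0.
Qed.
Fact mr_surj : linear_surj (mr_d 0).
Proof. by have [_ + _] := mc_ses (stage_cover (stages 0)). Qed.
Fact mr_exact n : linear_ker (mr_d n) = range (mr_d n.+1).
Proof.
have [_ _ pE] := mc_ses (stage_cover (stages n)).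
have [_ pS _] := mc_ses (stage_cover (stages n.+1)).
apply/predeqP => x; rewrite /linear_ker /= mr_ker pE; split=> [[y <-]|[y _ <-]].
  by have [z <-] := pS y; exists z.
by exists (mc_map (stage_cover (stages n.+1)) y).
Qed.
Definition min_resolution : proj_resolution X :=
  ProjResolution (fun n => mc_fg (stage_cover (stages n)))
    (fun n => @mc_projective _ (stage_cover (stages n))) mr_surj mr_exact.
Lemma min_resolution_minimal : pr_minimal min_resolution.
Proof.
move=> n; rewrite (_ : linear_ker _ = linear_ker (mc_map (stage_cover (stages n)))).
  exact: mc_minimal.
by apply/predeqP => x; exact: mr_ker.
Qed.
End MinimalResolution.

End ProjectiveCovers.


(** * Comparison of towers with projective resolutions, and direct sums *)

Section Syzygies.
Variable R : nzRingType.
Implicit Types X Y Z M N K E Q B U V L I J F C S : lmodType R.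
Hypothesis R_noeth : Noetherian R.
Hypothesis R_einj : enough_injectives R.
Local Notation Reg := (R^o : lmodType R).

(** A retract up to maps through a finite free module; equivalently, [X] is a direct summand of Y +
    R^m. *)
Definition stable_retract X Y : Prop :=
  exists (f : {linear X -> Y}) (g : {linear Y -> X}) m
    (h : 'I_m -> {linear X -> Reg}) (l : 'I_m -> {linear Reg -> X}),
    forall x, x = g (f x) + \sum_j l j (h j x).

(* Schanuel's lemma for retracts *)
Lemma stable_retract_syzygy K1 Q1 C1 K2 Q2 C2
    (i1 : {linear K1 -> Q1}) (p1 : {linear Q1 -> C1})
    (i2 : {linear K2 -> Q2}) (p2 : {linear Q2 -> C2}) :
  ses i1 p1 -> finitely_generated Q1 -> projective Q1 ->
  ses i2 p2 -> projective Q2 -> stable_retract C1 C2 -> stable_retract K1 K2.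
Proof.
move=> ip1 Q1f Q1p ip2 Q2p [f [g [m [h [l fg]]]]].
have [i1I p1S p1E] := ip1; have [i2I p2S p2E] := ip2.
have [a aE] := projective_lift (f \o p1) Q1p p2S.
have [b bE] := projective_lift (g \o p2) Q2p p1S.
have [c cE] := choice (fun j => projective_lift (l j) (@projective_regular R) p1S).
have [s sE] := lin_sum (fun j => h j \o p1 : {linear Q1 -> Reg}) c.
(* [t] is the identity minus [b \o a] and minus the free part [s]. It lands in [K1], and the
   resulting [r] gives the part of the retraction that factors through [Q1]. *)
have [t0 t0E] := lin_sub idfun (b \o a); have [t tE] := lin_sub t0 s.
have [x|r rE] := lin_colift (f := t) i1I.
  apply/p1E; rewrite tE t0E sE !linearB /= bE /= aE /= linear_sum.
  rewrite [X in X - _ - _]fg -addrA -opprD; apply/eqP; rewrite subr_eq0; apply/eqP.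
  by congr (_ + _); apply: eq_bigr => j _; rewrite cE.
have [x|a' a'E] := lin_colift (f := a \o i1) i2I.
  by apply/p2E; rewrite /= aE /= (ses_comp0 _ ip1) linear0.
have [x|b' b'E] := lin_colift (f := b \o i2) i1I.
  by apply/p1E; rewrite /= bE /= (ses_comp0 _ ip2) linear0.
have [n [u [v uv]]] := addm_projective Q1f Q1p.
exists a', b', n, (fun j => u j \o i1), (fun j => r \o v j) => x.
have -> : \sum_j (r \o v j) ((u j \o i1) x) = r (i1 x).
  by rewrite [i1 x in RHS]uv linear_sum.
apply: i1I; rewrite linearD b'E /= a'E /= rE tE t0E sE big1 => [|j _].
  by rewrite subr0 /= addrC subrK.
by rewrite /= (ses_comp0 _ ip1) !linear0.
Qed.

(** The tower and the resolution are descended together from their ends [C] and [C2]; Schanuel's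
    lemma passes the stable retract from cokernels to kernels. *)
Lemma tower_syzygy n X C : tower X n C ->
  forall C2 (P : proj_resolution C2), stable_retract C C2 ->
  exists Y (j : {linear Y -> with_aug C2 P n}),
    [/\ injective j, range j = range (pr_d P n) & stable_retract X Y].
Proof.
elim=> {n C} [C2 P CC2|n C C' Q i p _ IH ip Qf Qp C2 P CC2].
  exists C2, idfun; split=> //; apply/predeqP => x; split=> _; last by exists x.
  by have [y <-] := @pr_surj _ _ P x; exists y.
have [K [k [e [kp eE]]]] := pr_shift_exists P.
have CK := stable_retract_syzygy ip Qf Qp kp (@pr_proj _ _ P 0) CC2.
have [Y [j [jI jr XY]]] := IH K (pr_shift kp eE) CK.
have [kI _ _] := kp.
(* In the truncated resolution the 0-th syzygy is [K] itself and must be moved into [P 0] along [k];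
   from the next degree on, the differentials are those of [P]. *)
case: n j jI jr {IH} => [|n] j jI jr; last by exists Y, j; split.
exists Y, (k \o j); split=> //; first by move=> x y /kI /jI.
apply/predeqP => x; split=> -[y _ <-].
  have : range j (j y) by exists y.
  by rewrite jr => -[z _ /= <-]; exists z; rewrite //= eE.
have : range e (e y) by exists y.
by rewrite -[range e]jr => -[z _ zE]; exists z; rewrite //= zE eE.
Qed.

Lemma Ext0_syzygy d n Z (P : proj_resolution Z) Y V (j : {linear Y -> with_aug Z P d}) :
  finitely_generated Z -> finitely_generated V -> injective j ->
  range j = range (pr_d P d) ->
  finitely_generated Y /\ (Ext0 (d + n).+1 Z V -> Ext0 n.+1 Y V).
Proof.
move=> + Vf; elim: d Z P j => [|d IHd] Z P j Zf jI jr.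
  have jS : linear_surj j.
    move=> x; have : range (pr_d P 0) x by have [y <-] := @pr_surj _ _ P x; exists y.
    by rewrite -jr => -[y _ <-]; exists y.
  have [_ ZY] := addm_iso (lin_biject jI jS).
  by split; [exact: fg_addm ZY Zf|apply: (Ext0_addl R_noeth R_einj Zf Vf ZY)].
have [K [k [e [kp eE]]]] := pr_shift_exists P; have [kI _ _] := kp.
have Kf := ses_fgl R_noeth kp (pr_fg P 0).
have [j' [j'I j'r]] : exists j' : {linear Y -> with_aug K (pr_shift kp eE) d},
    injective j' /\ range j' = range (pr_d (pr_shift kp eE) d).
  case: d {IHd} j jI jr => [|d] j jI jr; last by exists j.
  have [y|j' j'E] := lin_colift (f := j : {linear Y -> P 0}) kI.
    have : range j (j y) by exists y.
    by rewrite jr => -[z _ <-]; exists (e z).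
  exists j'; split; first by move=> x y xy; apply: jI; rewrite -!j'E xy.
  apply/predeqP => x; split=> -[y _ <-].
    have : range j (j y) by exists y.
    by rewrite jr => -[z _ zE]; exists z => //; apply: kI; rewrite /= eE zE j'E.
  have : range (pr_d P 1) (k (e y)) by exists y; rewrite ?eE.
  by rewrite -jr => -[z _ zE]; exists z => //; apply: kI; rewrite j'E zE.
have [Yf EY] := IHd K _ j' Kf j'I j'r; split=> // EZ; apply: EY.
by apply/(Ext0_shiftl R_noeth R_einj (d + n) Vf kp (pr_fg P 0) (@pr_proj _ _ P 0)).
Qed.

Lemma direct_summand_retract X S (f : {linear X -> S}) (g : {linear S -> X}) :
  (forall x, g (f x) = x) -> direct_summand X S.
Proof.
move=> gf; have [K [i [iI iE]]] := submod_exists (ker_sub g).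
have [|h hE] := @linP _ _ _ (fun u : X * K => f u.1 + i u.2).
  by move=> a u v; rewrite !linearP /= scalerDr addrACA.
have gi y : g (i y) = 0 by apply/iE; exists y.
exists K, h; apply: lin_biject.
  apply: lin_inj => -[x y]; rewrite hE /= => xy.
  have x0 : x = 0 by rewrite -(gf x) -[RHS](linear0 g) -xy linearD gi addr0.
  by move: xy; rewrite x0 linear0 add0r => /(inj_eq0 iI)->.
move=> s; have [|y yE] := (iE (s - f (g s))).1.
  by rewrite /linear_ker /= linearB gf subrr.
by exists (g s, y); rewrite hE /= yE addrC subrK.
Qed.

Lemma direct_summand_addm X S : direct_summand X S -> addm S X.
Proof.
move=> [X' [f /addm_iso[_ SX]]].
exact: addm_trans SX (addm_prodl _ _).
Qed.

Lemma direct_sum_retract (D : lmodType R -> Prop) Y X : D Y -> D Reg ->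
  stable_retract X Y ->
  exists2 S, finite_direct_sum D S & direct_summand X S.
Proof.
move=> DY DR [f [g [m [h [l fg]]]]].
have [S [Sd [F [G FG]]]] : exists S, finite_direct_sum D S /\
    exists (F : {linear X -> S}) (G : {linear S -> X}),
      forall x, G (F x) = \sum_j l j (h j x).
  elim: m h l {fg} => [|m IHm] h l.
    exists 'rV[R]_0; split; first exact: fds_nil.
    by exists (\0 : {linear X -> 'rV[R]_0}), (\0 : {linear 'rV[R]_0 -> X}) => x;
      rewrite big_ord0.
  have [S [Sd [F [G FG]]]] := IHm (fun j => h (lift ord0 j)) (fun j => l (lift ord0 j)).
  exists (Reg * S)%type; split; first exact: fds_cons.
  have [|F' F'E] := @linP _ _ _ (fun x => (h ord0 x, F x) : Reg * S).
    by move=> a x y; rewrite !linearP.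
  have [|G' G'E] := @linP _ _ _ (fun u : Reg * S => l ord0 u.1 + G u.2).
    by move=> a u v; rewrite !linearP /= scalerDr addrACA.
  by exists F', G' => x; rewrite G'E F'E /= FG big_ord_recl.
have [|F' F'E] := @linP _ _ _ (fun x => (f x, F x) : Y * S).
  by move=> a x y; rewrite !linearP.
have [|G' G'E] := @linP _ _ _ (fun u : Y * S => g u.1 + G u.2).
  by move=> a u v; rewrite !linearP /= scalerDr addrACA.
exists (Y * S)%type; first exact: fds_cons.
by apply: (@direct_summand_retract _ _ F' G') => x; rewrite G'E F'E /= FG -fg.
Qed.

Lemma Ext0_direct_sum (D : lmodType R -> Prop) n V S : finitely_generated V ->
  (forall M, D M -> finitely_generated M /\ Ext0 n.+1 M V) ->
  finite_direct_sum D S -> finitely_generated S /\ Ext0 n.+1 S V.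
Proof.
move=> Vf DV; elim=> {S} [|M N DM _ [Nf NV]].
  have F0 := @rV0_fg R.
  by split=> //; apply: (Ext0_projl R_noeth R_einj n F0 Vf); exact: rV0_projective.
have [Mf MV] := DV M DM.
by split; [exact: fg_prod|exact: Ext0_prod].
Qed.

End Syzygies.

(** * The algebra and its opposite *)

Section FalgebraStructure.
Variables (k : fieldType) (A : falgType k).

Lemma falgebra_right : fin_dim_algebra (fun c : k => c%:A : A^c).
Proof.
have aE c (a : A^c) : (c%:A : A^c) * a = c *: (a : A).
  by rewrite -[LHS]/((a : A) * c%:A) mulr_algr.
split.
- exact: scale1r.
- by move=> a b; rewrite scalerDl.
- by move=> a b; rewrite aE scalerA.
- by move=> c a; rewrite aE -[RHS]/(c%:A * (a : A)) mulr_algl.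
exists (\dim {:A}), (fun j => (vbasis {:A})`_j), (fun j => coord (vbasis {:A}) j).
split=> [j c a b|a]; first by rewrite aE linearP.
rewrite [LHS](coord_vbasis (memvf (a : A))); apply: eq_bigr => j _.
by rewrite aE.
Qed.

Lemma falgebra_left : fin_dim_algebra (fun c : k => c%:A : A^c^c).
Proof.
have aE c (a : A^c^c) : (c%:A : A^c^c) * a = c *: (a : A).
  by rewrite -[LHS]/(c%:A * (a : A)) mulr_algl.
split.
- exact: scale1r.
- by move=> a b; rewrite scalerDl.
- by move=> a b; rewrite aE scalerA.
- by move=> c a; rewrite aE -[RHS]/((a : A) * c%:A) mulr_algr.
exists (\dim {:A}), (fun j => (vbasis {:A})`_j), (fun j => coord (vbasis {:A}) j).
split=> [j c a b|a]; first by rewrite aE linearP.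
rewrite [LHS](coord_vbasis (memvf (a : A))); apply: eq_bigr => j _.
by rewrite aE.
Qed.

(** Left A-modules are modules over [A^c^c], whose product is convertible to that of [A]; so the
    identity is an anti-isomorphism. *)
Lemma falgebra_anti_iso : anti_iso (fun c : k => c%:A : A^c)
  (fun c : k => c%:A : A^c^c) (id : A^c -> A^c^c) (id : A^c^c -> A^c).
Proof. by []. Qed.

End FalgebraStructure.

Theorem theorem0p5 (k : fieldType) (A : falgType k) (W : bimodule A) (d : nat)
    (W_dualizing : dualizing W) (fidim_A : fidim_eq A d)
    (A_Gorenstein : Gorenstein A d \/ quasi_Gorenstein A^c d) :
  forall X : lmodType A^c, CM W X <-> Omega_mod d X.
Proof.
have Rk := falgebra_right A; have Sk := falgebra_left A.
have tauP := falgebra_anti_iso A.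
have noeth := algebra_Noetherian Rk.
have einj := algebra_enough_injectives Rk Sk tauP.
have approx := algebra_left_approximations Rk.
have flen := algebra_finite_length Rk.
have Wd := finite_idim_W noeth einj W_dualizing; have [Wf _] := Wd.
move=> X; split=> [[Xf XW]|[Xf [S Sd /direct_summand_addm SX]]]; last first.
  (* As [W] has finite injective dimension, [fidim_A] bounds it by [d]. *)
  have WE n Z : finitely_generated Z -> Ext0 (d + n).+1 Z W.
    move=> Zf; apply: Ext0_of_idim_le => //.
    by apply: idim_le_mono (fidim_A.1 _ Wd); exact: leq_addr.
  have XW n : Ext0 n.+1 X W.
    have [Sf SW] : finitely_generated S /\ Ext0 n.+1 S W.
      apply: (Ext0_direct_sum noeth einj Wf _ Sd) => M [->|[Z [Zf [P [_ [j [jI jr]]]]]]].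
        split; first exact: fg_regular.
        by apply: Ext0_projl => //; [exact: fg_regular|exact: projective_regular].
      have [Mf MW] := Ext0_syzygy noeth einj n Zf Wf jI jr.
      by split=> //; exact/MW/WE.
    exact: (Ext0_addl noeth einj Sf Wf SX).
  split=> // -[//|n] _; exists (min_resolution noeth flen Xf).
  exact/(Ext0_resolution noeth einj n _ Wf).
have {}XW n : Ext0 n.+1 X W.
  by have [P PW] := XW n.+1 isT; apply/(Ext0_resolution noeth einj n P Wf).
have [|C tC] := tower_exists noeth einj approx (d := d) Xf.
  move=> i C id tC CR; case: A_Gorenstein => -[I [_ Ip]].
    exact: (tower_separated_of_Gorenstein noeth einj approx flen W_dualizing Ip Xf XW id tC CR).
  (* The dual of the left regular module is an injective cogenerator, and the coresolution of A^op
     dualizes to [fid_resolved d DA]. At height [i < d] of the tower, [i.+1] steps of it are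
     used. *)
  pose DA : lmodType A^c := dual Sk tauP ((A^c^c)^o : lmodType A^c^c).
  have DAd : finite_idim DA.
    apply: finite_idim_inj; first exact/dual_fg/fg_regular.
    exact: (@dual_regular_injective _ _ _ _ _ _ _ Rk Sk tauP).
  have DAr : fid_resolved d DA.
    by apply: (dual_fid_resolved Rk (I := I)) => // j jd; exists j.+1; exact: Ip.
  apply: (tower_separated_of_resolved noeth einj W_dualizing Xf XW tC CR (D := DA)).
    exact: (fid_resolved_le noeth einj id).
  exact: (@dual_regular_separated _ _ _ _ _ _ _ Rk Sk tauP C).
have Cf := tower_fg Xf tC.
(* Comparing [C] with itself makes [X] a summand of the d-th syzygy of [C] plus a free module. *)
have CC : stable_retract C C.
  exists idfun, idfun, 0, (fun=> \0), (fun=> \0) => x.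
  by rewrite big_ord0 addr0.
have [Y [j [jI jr XY]]] := tower_syzygy tC (min_resolution noeth flen Cf) CC.
split=> //; apply: direct_sum_retract XY; last by left.
right; exists C; split=> //; exists (min_resolution noeth flen Cf); split.
  exact: min_resolution_minimal.
by exists j.
Qed.
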